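(* Let $\lambda_1\ge\cdots\ge\lambda_q$ denote the eigenvalues of $R$, and assume that $\vec1$ is an eigenvector of $R$. Let $\beta=\sup\{c:\forall\vec x\in\mathcal S,\ \det(\mathcal H_{\Phi_c(\vec x)})>0\}$. Then, when $\frac mn$ is in a compact interval of $]0,\beta[$, the asymptotics of the number of $(n,m)$-$(R,\vec1)$-graphs is $$G_{R,\vec1}(n,m)\sim\frac{n^{2m}}{2^m m!}\,\lambda_1^m\,q^{n-m}\prod_{i=2}^q\left(1-2\frac{\lambda_i}{\lambda_1}\frac mn\right)^{-1/2}.$$ If $\lambda_2$ is positive, $\beta<\frac{\lambda_1}{2\lambda_2}$; otherwise the previous asymptotics holds for $\frac mn$ in any compact interval of $\mathbb R_{>0}$.
   Context: Fix a positive integer $q$ and an irreducible symmetric $q\times q$ matrix $R$ with non-negative coefficients; $\vec1$ is the all-ones vector of size $q$. Asymptotics are for $n\to\infty$ with $R$ fixed. Graphs are labelled, with vertex set $\{1,\dots,n\}$; loops and multiple edges are allowed. For a graph $G$ with $n$ vertices and $m$ edges, $\mathrm{seqv}(G)$ is the number of sequences $(v_1,w_1,\dots,v_m,w_m)\in\{1,\dots,n\}^{2m}$ such that the multiset of unordered pairs $\overline{v_iw_i}$ is the edge multiset of $G$, and $\kappa(G)=\mathrm{seqv}(G)/(2^m m!)$. An $(R,\vec1)$-graph is a labelled graph in which each vertex $v$ is given a type $t(v)\in\{1,\dots,q\}$; its weight is $\omega(G)=\kappa(G)\prod_{\overline{vw}}R_{t(v),t(w)}$ (product over edges, with multiplicity;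 every vertex has weight $1$). The ''number'' of $(R,\vec1)$-graphs in a family is the sum of their weights; $G_{R,\vec 1}(n,m)$ is the number of $(n,m)$-$(R,\vec1)$-graphs, i.e. those with $n$ vertices and $m$ edges. Let $\mathcal S=\{\vec x\in\mathbb R_{\ge0}^q:x_1+\dots+x_q=1\}$ and let $\Phi_c(\vec x)=\sum_i x_i\log x_i-c\log(\vec x^TR\vec x)$ on $\mathcal S$ (with the convention $0\log0=0$). Let $E$ denote a $q\times(q-1)$ matrix with left-kernel of dimension $1$ containing the all-ones row vector (for example, the matrix whose first $q-1$ rows form the identity matrix and whose last row is $(-1,\dots,-1)$). The Hessian matrix (of $\vec\epsilon\mapsto\Phi_c(\vec x+E\vec\epsilon)$ at $\vec\epsilon=0$, for any point $\vec x$ of the interior of $\mathcal S$) is $$\mathcal H_{\Phi_c(\vec x)}=E^T\Big(\mathrm{diag}(\vec x)^{-1}+\tfrac{2c}{\vec x^TR\vec x}\big(\tfrac{2}{\vec x^TR\vec x}R\vec x\,\vec x^TR-R\big)\Big)E ,$$ where $\mathrm{diag}(\vec x)$ is the diagonal matrix with diagonal $\vec x$.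
   Formalization: The strict bound β < λ₁/(2λ₂) is replaced by β ≤ λ₁/(2λ₂), since the strict one is false: for q = 2 and R = [[2,1],[1,2]] (eigenvalues 3 and 1), β = 3/2 = λ₁/(2λ₂). *)

(* Defs.v *)
From mathcomp Require Import all_boot all_order all_algebra.
From mathcomp Require Import all_classical all_reals all_analysis.

Set Implicit Arguments.
Unset Strict Implicit.
Unset Printing Implicit Defensive.

Import Order.TTheory GRing.Theory Num.Theory.
Import numFieldNormedType.Exports.

Local Open Scope classical_set_scope.
Local Open Scope ring_scope.

(* An unordered pair of vertices, possibly a loop, is represented by its
   non-decreasing ordering. *)
Definition edge (n : nat) := {e : 'I_n * 'I_n | (e.1 <= e.2)%N}.

Definition upair (n : nat) (p : 'I_n * 'I_n) : 'I_n * 'I_n :=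
  if (p.1 <= p.2)%N then p else (p.2, p.1).

(* A graph with [m] edges is given by the multiplicities of its edges; these
   are at most [m], so bounding them by ['I_m.+1] excludes no graph and makes
   the type finite. *)
Definition multigraph (n m : nat) :=
  {G : {ffun edge n -> 'I_m.+1} | (\sum_(e : edge n) G e == m)%N}.

Definition mult (n m : nat) (G : multigraph n m) (e : edge n) : nat := val G e.

(* The sequence (v_1, w_1, ..., v_m, w_m) is read as the tuple of pairs
   (v_i, w_i). *)
Definition seqv (n m : nat) (G : multigraph n m) : nat :=
  #|[set s : m.-tuple ('I_n * 'I_n)
      | [forall e : edge n,
           count (fun p => upair p == val e) s == mult G e]]%SET|.

Section Weights.
Context {K : realType}.

Definition kappa (n m : nat) (G : multigraph n m) : K :=
  (seqv G)%:R / (2 ^+ m * m`!%:R).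

Definition weight (q : nat) (R : 'M[K]_q) (n m : nat)
    (t : {ffun 'I_n -> 'I_q}) (G : multigraph n m) : K :=
  kappa G * \prod_(e : edge n) R (t (val e).1) (t (val e).2) ^+ mult G e.

Definition graph_number (q : nat) (R : 'M[K]_q) (n m : nat) : K :=
  \sum_(t : {ffun 'I_n -> 'I_q}) \sum_(G : multigraph n m) weight R t G.

Definition irreducible_matrix (q : nat) (R : 'M[K]_q) : Prop :=
  forall I : {set 'I_q}, I != finset.set0 -> I != [set: 'I_q]%SET ->
    exists i j : 'I_q, [/\ i \in I, j \notin I & R i j != 0].

(* The interior of the simplex is relative to the hyperplane of vectors with
   sum 1. *)
Definition simplex_interior (q : nat) : set 'cV[K]_q :=
  [set x | (forall i, 0 < x i 0) /\ \sum_i x i 0 = 1].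

Definition quad_form (q : nat) (R : 'M[K]_q) (x : 'cV[K]_q) : K :=
  (x^T *m R *m x) 0 0.

(* Hessian at 0 of eps |-> Phi_c(x + E eps), where
   Phi_c(x) = \sum_i x_i log x_i - c log (x^T R x). *)
Definition hessian (q : nat) (R : 'M[K]_q) (E : 'M[K]_(q, q.-1)) (c : K)
    (x : 'cV[K]_q) : 'M[K]_q.-1 :=
  let Q := quad_form R x in
  E^T *m (invmx (diag_mx x^T)
          + (2 * c / Q) *: ((2 / Q) *: (R *m x *m x^T *m R) - R)) *m E.

(* The supremum is taken in the extended reals, since the set is unbounded for
   some [R]. The quantification is over the interior of the simplex because
   diag(x) is singular on its boundary. *)
Definition beta (q : nat) (R : 'M[K]_q) (E : 'M[K]_(q, q.-1)) : \bar K :=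
  ereal_sup [set c%:E | c in
    [set c : K | forall x, simplex_interior x -> 0 < \det (hessian R E c x)]].

(* [lambda] lists lambda_1, ..., lambda_q, so that lambda_i is
   [lambda`_(i - 1)]. *)
Definition asymptotic_number (q : nat) (lambda : seq K) (n m : nat) : K :=
  n%:R ^+ (2 * m) / (2 ^+ m * m`!%:R) * lambda`_0 ^+ m
  * q%:R ^ (n%:Z - m%:Z)
  * \prod_(1 <= i < q)
      (1 - 2 * (lambda`_i / lambda`_0) * (m%:R / n%:R)) `^ (- (1 / 2)).

(* f(n, m) ~ g(n, m) as n tends to infinity, uniformly for m / n in [a, b]. *)
Definition equivalent_on (a b : K) (f g : nat -> nat -> K) : Prop :=
  forall eps : K, 0 < eps -> \forall n \near \oo, forall m : nat,
    a <= m%:R / n%:R <= b -> `|f n m - g n m| <= eps * `|g n m|.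

End Weights.

(* Main.v *)
Require Import Defs.
From mathcomp Require Import all_boot all_order all_algebra.
From mathcomp Require Import all_classical all_reals all_analysis.
From mathcomp Require Import ring lra zify.

Import Order.TTheory GRing.Theory Num.Theory.
Import numFieldNormedType.Exports.

Local Open Scope classical_set_scope.
Local Open Scope ring_scope.

(** Expanding [seqv] over sequences of vertex pairs turns the weighted number
    of graphs into [1 / (2 ^ m * m!)] times the sum, over all typings [t] of
    the vertices, of the [m]-th power of [\sum_v \sum_w R (t v) (t w)]
    ([graph_number_typings]).  Let [lambda_1] be the common row sum of [R], let
    [f_2, ..., f_q] be its other eigenvectors, orthonormal for the uniform law
    on the types ([mean_zero_eigenbasis]), and put
    [rho_k = lambda_k / lambda_1] and [z_k = \sum_v f_k (t v)].  The double sum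
    is then [n ^ 2 * lambda_1 / q] times [P = 1 + \sum_k rho_k (z_k / n) ^ 2],
    and the claim becomes: for a uniformly random typing, the expectation
    [E (P ^ m)] is equivalent to [\prod_k (1 - 2 rho_k m / n) ^ (-1/2)].

    This is what the central limit theorem for [z_k / sqrt n] suggests, and
    Stein's method proves it.  Resampling the type of one vertex gives an
    exchangeable pair, and Stein's identity for that pair yields, with
    [c = m / n],
    [(1 - 2 c rho_k) E (z_k ^ 2 P ^ m) / n = E (P ^ m) + small error]
    ([stein_exchange], [stein_estimate], [second_moment_eq]).  As
    [E (P ^ m.+1) - E (P ^ m)] is
    [n ^ -2 * \sum_k rho_k E (z_k ^ 2 P ^ m)], the moments follow, up to a small
    error, the Euler scheme with step [1 / n] of the equation
    [y' = y * \sum_k rho_k / (1 - 2 c rho_k)] ([moment_step]).  Its solution is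
    the announced product, and a discrete Gronwall inequality concludes, uniformly
    for [m <= b * n] ([moment_asymptotics]).

    The error is small only if typings with [z] of order [n] carry a negligible
    share of [E (P ^ m)].  With [H] the relative entropy of the type frequencies
    with respect to the uniform law, this follows from [c * ln P <= H] for a
    single [c > b] ([far_mass_limit]).  To get that inequality from the
    determinants, observe that at such a [c] the Hessian is invertible on the
    whole interior of the simplex, which is connected, and positive semidefinite
    at one point, near the barycentre of the face spanned by the indices of the
    largest entry of [R] ([exists_hessian_form_ge0]); it is therefore positive
    definite everywhere ([psd_path], [hessian_psd]).  Hence [H - c * ln P] is
    convex along the segments issued from the uniform law, where its value and
    its slope vanish, so it is non-negative ([entropy_bound]).  At the uniform
    law itself the Hessian form at [f_k] is a positive multiple of
    [1 - 2 c rho_k]; this bounds [beta] ([beta_le]) and keeps the factors of the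
    product away from [0].  When [lambda_2 <= 0] one has [P <= 1], so the entropy
    inequality is trivial for every [c] ([equivalent_nonpos]). *)

Set Implicit Arguments.
Unset Strict Implicit.
Unset Printing Implicit Defensive.

(** * Counting graphs through sequences of vertex pairs *)

Section Counting.
Variables (K : realType) (q : nat).
Implicit Types (R : 'M[K]_q) (n m : nat).

Lemma upair_le n (p : 'I_n * 'I_n) : ((upair p).1 <= (upair p).2)%N.
Proof.
rewrite /upair; case: ifP => //= /negbT.
by rewrite -ltnNge => /ltnW.
Qed.

Definition edge_of n (p : 'I_n * 'I_n) : edge n :=
  exist _ (upair p) (upair_le p).

Lemma upairE n (p : 'I_n * 'I_n) (e : edge n) :
  (upair p == val e) = (edge_of p == e).
Proof. by []. Qed.

Definition graph_of_mult n m (s : m.-tuple ('I_n * 'I_n)) (e : edge n) :=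
  count (fun p => upair p == val e) s.

Lemma sum_graph_of_mult n m (s : m.-tuple ('I_n * 'I_n)) :
  (\sum_(e : edge n) graph_of_mult s e)%N = m.
Proof.
under eq_bigr do rewrite /graph_of_mult -sum1_count.
rewrite (exchange_big_dep xpredT) //=.
under eq_bigr => p _ do rewrite (big_pred1 (edge_of p)) //.
by rewrite sum1_size size_tuple.
Qed.

Lemma graph_of_mult_lt n m (s : m.-tuple ('I_n * 'I_n)) (e : edge n) :
  (graph_of_mult s e < m.+1)%N.
Proof. by rewrite ltnS /graph_of_mult -[X in (_ <= X)%N](size_tuple s) count_size. Qed.

(** Symmetry of [R] makes the weight of a pair independent of the orientation
    forgotten by [upair]. *)
Lemma prod_over_edges R n m (t : {ffun 'I_n -> 'I_q})
    (s : m.-tuple ('I_n * 'I_n)) : R^T = R ->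
  \prod_(e : edge n) R (t (val e).1) (t (val e).2) ^+ graph_of_mult s e
  = \prod_(p <- s) R (t p.1) (t p.2).
Proof.
move=> symR.
have expE (e : edge n) (x : K) : x ^+ graph_of_mult s e
    = \prod_(p <- s | upair p == val e) x.
  by rewrite big_const_seq -iter_mulr_1.
rewrite (eq_bigr (fun e : edge n =>
    \prod_(p <- s | upair p == val e) R (t (val e).1) (t (val e).2))); last first.
  by move=> e _; exact: expE.
rewrite (exchange_big_dep xpredT) //=; apply: eq_bigr => p _.
rewrite (big_pred1 (edge_of p)) /=; last by move=> e; rewrite upairE eq_sym.
by rewrite /upair; case: ifP => //= _; rewrite -[in LHS]symR mxE.
Qed.

Lemma graph_of_subproof n m (s : m.-tuple ('I_n * 'I_n)) :
  (\sum_(e : edge n) [ffun e => Ordinal (graph_of_mult_lt s e)] e == m)%N.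
Proof.
by rewrite -[X in _ == X](sum_graph_of_mult s); apply/eqP/eq_bigr => e _; rewrite ffunE.
Qed.

Definition graph_of n m (s : m.-tuple ('I_n * 'I_n)) : multigraph n m :=
  exist (fun G : {ffun edge n -> 'I_m.+1} => \sum_(e : edge n) G e == m)%N
    _ (graph_of_subproof s).

(** A sequence of pairs lists the edges of exactly one multigraph; this is what
    lets [seqv] be summed over all multigraphs. *)
Lemma graph_ofE n m (s : m.-tuple ('I_n * 'I_n)) (G : multigraph n m) :
  [forall e : edge n, count (fun p => upair p == val e) s == mult G e]
  = (G == graph_of s).
Proof.
apply/forallP/eqP => [h | -> e]; last by rewrite /mult /= ffunE.
apply/val_inj/ffunP => e; apply/val_inj; rewrite /= ffunE.
by have /eqP := h e.
Qed.

Lemma exp_sum_tuple (I : finType) (h : I -> K) m :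
  \sum_(s : m.-tuple I) \prod_(p <- s) h p = (\sum_p h p) ^+ m.
Proof.
elim: m => [|m IH].
  rewrite expr0 (big_pred1 [tuple]) ?big_nil // => s.
  by rewrite /= [s]tuple0; apply/esym/eqP/val_inj.
rewrite exprS -IH big_distrl /=.
under [RHS]eq_bigr do rewrite big_distrr /=.
rewrite pair_bigA /=.
rewrite (reindex (fun p : I * m.-tuple I => [tuple of p.1 :: p.2])) /=; last first.
  exists (fun s : m.+1.-tuple I => (thead s, [tuple of behead s])) => [[x s] _|s _] /=.
    by congr (_, _); apply/val_inj.
  by rewrite -tuple_eta.
by apply: eq_bigr => p _; rewrite big_cons.
Qed.

(** The factor [kappa] counts the sequences that list the edges of a graph, so the
    sum over graphs is a sum over all sequences of [m] pairs, which factors as an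
    [m]-th power. *)
Lemma graph_number_typings R n m : R^T = R ->
  graph_number R n m
  = (\sum_(t : {ffun 'I_n -> 'I_q})
       (\sum_v \sum_w R (t v) (t w)) ^+ m) / (2 ^+ m * m`!%:R).
Proof.
move=> symR; rewrite /graph_number big_distrl /=; apply: eq_bigr => t _.
rewrite pair_bigA /= -exp_sum_tuple big_distrl /=.
under [RHS]eq_bigr => s _ do
  rewrite -(prod_over_edges t s symR) -[X in X / _](big_pred1_eq (+%R)
    (graph_of s) (fun G : multigraph n m => \prod_(e : edge n)
      R (t (val e).1) (t (val e).2) ^+ graph_of_mult s e)).
under [RHS]eq_bigr do rewrite big_distrl /=.
rewrite (exchange_big_dep xpredT) //=; apply: eq_bigr => G _.
rewrite /weight /kappa /seqv -sum1_card natr_sum !big_distrl /=.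
apply: eq_big => [s | s /[!inE]]; first by rewrite inE graph_ofE.
by rewrite graph_ofE => /eqP -> ; rewrite mul1r mulrC; congr (_ / _);
  apply: eq_bigr => e _; rewrite /mult /= ffunE.
Qed.
End Counting.

(** * Spectral theorem for real symmetric matrices *)

Section Spectral.
Variable K : realType.

Lemma sum_sqr_eq0 n (w : 'cV[K]_n) : (w^T *m w) 0 0 = 0 -> w = 0.
Proof.
rewrite mxE => h; apply/matrixP => i j; rewrite ord1 mxE.
have := h; rewrite (eq_bigr (fun k => w k 0 ^+ 2)); last first.
  by move=> k _; rewrite mxE expr2.
move/eqP; rewrite psumr_eq0 => [/allP /(_ i)|k _]; last exact: sqr_ge0.
by rewrite mem_index_enum sqrf_eq0 => /(_ isT) /eqP.
Qed.

(** The reflection exchanging the first basis vector and [u]; being an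
    involution, it conjugates matrices by itself. *)
Lemma householder n (u : 'cV[K]_(1 + n)) : u^T *m u = 1%:M ->
  exists O : 'M[K]_(1 + n),
    [/\ O^T = O, O *m O = 1%:M & O *m delta_mx 0 0 = u].
Proof.
move=> u1; pose e : 'cV[K]_(1 + n) := delta_mx 0 0.
have [ue|ue] := eqVneq u e.
  by exists 1%:M; split; rewrite ?trmx1 ?mul1mx.
pose w := u - e; pose s := (w^T *m w) 0 0.
have s0 : s != 0.
  by apply: contraNneq ue => /sum_sqr_eq0 /eqP; rewrite subr_eq0.
have wwE : w^T *m w = s%:M by rewrite [LHS]mx11_scalar.
have ee : e^T *m e = 1%:M.
  rewrite trmx_delta mul_delta_mx; apply/matrixP => i j.
  by rewrite !ord1 !mxE.
have ue_eq : u^T *m e = e^T *m u.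
  by rewrite -[LHS]trmxK trmx_mul trmxK [LHS]mx11_scalar mxE -mx11_scalar.
pose a := (e^T *m u) 0 0.
have euE : e^T *m u = a%:M by rewrite [LHS]mx11_scalar.
have wT : w^T = u^T - e^T by rewrite /w linearB.
have sE : s = 2 - 2 * a.
  rewrite /s wT mulmxBl /w !mulmxBr u1 ue_eq euE ee.
  by rewrite !mxE eqxx /=; ring.
exists (1%:M - (2 / s) *: (w *m w^T)); split.
- by rewrite linearB /= trmx1 linearZ /= trmx_mul trmxK.
- rewrite mulmxBl mul1mx mulmxBr mulmx1 -scalemxAl -scalemxAr.
  rewrite mulmxA -(mulmxA w) wwE mul_mx_scalar -scalemxAl !scalerA.
  have -> : 2 / s * (2 / s * s) = 2 / s + 2 / s by field.
  by rewrite scalerDl opprB addrK subrK.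
- rewrite -/e mulmxBl mul1mx -scalemxAl -mulmxA.
  have -> : w^T *m e = (a - 1)%:M.
    by rewrite wT mulmxBl ue_eq euE ee; apply/matrixP => i j; rewrite !mxE; ring.
  rewrite mul_mx_scalar scalerA.
  have -> : 2 / s * (a - 1) = -1 by rewrite sE in s0 *; field.
  by rewrite scaleN1r opprK /w addrC subrK.
Qed.

Lemma char_poly_conj n (O A : 'M[K]_n) : O *m O = 1%:M ->
  char_poly (O *m A *m O) = char_poly A.
Proof.
move=> OO; rewrite /char_poly.
have OO' : map_mx polyC O *m map_mx polyC O = 1%:M.
  by rewrite -map_mxM OO map_mx1.
have -> : char_poly_mx (O *m A *m O)
    = map_mx polyC O *m char_poly_mx A *m map_mx polyC O.
  rewrite /char_poly_mx mulmxBr mulmxBl !map_mxM; congr (_ - _).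
  by rewrite mul_mx_scalar -scalemxAl OO' scalemx1.
rewrite !det_mulmx mulrC mulrA -det_mulmx OO' det1 mul1r //.
Qed.

(** After the reflection that sends the first basis vector to the eigenvector, the
    first column of the conjugated matrix vanishes below the diagonal; by symmetry so
    does the first row. *)
Lemma deflation n (A : 'M[K]_(1 + n)) (x : K) (u : 'cV[K]_(1 + n)) :
  A^T = A -> u^T *m u = 1%:M -> A *m u = x *: u ->
  exists (O : 'M[K]_(1 + n)) (B : 'M[K]_n),
    [/\ O^T = O, O *m O = 1%:M, O *m delta_mx 0 0 = u, B^T = B &
        A = O *m block_mx x%:M 0 0 B *m O /\
        char_poly A = ('X - x%:P) * char_poly B].
Proof.
move=> symA u1 Au; have [ O [symO OO Oe]] := householder u1.
pose C := O *m A *m O.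
have symC : C^T = C by rewrite /C !trmx_mul symO symA mulmxA.
have Ce : C *m delta_mx 0 0 = x *: (delta_mx 0 0 : 'cV_(1 + n)).
  by rewrite /C -!mulmxA Oe Au -Oe -scalemxAr mulmxA OO mul1mx.
have AE : A = O *m C *m O by rewrite /C !mulmxA OO mul1mx -mulmxA OO mulmx1.
have cC : char_poly A = char_poly C by rewrite /C char_poly_conj.
clearbody C.
have C0 i : C i 0 = x * (i == 0)%:R.
  have := congr1 (fun M : 'cV_(1 + n) => M i 0) Ce.
  by rewrite -colE !mxE andbT.
have CE : C = block_mx x%:M 0 0 (drsubmx C).
  have l0 : lshift n (0 : 'I_1) = 0 :> 'I_(1 + n) by apply/val_inj.
  have r0 i : (rshift 1 i == 0 :> 'I_(1 + n)) = false by [].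
  rewrite -[LHS]submxK; congr block_mx; apply/matrixP => i j; rewrite ?ord1 !mxE l0.
  - by rewrite C0 eqxx mulr1.
  - by rewrite -symC mxE C0 r0 mulr0.
  - by rewrite C0 r0 mulr0.
exists O, (drsubmx C); split=> //; first by rewrite trmx_drsub symC.
split; first by rewrite -CE.
rewrite cC CE /char_poly char_block_diag_mx det_lblock.
congr (_ * _); first by rewrite det_mx11 !mxE eqxx /= mulr1n.
by rewrite block_mxKdr.
Qed.

Definition spectral_decomposition n (A V : 'M[K]_n) (l : seq K) : Prop :=
  V^T *m V = 1%:M /\ A = V *m diag_mx (\row_i l`_i) *m V^T.

(** The induction step of the spectral theorem.  The first column of the resulting
    basis is the image of the first basis vector under [O]: this is how a prescribed
    eigenvector is kept in the basis. *)
Lemma spectral_glue n (O : 'M[K]_(1 + n)) (B V : 'M[K]_n) x l :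
  O^T = O -> O *m O = 1%:M -> spectral_decomposition B V l ->
  spectral_decomposition (O *m block_mx x%:M 0 0 B *m O)
    (O *m block_mx 1%:M 0 0 V) (x :: l) /\
  (O *m block_mx 1%:M 0 0 V) *m (delta_mx 0 0 : 'cV_(1 + n))
    = O *m delta_mx 0 0.
Proof.
move=> symO OO [VV ->]; split; last first.
  rewrite -mulmxA; congr (_ *m _).
  have -> : (delta_mx 0 0 : 'cV[K]_(1 + n)) = col_mx 1%:M 0.
    apply/matrixP => i j; rewrite ord1 !mxE; case: splitP => k ik; rewrite !mxE.
      by rewrite ord1 in ik *; rewrite (_ : i = 0) //; apply/val_inj.
    by rewrite (_ : i == 0 = false) //; apply/eqP => i0; rewrite i0 in ik.
  by rewrite mul_block_col !mulmx1 !mulmx0 !addr0.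
have Dblock : diag_mx (\row_i (x :: l)`_i) =
    block_mx x%:M 0 0 (diag_mx (\row_i l`_i)) :> 'M[K]_(1 + n).
  rewrite -[LHS]submxK; congr block_mx; apply/matrixP => i j; rewrite !mxE.
  - by rewrite !ord1.
  - by rewrite eq_lrshift mulr0n.
  - by rewrite eq_rlshift mulr0n.
  - by rewrite eq_rshift.
split.
  rewrite trmx_mul symO tr_block_mx !trmx0 trmx1 -mulmxA (mulmxA O) OO mul1mx.
  rewrite mulmx_block !mulmx0 !mul0mx !mulmx1 !addr0 add0r VV.
  by rewrite -scalar_mx_block.
rewrite Dblock trmx_mul symO tr_block_mx !trmx0 trmx1 !mulmxA; congr (_ *m _).
rewrite -!(mulmxA O); congr (_ *m _).
by rewrite !mulmx_block !mulmx0 !mul0mx !mulmx1 !mul1mx !addr0 !add0r ?mulmx0 ?mul0mx.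
Qed.

(** The factorisation of the characteristic polynomial provides the real
    eigenvalues, and deflation removes them one at a time. *)
Theorem real_spectral n (A : 'M[K]_n) (l : seq K) :
  A^T = A -> char_poly A = \prod_(x <- l) ('X - x%:P) ->
  exists V, spectral_decomposition A V l.
Proof.
elim: n A l => [|n IH] A l symA cA.
  by exists 1%:M; split; apply/matrixP => -[].
case: l cA => [|x l] cA.
  by have := size_char_poly A; rewrite cA big_nil size_poly1.
have : eigenvalue A x by rewrite eigenvalue_root_char cA big_cons rootM root_XsubC eqxx.
case/eigenvalueP => v vA v0.
pose s := (v *m v^T) 0 0.
have s0 : 0 < s.
  rewrite lt_neqAle; apply/andP; split; last first.
    by rewrite /s mxE; apply: sumr_ge0 => i _; rewrite mxE -expr2 sqr_ge0.
  rewrite eq_sym; apply: contra_neq v0 => s0; apply: trmx_inj; rewrite trmx0.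
  by apply: sum_sqr_eq0; rewrite trmxK.
pose u := (Num.sqrt s)^-1 *: v^T.
have u1 : u^T *m u = 1%:M.
  have -> : u^T = (Num.sqrt s)^-1 *: v by rewrite /u linearZ /= trmxK.
  rewrite -scalemxAl -scalemxAr scalerA.
  rewrite [v *m _]mx11_scalar -/s scale_scalar_mx -invfM -expr2 sqr_sqrtr ?ltW //.
  by rewrite mulVf // gt_eqF.
have Au : A *m u = x *: u.
  rewrite /u -scalemxAr.
  have -> : A *m v^T = x *: v^T by rewrite -[A]symA -trmx_mul vA linearZ.
  by rewrite !scalerA mulrC.
have [ O [B [symO OO _ symB [AE cB]]]] := @deflation n A x u symA u1 Au.
have {}cB : char_poly B = \prod_(y <- l) ('X - y%:P).
  have : 'X - x%:P != 0 :> {poly K} by rewrite polyXsubC_eq0.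
  by move/mulfI; apply; rewrite -cB cA big_cons.
have [V hV] := IH B l symB cB.
by exists (O *m block_mx 1%:M 0 0 V); rewrite AE; apply: (proj1 (spectral_glue x symO OO hV)).
Qed.

End Spectral.

(** * Eigenvectors of a symmetric matrix with constant row sums *)

Section ConstantRowSums.
Variables (K : realType) (p : nat).
Variables (R : 'M[K]_p.+1) (mu : K) (lambda : seq K).
Hypothesis R_sym : R^T = R.
Hypothesis R_ge0 : forall i j, 0 <= R i j.
Hypothesis R_one : R *m const_mx 1 = mu *: (const_mx 1 : 'cV[K]_p.+1).
Hypothesis lambda_eigen : char_poly R = \prod_(x <- lambda) ('X - x%:P).
Hypothesis lambda_sorted : sorted (fun x y : K => y <= x) lambda.

Lemma row_sum i : \sum_j R i j = mu.
Proof.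
have := congr1 (fun M : 'cV_p.+1 => M i 0) R_one; rewrite !mxE mulr1 => <-.
by apply: eq_bigr => j _; rewrite mxE mulr1.
Qed.

(** Compare both sides of the eigenvector equation at a coordinate of largest
    absolute value. *)
Lemma eigenvalue_le_row_sum x : x \in lambda -> x <= mu.
Proof.
move=> xl; have : eigenvalue R x.
  by rewrite eigenvalue_root_char lambda_eigen root_prod_XsubC.
case/eigenvalueP => v vR v0.
have [i _ hi] := @arg_maxP _ K 'I_p.+1 ord0 xpredT (fun i => `|v 0 i|) isT.
have vi0 : 0 < `|v 0 i|.
  rewrite normr_gt0; apply: contraNneq v0 => vi; apply/eqP/rowP => j.
  apply/eqP; rewrite mxE -normr_le0; apply: le_trans (hi j isT) _.
  by rewrite vi normr0.
have E : x * v 0 i = \sum_j v 0 j * R j i.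
  by have := congr1 (fun M : 'rV_p.+1 => M 0 i) vR; rewrite !mxE.
rewrite -(ler_pM2r vi0); apply: le_trans (ler_norm _) _.
rewrite normrM normr_id -normrM E; apply: le_trans (ler_norm_sum _ _ _) _.
rewrite -(row_sum i) mulr_suml; apply: ler_sum => j _.
rewrite normrM mulrC -[in R j i]R_sym mxE ger0_norm //.
by apply: ler_wpM2l => //; apply: hi.
Qed.

Lemma size_eigenvalues : size lambda = p.+1.
Proof.
by have := size_char_poly R; rewrite lambda_eigen size_prod_XsubC => -[].
Qed.

Lemma head_eigenvalue : lambda`_0 = mu.
Proof.
have mu_in : mu \in lambda.
  rewrite -root_prod_XsubC -lambda_eigen -eigenvalue_root_char.
  apply/eigenvalueP; exists (const_mx 1).
    by apply: trmx_inj; rewrite trmx_mul linearZ /= !trmx_const R_sym.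
  by apply/eqP => /rowP /(_ 0); rewrite !mxE => /eqP; rewrite oner_eq0.
apply/eqP; rewrite eq_le; apply/andP; split.
  by apply: eigenvalue_le_row_sum; rewrite mem_nth // size_eigenvalues.
case: lambda lambda_sorted mu_in => [//|x l] /= srt.
rewrite inE => /orP[/eqP -> //|].
have tr : transitive (fun x y : K => y <= x) by move=> y z w h1 h2; apply: le_trans h2 h1.
by move: srt; rewrite path_sortedE // => /andP[/allP h _] /h.
Qed.

(** The constant eigenvector is deflated first; the remaining eigenvectors are
    multiplied by [sqrt q], which makes them orthonormal for the uniform law on the
    types.  The third property is the completeness of the full basis, with the
    constant vector moved to the right-hand side. *)
Lemma mean_zero_eigenbasis : exists f : 'I_p -> 'I_p.+1 -> K,
  [/\ forall k, \sum_a f k a = 0,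
      forall k l, \sum_a f k a * f l a = p.+1%:R * (k == l)%:R,
      forall a b, \sum_k f k a * f k b = p.+1%:R * (a == b)%:R - 1,
      forall a b, R a b = (mu + \sum_(k < p) lambda`_k.+1 * (f k a * f k b)) / p.+1%:R
      & forall k a, \sum_b R a b * f k b = lambda`_k.+1 * f k a].
Proof.
pose q : K := p.+1%:R; have q0 : 0 < q by rewrite ltr0n.
pose sq := Num.sqrt q; have sq0 : 0 < sq by rewrite sqrtr_gt0.
have sq2 : sq * sq = q by rewrite -expr2 sqr_sqrtr // ltW.
pose u : 'cV[K]_(1 + p) := sq^-1 *: const_mx 1.
have u1 : u^T *m u = 1%:M.
  apply/matrixP => i j; rewrite !ord1 !mxE.
  under eq_bigr do rewrite !mxE mulr1 -invfM sq2.
  by rewrite sumr_const card_ord -[_ *+ _]mulr_natl divff // gt_eqF.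
have Ru : R *m u = mu *: u by rewrite -scalemxAr R_one !scalerA mulrC.
have [ O [B [symO OO Oe symB [RE cR]]]] := @deflation K p R mu u R_sym u1 Ru.
have lE : lambda = mu :: behead lambda.
  by rewrite -head_eigenvalue; case: lambda size_eigenvalues.
have cB : char_poly B = \prod_(y <- behead lambda) ('X - y%:P).
  have : 'X - mu%:P != 0 :> {poly K} by rewrite polyXsubC_eq0.
  by move/mulfI; apply; rewrite -cR lambda_eigen {1}lE big_cons.
have [V0 hV0] := real_spectral symB cB.
have [[VV RV] Ve] := spectral_glue mu symO OO hV0.
rewrite -RE -lE in RV; rewrite Oe in Ve.
set V := O *m block_mx 1%:M 0 0 V0 in VV RV Ve.
have V0E a : V a 0 = sq^-1.
  have := congr1 (fun M : 'cV_(1 + p) => M a 0) Ve.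
  by rewrite -colE !mxE mulr1.
have VVT : V *m V^T = 1%:M by apply: mulmx1C.
clearbody V.
have VE1 (k l : 'I_(1 + p)) : \sum_a V a k * V a l = (k == l)%:R.
  have := congr1 (fun M : 'M[K]_(1 + p) => M k l) VV; rewrite !mxE => <-.
  by apply: eq_bigr => a _; rewrite mxE.
have VE2 (a b : 'I_(1 + p)) : \sum_k V a k * V b k = (a == b)%:R.
  have := congr1 (fun M : 'M[K]_(1 + p) => M a b) VVT; rewrite !mxE => <-.
  by apply: eq_bigr => k _; rewrite mxE.
have VE3 (a b : 'I_(1 + p)) : R a b = \sum_(k < p.+1) lambda`_k * (V a k * V b k).
  have := congr1 (fun M : 'M[K]_(1 + p) => M a b) RV; rewrite [X in _ = X -> _]mxE => ->.
  apply: eq_bigr => k _; rewrite mul_mx_diag !mxE; ring.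
exists (fun k a => sq * V a (lift 0 k)); split.
- move=> k; rewrite -mulr_sumr.
  have := VE1 0 (lift 0 k); rewrite (negPf (neq_lift _ _)).
  under eq_bigr do rewrite V0E.
  rewrite -mulr_sumr => /eqP; rewrite mulf_eq0 invr_eq0 (gt_eqF sq0) /= => /eqP ->.
  by rewrite mulr0.
- move=> k l; under eq_bigr do rewrite mulrACA sq2.
  by rewrite -mulr_sumr VE1 (inj_eq lift_inj).
- move=> a b; under eq_bigr do rewrite mulrACA sq2.
  rewrite -mulr_sumr -(VE2 a b) big_ord_recl /= !V0E -invfM sq2 mulrDr divff ?gt_eqF //.
  ring.
- move=> a b; rewrite VE3 big_ord_recl /= !V0E -invfM sq2 head_eigenvalue mulrDl.
  congr (_ + _); rewrite mulr_suml; apply: eq_bigr => k _.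
  by rewrite mulrACA sq2; field; rewrite gt_eqF.
- move=> k a; under eq_bigr do rewrite VE3 mulr_suml.
  rewrite exchange_big /= (bigD1 (lift 0 k)) //= [X in _ + X = _]big1 ?addr0; last first.
    move=> l lk.
    transitivity (lambda`_l * V a l * sq * \sum_b V b l * V b (lift 0 k)).
      by rewrite mulr_sumr; apply: eq_bigr => b _; ring.
    by rewrite VE1 (negPf lk) mulr0.
  transitivity (lambda`_k.+1 * V a (lift 0 k) * sq *
                \sum_b V b (lift 0 k) * V b (lift 0 k)).
    by rewrite mulr_sumr; apply: eq_bigr => b _; ring.
  by rewrite VE1 eqxx mulr1; ring.
Qed.

End ConstantRowSums.

(** * Elementary real inequalities *)

Section RealBounds.
Variable K : realType.
Implicit Types x y : K.

(** By induction on [m]: the error [e_m] satisfies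
    [e_(m + 1) = m * x ^ 2 + (1 - x) * e_m]. *)
Lemma bernoulli_second_order x m : m%:R * `|x| <= 1 ->
  `|(1 - x) ^+ m - 1 + m%:R * x| <= (m%:R * x) ^+ 2.
Proof.
elim: m => [|m IH] hm.
  by rewrite expr0 subrr mul0r addr0 normr0 expr0n.
have hm' : m%:R * `|x| <= 1.
  by apply: le_trans hm; rewrite ler_wpM2r // ler_nat.
have m0 : 0 <= m%:R :> K by [].
have {}IH := IH hm'.
have -> : (1 - x) ^+ m.+1 - 1 + m.+1%:R * x
  = m%:R * x ^+ 2 + (1 - x) * ((1 - x) ^+ m - 1 + m%:R * x).
  rewrite exprS -natr1; ring.
apply: le_trans (ler_normD _ _) _.
have -> : `|m%:R * x ^+ 2| = m%:R * x ^+ 2.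
  by rewrite ger0_norm // mulr_ge0 // sqr_ge0.
rewrite normrM.
have h1 : `|1 - x| <= 1 + `|x| by apply: le_trans (ler_normB _ _) _; rewrite normr1.
have h2 : `|1 - x| * `|(1 - x) ^+ m - 1 + m%:R * x|
    <= (1 + `|x|) * (m%:R * x) ^+ 2.
  by apply: ler_pM.
apply: le_trans (lerD (lexx _) h2) _.
rewrite -natr1 !exprMn -[x ^+ 2]real_normK ?num_real //.
set y := `|x| in hm' *; have y0 : 0 <= y by rewrite /y.
have : m%:R * y * (m%:R * y ^+ 2) <= 1 * (m%:R * y ^+ 2).
  by apply: ler_wpM2r => //; rewrite mulr_ge0 // sqr_ge0.
have : 0 <= y ^+ 2 by apply: sqr_ge0.
nra.
Qed.

(** The change of [P ^+ m] when [P] moves by [(2 * S - Q) / n ^ 2] and [m = c * n].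
    The displacement has relative size [(u + 1) / n ^ 2] with [u <= d * n], so [m] times
    it stays below [1] and a second-order expansion applies; the remaining terms come
    from replacing [P ^+ m.-1] by [P ^+ m], which costs [P - 1], and from [Q]. *)
Lemma pow_perturbation (b B1 B2 B3 c d n u P P' S Q : K) m :
  0 <= b -> 0 <= B1 -> 0 <= B2 -> 0 <= B3 ->
  0 < n -> m%:R = c * n -> 0 <= c <= b ->
  0 <= u <= d * n -> 0 <= d <= 1 -> B3 * d <= 2^-1 ->
  4 * b * (2 * B1 + B2) * d <= 1 -> 4 * b * (2 * B1 + B2) <= n ->
  P - P' = (2 * S - Q) / n ^+ 2 ->
  `|S| <= B1 * u -> `|Q| <= B2 -> `|P - 1| <= B3 * u ^+ 2 / n ^+ 2 ->
  `|P ^+ m - P' ^+ m - P ^+ m * (2 * c / n * S)|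
  <= P ^+ m * (((2 * b * (2 * B1 + B2)) ^+ 2 + 2 * b * (2 * B1 + B2) * B3)
                 * ((u + 1) / n) ^+ 2 + b * B2 / n).
Proof.
set C := 2 * B1 + B2.
move=> b0 B10 B20 B30 n0 mE /andP[c0 cb] /andP[u0 ud] /andP[d0 d1] hB3 hC hn PP hS hQ hP.
have C0 : 0 <= C by rewrite /C; lra.
have un : u / n <= d by rewrite ler_pdivrMr.
have un0 : 0 <= u / n by rewrite divr_ge0 // ltW.
have hP' : `|P - 1| <= B3 * (u / n) ^+ 2.
  by rewrite expr_div_n mulrA.
have hB : B3 * (u / n) ^+ 2 <= 2^-1.
  apply: le_trans hB3; apply: ler_wpM2l => //; nra.
have Phalf : 2^-1 <= P.
  by move: hP'; rewrite ler_norml => /andP[]; lra.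
have P0 : 0 < P by lra.
have Pinv : P^-1 <= 2 by rewrite -[2]invrK lef_pV2 // posrE; lra.
set A := P - P'.
have W0 : 0 <= (u + 1) / n by rewrite divr_ge0 //; lra.
have hA : `|A| * n <= C * ((u + 1) / n).
  rewrite /A PP normrM normfV [`|n ^+ 2|]ger0_norm ?sqr_ge0 //.
  have -> : `|2 * S - Q| / n ^+ 2 * n = `|2 * S - Q| / n by field; lra.
  rewrite mulrA ler_pM2r ?invr_gt0 //.
  apply: le_trans (ler_normB _ _) _; rewrite normrM ger0_norm // /C; nra.
set x := A / P.
have xA : `|x| <= 2 * `|A|.
  rewrite /x normrM normfV (ger0_norm (ltW P0)) mulrC.
  exact: ler_wpM2r.
have Wd : (u + 1) / n = u / n + n^-1 by rewrite mulrDl mul1r.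
have hmx : m%:R * `|x| <= 2 * b * C * ((u + 1) / n).
  rewrite mE.
  have h1 : c * n * `|x| <= b * (2 * (`|A| * n)).
    have -> : b * (2 * (`|A| * n)) = b * n * (2 * `|A|) by ring.
    apply: ler_pM => //; first by rewrite mulr_ge0 // ltW.
    by rewrite ler_pM2r.
  apply: le_trans h1 _.
  have -> : 2 * b * C * ((u + 1) / n) = b * (2 * (C * ((u + 1) / n))) by ring.
  by apply: ler_wpM2l => //; apply: ler_wpM2l.
have hmx1 : m%:R * `|x| <= 1.
  apply: le_trans hmx _; rewrite Wd mulrDr.
  have i1 : 2 * b * C * (u / n) <= 2 * b * C * d by apply: ler_wpM2l => //; nra.
  have i2 : 2 * b * C * n^-1 <= 2^-1.
    by rewrite ler_pdivrMr //; lra.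
  lra.
have hB1 := bernoulli_second_order hmx1.
have P'E : P' = P * (1 - x).
  by rewrite /x mulrBr mulr1 mulrC divfK ?gt_eqF // /A; ring.
have Pm0 : 0 <= P ^+ m by rewrite exprn_ge0 // ltW.
have -> : P ^+ m - P' ^+ m - P ^+ m * (2 * c / n * S)
  = P ^+ m * (- ((1 - x) ^+ m - 1 + m%:R * x)
              + (m%:R * (x * (1 - P)) - c * Q / n)).
  rewrite P'E exprMn.
  have -> : x * (1 - P) = x - A by rewrite /x; field; rewrite gt_eqF.
  have -> : m%:R * (x - A) = m%:R * x - c * (2 * S - Q) / n.
    by rewrite /A PP mE; field; lra.
  by field; lra.
rewrite normrM (ger0_norm Pm0); apply: ler_wpM2l => //.
apply: le_trans (ler_normD _ _) _; rewrite normrN mulrDl -[leRHS]addrA; apply: lerD.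
  apply: le_trans hB1 _; rewrite -[_ ^+ 2]real_normK ?num_real // -exprMn.
  have bC0 : 0 <= 2 * b * C * ((u + 1) / n).
    by apply: mulr_ge0 W0; apply: mulr_ge0 C0; apply: mulr_ge0.
  apply: lerXn2r; rewrite ?nnegrE ?normr_ge0 //.
  by rewrite normrM [`|m%:R|]ger0_norm.
apply: le_trans (ler_normB _ _) _; apply: lerD.
  rewrite mulrA normrM distrC normrM ger0_norm //.
  have -> : 2 * b * C * B3 * ((u + 1) / n) ^+ 2
    = (2 * b * C * ((u + 1) / n)) * (B3 * ((u + 1) / n)) by ring.
  apply: ler_pM => //.
  apply: le_trans hP' _; apply: ler_wpM2l => //.
  have ni : 0 <= n^-1 by rewrite invr_ge0 ltW.
  rewrite Wd; nra.
rewrite !normrM normfV (ger0_norm (ltW n0)) (ger0_norm c0) ler_pM2r ?invr_gt0 //.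
exact: ler_pM.
Qed.

Lemma sqrt_second_order x : x <= 1 ->
  `|Num.sqrt (1 - x) - 1 + x / 2| <= x ^+ 2 / 2.
Proof.
move=> x1; set s := Num.sqrt (1 - x).
have s0 : 0 <= s by apply: sqrtr_ge0.
have s2 : s ^+ 2 = 1 - x by rewrite sqr_sqrtr // subr_ge0.
have -> : s - 1 + x / 2 = - ((1 - s) ^+ 2 / 2).
  by have -> : x = 1 - s ^+ 2; [rewrite s2; ring | field].
rewrite normrN ger0_norm ?divr_ge0 ?sqr_ge0 // ler_pM2r ?invr_gt0 //.
have -> : x = (1 - s) * (1 + s) by rewrite -subr_sqr s2; ring.
rewrite exprMn ler_peMr ?sqr_ge0 //; nra.
Qed.

(** First-order expansion of a product of square roots, by induction on the number of
    factors; the powers of [2] and [4] are crude bounds that survive the induction. *)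
Lemma prod_sqrt_second_order (I : Type) (s : seq I) (x : I -> K) y :
  0 <= y <= 2^-1 -> (forall i, `|x i| <= y) ->
  0 <= \prod_(i <- s) Num.sqrt (1 - x i) <= 2 ^+ size s /\
  `|\prod_(i <- s) Num.sqrt (1 - x i) - 1 + (\sum_(i <- s) x i) / 2|
  <= 4 ^+ size s * y ^+ 2.
Proof.
move=> /andP[y0 y12] xy.
have sumle (s' : seq I) : `|\sum_(i <- s') x i| <= (size s')%:R * y.
  elim: s' => [|i s' IH]; first by rewrite big_nil normr0 mul0r.
  rewrite big_cons /= -natr1 mulrDl mul1r addrC.
  by apply: le_trans (ler_normD _ _) _; apply: lerD.
elim: s => [|i s [/andP[P0 P1] IH]].
  by rewrite !big_nil !expr0 subrr mul0r addr0 normr0 mul1r sqr_ge0 ler01 lexx.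
have xi : - y <= x i <= y by rewrite -ler_norml.
have xi1 : x i <= 1 by lra.
have := sqrt_second_order xi1; rewrite !big_cons /=.
have : 0 <= Num.sqrt (1 - x i) by apply: sqrtr_ge0.
have : Num.sqrt (1 - x i) ^+ 2 = 1 - x i by rewrite sqr_sqrtr // subr_ge0.
move: (Num.sqrt _) => u; move: IH P0 P1.
set P := \prod_(_ <- _) _; set S := \sum_(_ <- _) _ => IH P0 P1 u2 u0 hu.
have u1 : u <= 2 by nra.
have n1 : (size s)%:R <= 2 ^+ size s :> K.
  by rewrite -natrX ler_nat ltnW // ltn_expl.
have n2 : 2 ^+ size s <= 4 ^+ size s :> K.
  by rewrite lerXn2r ?nnegrE // ler_nat.
have hS : `|S| <= (size s)%:R * y by apply: sumle.
move: n1 n2 IH hS P1.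
rewrite (exprS 2) (exprS 4); move: (2 ^+ _) (4 ^+ _) ((size s)%:R) => p2 p4 ss n1 n2 IH hS P1.
split; first by rewrite mulr_ge0 //= ler_pM.
set th := P - 1 + S / 2 in IH; set tau := u - 1 + x i / 2 in hu.
have -> : u * P - 1 + (x i + S) / 2
  = x i * S / 4 + tau * P + th * (1 - x i / 2).
  by rewrite /th /tau; field.
have y2 : 0 <= y ^+ 2 by apply: sqr_ge0.
have a1 : `|x i * S / 4| <= p4 * y ^+ 2 / 4.
  rewrite normrM normfV [`|4|]ger0_norm // ler_pM2r ?invr_gt0 // normrM.
  apply: (@le_trans _ _ (y * (ss * y))); first by apply: ler_pM.
  rewrite [leLHS](_ : _ = ss * y ^+ 2); last by ring.
  by apply: ler_wpM2r => //; lra.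
have a2 : `|tau * P| <= p4 * y ^+ 2 / 2.
  rewrite normrM (ger0_norm P0).
  apply: (@le_trans _ _ (y ^+ 2 / 2 * p4)); last by lra.
  apply: ler_pM => //; last by lra.
  apply: le_trans hu _; rewrite ler_pM2r ?invr_gt0 //.
  by rewrite -[x i ^+ 2]real_normK ?num_real // lerXn2r ?nnegrE.
have a3 : `|th * (1 - x i / 2)| <= p4 * y ^+ 2 * (5 / 4).
  rewrite normrM; apply: ler_pM => //.
  by rewrite ger0_norm; lra.
apply: le_trans (ler_normD _ _) _.
apply: le_trans (lerD (ler_normD _ _) (lexx _)) _.
apply: le_trans (lerD (lerD a1 a2) a3) _.
have : 0 <= p4 * y ^+ 2 by rewrite mulr_ge0 //; lra.
lra.
Qed.

Lemma expR_small x : 0 <= x <= 2^-1 -> expR x <= 1 + 2 * x.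
Proof.
move=> /andP[x0 x1].
have h : 1 - x <= (expR x)^-1 by rewrite -expRN; apply: expR_ge1Dx.
have e0 := expR_gt0 x.
have : (1 - x) * expR x <= 1 by rewrite -ler_pdivlMr // div1r.
nra.
Qed.

(** The increments are compared with those of [2 * (1 + e / n) ^ m - 2], which
    solves the extremal recursion and is at most [2 * expR (e * b) - 2]. *)
Lemma discrete_gronwall (v : nat -> K) (e b n : K) :
  0 < n -> 0 <= e -> 0 <= b -> e * b <= 2^-1 -> v 0%N = 1 ->
  (forall m, m.+1%:R <= b * n -> `|v m.+1 - v m| <= e / n * (`|v m| + 1)) ->
  forall m, m%:R <= b * n -> `|v m - 1| <= 4 * (e * b).
Proof.
move=> n0 e0 b0 eb v0 step.
have en : 0 <= e / n by rewrite divr_ge0 // ltW.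
have ind m : m%:R <= b * n -> `|v m - 1| <= 2 * (1 + e / n) ^+ m - 2.
  elim: m => [|m IH] hm; first by rewrite v0 subrr normr0 expr0 mulr1 subrr.
  have {}IH := IH (le_trans (_ : m%:R <= m.+1%:R) hm); rewrite ler_nat leqnSn in IH.
  have {}IH := IH isT.
  have vm : `|v m| <= `|v m - 1| + 1.
    by rewrite -{1}(subrK 1 (v m)); apply: le_trans (ler_normD _ _) _; rewrite normr1.
  have -> : v m.+1 - 1 = (v m.+1 - v m) + (v m - 1) by ring.
  apply: le_trans (ler_normD _ _) _.
  apply: le_trans (lerD (step m hm) (lexx _)) _.
  rewrite exprS; nra.
move=> m hm; apply: le_trans (ind m hm) _.
have h1 : (1 + e / n) ^+ m <= expR (e * b).
  apply: (@le_trans _ _ (expR (e / n) ^+ m)).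
    by rewrite lerXn2r ?nnegrE ?expR_ge0 // ?expR_ge1Dx // addr_ge0.
  rewrite -expRM_natl ler_expR mulrA ler_pdivrMr // mulrC -mulrA.
  by rewrite ler_wpM2l.
have h2 : expR (e * b) <= 1 + 2 * (e * b).
  by apply: expR_small; rewrite mulr_ge0.
lra.
Qed.

Lemma eventually_lt_nat x :
  exists N : nat, forall n, (N <= n)%N -> x < n%:R.
Proof.
exists (Num.bound `|x|) => n hn; apply: le_lt_trans (ler_norm x) _.
by apply: lt_le_trans (archi_boundP (normr_ge0 x)) _; rewrite ler_nat.
Qed.

(** The exponential dominates the term of degree [j + 3] of its series. *)
Lemma poly_expR_small (tau eta : K) (j : nat) :
  0 < tau -> 0 < eta -> exists N : nat, forall n, (N <= n)%N ->
  n%:R ^+ 2 * n.+1%:R ^+ j * expR (- (tau * n%:R)) <= eta.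
Proof.
move=> tau0 eta0.
pose F : K := j.+3`!%:R; have F0 : 0 < F by rewrite ltr0n fact_gt0.
have [N hN] := eventually_lt_nat (2 ^+ j * F / (tau ^+ j.+3 * eta)).
exists (maxn N 1) => n; rewrite geq_max => /andP[/hN hn n1].
have n0 : 0 < n%:R :> K by rewrite ltr0n.
have T0 : 0 < tau ^+ j.+3 by rewrite exprn_gt0.
have E : (tau * n%:R) ^+ j.+3 / F <= expR (tau * n%:R).
  apply: le_trans (expR_ge1Dxn j.+2 _); first by rewrite lerDr.
  by rewrite mulr_ge0 // ltW.
rewrite expRN ler_pdivrMr ?expR_gt0 //.
apply: (@le_trans _ _ (eta * ((tau * n%:R) ^+ j.+3 / F))); last by rewrite ler_pM2l.
apply: (@le_trans _ _ (n%:R ^+ 2 * (2 * n%:R) ^+ j)).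
  rewrite ler_wpM2l ?sqr_ge0 // lerXn2r ?nnegrE ?mulr_ge0 //.
  by rewrite -natrM ler_nat mul2n -addnn -addn1 leq_add2l.
have -> : n%:R ^+ 2 * (2 * n%:R) ^+ j = 2 ^+ j * n%:R ^+ j.+2 :> K.
  by rewrite exprMn mulrCA -exprD.
have -> : eta * ((tau * n%:R) ^+ j.+3 / F)
    = (tau ^+ j.+3 * eta * n%:R / F) * n%:R ^+ j.+2.
  by rewrite exprMn (exprS n%:R j.+2); field; rewrite gt_eqF.
rewrite ler_pM2r ?exprn_gt0 // ler_pdivlMr //.
by move: hn; rewrite ltr_pdivrMr ?(mulr_gt0 T0 eta0) // [n%:R * _]mulrC => /ltW.
Qed.

End RealBounds.

(** * Random typings and resampling of one vertex *)

Section Typings.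
Variables (K : realType) (q p : nat).
Variables (f : 'I_p -> 'I_q -> K) (rho : 'I_p -> K).

Definition expect n (F : {ffun 'I_n -> 'I_q} -> K) : K :=
  (\sum_t F t) / q%:R ^+ n.

Lemma expectD n (F G : {ffun 'I_n -> 'I_q} -> K) :
  expect (fun t => F t + G t) = expect F + expect G.
Proof. by rewrite /expect big_split /= mulrDl. Qed.

Lemma expectB n (F G : {ffun 'I_n -> 'I_q} -> K) :
  expect (fun t => F t - G t) = expect F - expect G.
Proof. by rewrite /expect sumrB mulrBl. Qed.

Lemma expectZ n x (F : {ffun 'I_n -> 'I_q} -> K) :
  expect (fun t => x * F t) = x * expect F.
Proof. by rewrite /expect -mulr_sumr mulrA. Qed.

Lemma expect_sum n (I : finType) (F : I -> {ffun 'I_n -> 'I_q} -> K) :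
  expect (fun t => \sum_i F i t) = \sum_i expect (F i).
Proof. by rewrite /expect exchange_big /= -mulr_suml. Qed.

Lemma expect_le n (F G : {ffun 'I_n -> 'I_q} -> K) :
  (forall t, F t <= G t) -> expect F <= expect G.
Proof.
move=> FG; rewrite /expect ler_wpM2r ?invr_ge0 ?exprn_ge0 ?ler0n //.
exact: ler_sum.
Qed.

Lemma expect_ge0 n (F : {ffun 'I_n -> 'I_q} -> K) :
  (forall t, 0 <= F t) -> 0 <= expect F.
Proof.
by move=> F0; rewrite /expect mulr_ge0 ?invr_ge0 ?exprn_ge0 ?ler0n ?sumr_ge0.
Qed.

Lemma expect_norm n (F : {ffun 'I_n -> 'I_q} -> K) :
  `|expect F| <= expect (fun t => `|F t|).
Proof.
rewrite /expect normrM [`|_^-1|]ger0_norm ?invr_ge0 ?exprn_ge0 ?ler0n //.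
by rewrite ler_wpM2r ?invr_ge0 ?exprn_ge0 ?ler0n // ler_norm_sum.
Qed.

(** Up to normalisation, the coordinate along [f k] of the vector of class sizes of
    [t]. *)
Definition coord n (t : {ffun 'I_n -> 'I_q}) k : K := \sum_w f k (t w).

Definition coord_norm n (t : {ffun 'I_n -> 'I_q}) : K := \sum_k `|coord t k|.

(** When [1 + \sum_k rho k * (f k a * f k b)] is an edge weight, this is its mean
    over all ordered pairs of vertices. *)
Definition pair_mean n (t : {ffun 'I_n -> 'I_q}) : K :=
  1 + \sum_k rho k * (coord t k / n%:R) ^+ 2.

Definition resample n (t : {ffun 'I_n -> 'I_q}) w s : {ffun 'I_n -> 'I_q} :=
  [ffun v => if v == w then s else t v].

(** Exchangeability: giving the vertex [w] an independent type and remembering the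
    old one is an involution on pairs (typing, type). *)
Lemma sum_resample n w (G : {ffun 'I_n -> 'I_q} -> 'I_q -> K) :
  \sum_t \sum_s G t s = \sum_t \sum_s G (resample t w s) (t w).
Proof.
rewrite !pair_bigA /=.
rewrite (reindex (fun x : {ffun 'I_n -> 'I_q} * 'I_q =>
  (resample x.1 w x.2, x.1 w))) //=.
have inv : involutive (fun x : {ffun 'I_n -> 'I_q} * 'I_q =>
    (resample x.1 w x.2, x.1 w)).
  move=> [t s] /=; congr (_, _); last by rewrite ffunE eqxx.
  by apply/ffunP => v; rewrite !ffunE; case: eqP => // ->.
by exists (fun x => (resample x.1 w x.2, x.1 w)) => x _; apply: inv.
Qed.

Lemma coord_resample n (t : {ffun 'I_n -> 'I_q}) w s k :
  coord (resample t w s) k = coord t k - (f k (t w) - f k s).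
Proof.
rewrite /coord (bigD1 w) //= [in RHS](bigD1 w) //= ffunE eqxx.
under eq_bigr => v vw do rewrite ffunE (negPf vw).
ring.
Qed.

Hypothesis q_gt0 : (0 < q)%N.
Hypothesis f_mean : forall k, \sum_a f k a = 0.

Let q0 : 0 < q%:R :> K. Proof. by rewrite ltr0n. Qed.

(** Since [f k] has mean zero, the independent type [s] contributes nothing to
    [(f k (t w) - f k s) * g t]; antisymmetrising under the exchange of [t w] and [s]
    then produces the differences of [g]. *)
Lemma stein_exchange n k (g : {ffun 'I_n -> 'I_q} -> K) :
  \sum_t coord t k * g t =
  \sum_(t : {ffun 'I_n -> 'I_q}) (2 * q%:R)^-1 * (\sum_w \sum_s
    (f k (t w) - f k s) * (g t - g (resample t w s))).
Proof.
rewrite -mulr_sumr.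
have -> : \sum_(t : {ffun 'I_n -> 'I_q}) \sum_w \sum_s
    (f k (t w) - f k s) * (g t - g (resample t w s))
  = \sum_(t : {ffun 'I_n -> 'I_q}) \sum_w \sum_s
       2 * ((f k (t w) - f k s) * g t).
  rewrite exchange_big [RHS]exchange_big /=; apply: eq_bigr => w _.
  under eq_bigr do under eq_bigr do rewrite mulrBr.
  under eq_bigr do rewrite sumrB.
  rewrite sumrB (sum_resample w (fun t s => (f k (t w) - f k s) * g (resample t w s))).
  rewrite -sumrB; apply: eq_bigr => t _; rewrite -sumrB; apply: eq_bigr => s _.
  have -> : resample (resample t w s) w (t w) = t.
    by apply/ffunP => v; rewrite !ffunE; case: eqP => // ->.
  by rewrite ffunE eqxx; ring.
rewrite mulr_sumr; apply: eq_bigr => t _.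
under eq_bigr => w _.
  rewrite -mulr_sumr -mulr_suml sumrB f_mean subr0 sumr_const card_ord.
  over.
rewrite -mulr_sumr -mulr_suml sumrMnl -/(coord t k) -mulr_natr.
by field; rewrite gt_eqF.
Qed.

End Typings.

(** * Second moments under the weight [P ^+ m] *)

Section SteinEstimate.
Variables (K : realType) (q p : nat).
Variables (f : 'I_p -> 'I_q -> K) (rho : 'I_p -> K).
Hypothesis q_gt0 : (0 < q)%N.
Hypothesis f_mean : forall k, \sum_a f k a = 0.
Hypothesis f_orth : forall k l, \sum_a f k a * f l a = q%:R * (k == l)%:R.
Hypothesis f_complete :
  forall a b, \sum_k f k a * f k b = q%:R * (a == b)%:R - 1.
Variables (M r b : K).
Hypothesis M0 : 0 <= M.
Hypothesis r0 : 0 <= r.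
Hypothesis b0 : 0 <= b.
Hypothesis f_le : forall k a, `|f k a| <= M.
Hypothesis rho_le : forall k, `|rho k| <= r.

Let q0 : 0 < q%:R :> K. Proof. by rewrite ltr0n. Qed.

Definition coefficient (h : 'I_q -> K) (l : 'I_p) : K :=
  (\sum_a h a * f l a) / q%:R.

(** Constants and the [f l] span all functions on the types. *)
Lemma basis_expansion (h : 'I_q -> K) x :
  h x = (\sum_a h a) / q%:R + \sum_l coefficient h l * f l x.
Proof.
rewrite /coefficient.
under [X in _ + X]eq_bigr do rewrite mulrAC mulr_suml.
rewrite -mulr_suml exchange_big /=.
under [X in _ + X / _]eq_bigr => a _.
  under eq_bigr do rewrite -mulrA.
  rewrite -mulr_sumr f_complete mulrBr mulr1 mulrCA.
  over.
rewrite sumrB -mulr_sumr.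
rewrite [X in _ * X - _](bigD1 x) //= eqxx mulr1 [X in h x + X]big1 ?addr0; last first.
  by move=> a /negPf ->; rewrite mulr0.
by field; rewrite gt_eqF.
Qed.

Lemma sum_over_vertices n (t : {ffun 'I_n -> 'I_q}) (h : 'I_q -> K) :
  \sum_w h (t w) = n%:R * ((\sum_a h a) / q%:R)
                   + \sum_l coefficient h l * coord f t l.
Proof.
under eq_bigr do rewrite basis_expansion.
rewrite big_split /= sumr_const card_ord mulr_natl; congr (_ + _).
rewrite exchange_big /=; apply: eq_bigr => l _.
by rewrite -mulr_sumr.
Qed.

Lemma coord_le n (t : {ffun 'I_n -> 'I_q}) k : `|coord f t k| <= coord_norm f t.
Proof. by rewrite /coord_norm (bigD1 k) //= lerDl sumr_ge0. Qed.

Lemma coord_norm_ge0 n (t : {ffun 'I_n -> 'I_q}) : 0 <= coord_norm f t.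
Proof. exact: sumr_ge0. Qed.

Lemma coord_norm_le n (t : {ffun 'I_n -> 'I_q}) : coord_norm f t <= p%:R * M * n%:R.
Proof.
rewrite /coord_norm; apply: le_trans (_ : \sum_(k < p) M * n%:R <= _); last first.
  by rewrite sumr_const card_ord -[_ *+ p]mulr_natl mulrA.
apply: ler_sum => k _; apply: le_trans (ler_norm_sum _ _ _) _.
rewrite mulr_natr -[n in leRHS]card_ord -sumr_const.
by apply: ler_sum.
Qed.

Lemma coefficient_le (k l : 'I_p) j :
  `|coefficient (fun a => f k a * f l a) j| <= M ^+ 3.
Proof.
rewrite /coefficient normrM normfV (ger0_norm (ltW q0)) ler_pdivrMr //.
apply: le_trans (ler_norm_sum _ _ _) _.
rewrite mulr_natr -[q in leRHS]card_ord -sumr_const.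
apply: ler_sum => a _; rewrite !normrM !exprSr expr0 mul1r.
by apply: ler_pM; rewrite ?mulr_ge0 //; apply: ler_pM.
Qed.

Lemma sum_coefficient_le n (t : {ffun 'I_n -> 'I_q}) k l :
  `|\sum_j coefficient (fun a => f k a * f l a) j * coord f t j|
  <= M ^+ 3 * coord_norm f t.
Proof.
apply: le_trans (ler_norm_sum _ _ _) _.
rewrite /coord_norm mulr_sumr; apply: ler_sum => j _.
by rewrite normrM ler_wpM2r // coefficient_le.
Qed.

(** The leading term [2 * n] for [k = l] is the covariance of the limiting Gaussian vector;
    the other terms are linear in the coordinates, hence of lower order near
    equidistribution. *)
Lemma sum_diff_products n (t : {ffun 'I_n -> 'I_q}) k l :
  q%:R^-1 * (\sum_w \sum_s (f k (t w) - f k s) * (f l (t w) - f l s))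
  = 2 * n%:R * (k == l)%:R
    + \sum_j coefficient (fun a => f k a * f l a) j * coord f t j.
Proof.
have E w : \sum_s (f k (t w) - f k s) * (f l (t w) - f l s)
  = q%:R * (f k (t w) * f l (t w)) + q%:R * (k == l)%:R.
  rewrite (eq_bigr (fun s => f k (t w) * f l (t w)
    - f k (t w) * f l s - f k s * f l (t w) + f k s * f l s)); last first.
    by move=> s _; ring.
  rewrite !big_split /= !sumrN sumr_const card_ord -mulr_sumr -mulr_suml.
  by rewrite !f_mean f_orth -[_ *+ q]mulr_natl; ring.
under eq_bigr do rewrite E.
rewrite big_split /= -mulr_sumr.
rewrite (sum_over_vertices t (fun a => f k a * f l a)) f_orth.
rewrite sumr_const card_ord -[_ *+ n]mulr_natl.
by field; rewrite gt_eqF.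
Qed.

Let diff_le k a a' : `|f k a - f k a'| <= 2 * M.
Proof.
apply: le_trans (ler_normB _ _) _.
by have := f_le k a; have := f_le k a'; lra.
Qed.

Lemma sum_rho_sqr_le n (t : {ffun 'I_n -> 'I_q}) :
  `|\sum_k rho k * coord f t k ^+ 2| <= r * coord_norm f t ^+ 2.
Proof.
apply: le_trans (ler_norm_sum _ _ _) _.
rewrite expr2 [X in r * (X * _)]/coord_norm mulr_suml mulr_sumr; apply: ler_sum => k _.
rewrite normrM; apply: ler_pM => //.
by rewrite normrX expr2; apply: ler_pM => //; apply: coord_le.
Qed.

Lemma pair_meanE n (t : {ffun 'I_n -> 'I_q}) :
  pair_mean f rho t = 1 + (\sum_k rho k * coord f t k ^+ 2) / n%:R ^+ 2.
Proof.
rewrite /pair_mean mulr_suml; congr (_ + _); apply: eq_bigr => k _.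
by rewrite expr_div_n mulrA.
Qed.

(** The first-order part of the change of the mean edge weight when [w] is resampled. *)
Definition cross n (t : {ffun 'I_n -> 'I_q}) w s : K :=
  \sum_l rho l * (coord f t l * (f l (t w) - f l s)).

Lemma cross_le n (t : {ffun 'I_n -> 'I_q}) w s :
  `|cross t w s| <= 2 * M * r * coord_norm f t.
Proof.
apply: le_trans (ler_norm_sum _ _ _) _.
rewrite /coord_norm mulr_sumr; apply: ler_sum => l _.
rewrite !normrM [leRHS](_ : _ = r * (`|coord f t l| * (2 * M))); last by ring.
by apply: ler_pM => //; apply: ler_pM.
Qed.

Lemma pair_mean_diff n (t : {ffun 'I_n -> 'I_q}) w s :
  pair_mean f rho t - pair_mean f rho (resample t w s)
  = (2 * cross t w s - \sum_l rho l * (f l (t w) - f l s) ^+ 2) / n%:R ^+ 2.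
Proof.
rewrite !pair_meanE opprD addrACA subrr add0r -mulrBl; congr (_ / _).
rewrite -sumrB /cross mulr_sumr -sumrB; apply: eq_bigr => l _.
by rewrite coord_resample; ring.
Qed.

Lemma sum_rho_diff_le n (t : {ffun 'I_n -> 'I_q}) w s :
  `|\sum_l rho l * (f l (t w) - f l s) ^+ 2| <= p%:R * r * (2 * M) ^+ 2.
Proof.
apply: le_trans (ler_norm_sum _ _ _) _.
rewrite -[leRHS]mulrA mulr_natl -[p in leRHS]card_ord -sumr_const.
apply: ler_sum => l _; rewrite normrM normrX; apply: ler_pM => //.
by apply: lerXn2r; rewrite ?nnegrE // mulr_ge0.
Qed.

Let B1 : K := 2 * M * r.
Let B2 : K := p%:R * r * (2 * M) ^+ 2.
Let B3 : K := 2 * b * (2 * B1 + B2).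
Let B4 : K := B3 ^+ 2 + B3 * r.

Let B10 : 0 <= B1. Proof. by rewrite /B1 !mulr_ge0. Qed.
Let B20 : 0 <= B2. Proof. by rewrite /B2 !mulr_ge0 // sqr_ge0. Qed.
Let B30 : 0 <= B3.
Proof. by rewrite /B3 !mulr_ge0 // addr_ge0 // mulr_ge0. Qed.
Let B40 : 0 <= B4. Proof. by rewrite /B4 addr_ge0 ?sqr_ge0 // mulr_ge0. Qed.

(** The summand of Stein's identity for [g t = coord t k * pair_mean t ^+ m]. *)
Definition stein_summand n m (t : {ffun 'I_n -> 'I_q}) k : K :=
  (2 * q%:R)^-1 * (\sum_w \sum_s (f k (t w) - f k s) *
    (coord f t k * pair_mean f rho t ^+ m -
     coord f (resample t w s) k * pair_mean f rho (resample t w s) ^+ m)).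

Definition near_constant : K :=
  M ^+ 3 + b * r * M ^+ 3 + 4 * M ^+ 2 * b * B1 + 4 * M * B4 + 2 * M * b * B2.

Lemma near_constant_ge0 : 0 <= near_constant.
Proof.
have M30 : 0 <= M ^+ 3 by rewrite exprn_ge0.
have h1 := mulr_ge0 (mulr_ge0 b0 r0) M30.
have h2 := mulr_ge0 (mulr_ge0 (sqr_ge0 M) b0) B10.
have h3 := mulr_ge0 M0 B40; have h4 := mulr_ge0 (mulr_ge0 M0 b0) B20.
rewrite /near_constant; move: B1 B2 B4 h2 h3 h4 => x y z; lra.
Qed.

Let double_sum_le n (F : 'I_n -> 'I_q -> K) B : (forall w s, `|F w s| <= B) ->
  `|(2 * q%:R)^-1 * (\sum_w \sum_s F w s)| <= n%:R * B / 2.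
Proof.
have q2 : 0 < 2 * q%:R :> K by rewrite mulr_gt0.
move=> hF; rewrite normrM normfV (ger0_norm (ltW q2)).
rewrite [leLHS]mulrC ler_pdivrMr //.
apply: le_trans (ler_norm_sum _ _ _) _.
have -> : n%:R * B / 2 * (2 * q%:R) = \sum_(w < n) \sum_(s < q) B.
  rewrite !sumr_const !card_ord -[B *+ q]mulr_natl -[_ *+ n]mulr_natl.
  by field.
apply: ler_sum => w _; apply: le_trans (ler_norm_sum _ _ _) _.
exact: ler_sum.
Qed.

(** Near equidistribution the difference [D * (z * P ^+ m - z' * P' ^+ m)] is
    [D ^ 2 * P ^+ m + D * z * (P ^+ m - P' ^+ m)] up to lower order.  Summed over the vertices
    and the new types, the first part gives [n * P ^+ m] and the second, by
    [pow_perturbation], gives [2 * c * rho k * z ^ 2 * P ^+ m]. *)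
Lemma stein_summand_near n m (t : {ffun 'I_n -> 'I_q}) k (c d : K) :
  (0 < n)%N -> m%:R = c * n%:R -> 0 <= c <= b -> 0 <= d <= 1 ->
  r * d <= 2^-1 -> 2 * B3 * d <= 1 -> 2 * B3 <= n%:R -> 2 * M <= d * n%:R ->
  coord_norm f t <= d * n%:R -> 0 <= pair_mean f rho t ->
  `|stein_summand m t k - (n%:R + 2 * c * rho k * coord f t k ^+ 2) * pair_mean f rho t ^+ m|
  <= near_constant * d * (coord_norm f t ^+ 2 + n%:R) * pair_mean f rho t ^+ m.
Proof.
move=> n_gt0 mE /andP[c0 cb] /andP[d0 d1] rd Bd Bn Mn ud P0.
have n0 : 0 < n%:R :> K by rewrite ltr0n.
have n1 : 1 <= n%:R :> K by rewrite ler1n.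
set u := coord_norm f t in ud *.
have u0 : 0 <= u by apply: coord_norm_ge0.
set P := pair_mean f rho t in P0 *; set z := coord f t k.
have zu : `|z| <= u by apply: coord_le.
set Y := P ^+ m; have Y0 : 0 <= Y by rewrite exprn_ge0.
pose D w s := f k (t w) - f k s.
pose S w s := cross t w s.
pose e w s := Y - pair_mean f rho (resample t w s) ^+ m - Y * (2 * c / n%:R * S w s).
pose E0 := B4 * ((u + 1) / n%:R) ^+ 2 + b * B2 / n%:R.
have he w s : `|e w s| <= Y * E0.
  rewrite /e /Y /E0 /B4 /B3; apply: (@pow_perturbation _ _ _ _ _ _ d _ _ _ _ _
    (\sum_l rho l * (f l (t w) - f l s) ^+ 2)) => //.
  - by rewrite c0.
  - by rewrite u0.
  - by rewrite d0.
  - by move: Bd; rewrite /B3; lra.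
  - by move: Bn; rewrite /B3; lra.
  - exact: pair_mean_diff.
  - exact: cross_le.
  - exact: sum_rho_diff_le.
  - rewrite /P pair_meanE [X in `|X|]addrC addKr normrM normfV [`|_ ^+ 2|]ger0_norm ?sqr_ge0 //.
    by rewrite ler_wpM2r ?invr_ge0 ?sqr_ge0 // sum_rho_sqr_le.
pose F w s := - (Y * (2 * c / n%:R) * (D w s ^+ 2 * S w s)) + D w s * (z - D w s) * e w s.
have summandE : stein_summand m t k =
   Y * (2^-1 * (q%:R^-1 * \sum_w \sum_s D w s * D w s))
   + Y * (c / n%:R) * z * (q%:R^-1 * \sum_w \sum_s D w s * S w s)
   + (2 * q%:R)^-1 * \sum_w \sum_s F w s.
  have push x (G : 'I_n -> 'I_q -> K) :
      x * \sum_w \sum_s G w s = \sum_w \sum_s x * G w s.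
    by rewrite mulr_sumr; apply: eq_bigr => w _; rewrite mulr_sumr.
  rewrite /stein_summand !push -!big_split /=; apply: eq_bigr => w _.
  rewrite -!big_split /=; apply: eq_bigr => s _.
  rewrite coord_resample -/z -/P -/Y /F /e /D.
  by field; rewrite !gt_eqF.
have DS : q%:R^-1 * \sum_w \sum_s D w s * S w s
  = 2 * n%:R * (rho k * z) + \sum_l rho l * coord f t l *
      (\sum_j coefficient (fun a => f k a * f l a) j * coord f t j).
  have -> : q%:R^-1 * \sum_w \sum_s D w s * S w s
    = \sum_l rho l * coord f t l * (q%:R^-1 *
        \sum_w \sum_s D w s * (f l (t w) - f l s)).
    under [RHS]eq_bigr do rewrite mulrCA.
    rewrite -mulr_sumr; congr (_ * _).
    under [RHS]eq_bigr do rewrite mulr_sumr.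
    rewrite [RHS]exchange_big /=; apply: eq_bigr => w _.
    under [RHS]eq_bigr do rewrite mulr_sumr.
    rewrite [RHS]exchange_big /=; apply: eq_bigr => s _.
    by rewrite /S /cross mulr_sumr; apply: eq_bigr => l _; ring.
  under eq_bigr => l _ do rewrite /D sum_diff_products // mulrDr.
  rewrite big_split /=; congr (_ + _).
  rewrite (bigD1 k) //= eqxx big1 ?addr0 /z /=; first by ring.
  by move=> l /negPf lk; rewrite eq_sym lk !mulr0.
have M30 : 0 <= M ^+ 3 by rewrite exprn_ge0.
set s2 := \sum_l rho l * _ * _ in DS.
have hs2 : `|s2| <= r * u * (M ^+ 3 * u).
  apply: le_trans (ler_norm_sum _ _ _) _.
  rewrite {1}/u /coord_norm mulr_sumr mulr_suml; apply: ler_sum => l _.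
  rewrite !normrM; apply: ler_pM => //; first by apply: ler_pM.
  exact: sum_coefficient_le.
set s1 := \sum_j coefficient (fun a => f k a * f k a) j * coord f t j.
have hs1 : `|s1| <= M ^+ 3 * u by apply: sum_coefficient_le.
have DD : q%:R^-1 * \sum_w \sum_s D w s * D w s = 2 * n%:R + s1.
  by rewrite /D sum_diff_products // eqxx mulr1.
pose GG := 4 * M ^+ 2 * (2 * b / n%:R) * (B1 * u) + 2 * M * (u + 2 * M) * E0.
have E00 : 0 <= E0.
  by rewrite /E0 addr_ge0 // mulr_ge0 ?sqr_ge0 ?invr_ge0 ?ler0n // mulr_ge0.
have hF w s : `|F w s| <= Y * GG.
  have D2 : `|D w s| <= 2 * M by apply: diff_le.
  rewrite /F /GG [leRHS]mulrDr; apply: le_trans (ler_normD _ _) _; apply: lerD.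
    rewrite normrN !normrM (ger0_norm Y0) (ger0_norm c0) normfV.
    rewrite (ger0_norm (ltW n0)) [`|2|]ger0_norm //.
    have -> : Y * (4 * M ^+ 2 * (2 * b / n%:R) * (B1 * u))
      = Y * (2 * b / n%:R) * ((2 * M) * (2 * M) * (B1 * u)) by ring.
    have ni : 0 <= n%:R^-1 :> K by rewrite invr_ge0 ltW.
    apply: ler_pM; rewrite ?mulr_ge0 //.
      by apply: ler_wpM2l => //; apply: ler_wpM2r => //; apply: ler_wpM2l.
    apply: ler_pM; rewrite ?mulr_ge0 //; first by apply: ler_pM.
    exact: cross_le.
  rewrite !normrM.
  have -> : Y * (2 * M * (u + 2 * M) * E0) = 2 * M * (u + 2 * M) * (Y * E0) by ring.
  apply: ler_pM => //; apply: ler_pM => //.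
  by apply: le_trans (ler_normB _ _) _; apply: lerD.
rewrite summandE DD DS.
have -> : Y * (2^-1 * (2 * n%:R + s1)) +
    Y * (c / n%:R) * z * (2 * n%:R * (rho k * z) + s2) +
    (2 * q%:R)^-1 * (\sum_w \sum_s F w s) - (n%:R + 2 * c * rho k * z ^+ 2) * Y
  = Y * (s1 / 2) + Y * (c / n%:R * (z * s2)) + (2 * q%:R)^-1 * (\sum_w \sum_s F w s).
  by field; rewrite !gt_eqF.
apply: le_trans (ler_normD _ _) _.
apply: le_trans (lerD (ler_normD _ _) (double_sum_le hF)) _.
have t1 : `|Y * (s1 / 2)| <= Y * (M ^+ 3 * d * n%:R).
  rewrite normrM (ger0_norm Y0); apply: ler_wpM2l => //.
  rewrite normrM normfV [`|2|]ger0_norm //.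
  have : M ^+ 3 * u <= M ^+ 3 * d * n%:R by rewrite -mulrA; apply: ler_wpM2l.
  by have : 0 <= `|s1| by []; lra.
have und : u / n%:R <= d by rewrite ler_pdivrMr.
have un0 : 0 <= u / n%:R by rewrite divr_ge0 // ltW.
have t2 : `|Y * (c / n%:R * (z * s2))| <= Y * (b * r * M ^+ 3 * d * u ^+ 2).
  rewrite normrM (ger0_norm Y0); apply: ler_wpM2l => //.
  rewrite !normrM normfV (ger0_norm c0) (ger0_norm (ltW n0)).
  apply: (@le_trans _ _ (b / n%:R * (u * (r * u * (M ^+ 3 * u))))).
    apply: ler_pM; rewrite ?mulr_ge0 ?invr_ge0 ?ler0n //.
      by rewrite ler_wpM2r // invr_ge0 ler0n.
    by apply: ler_pM.
  have -> : b / n%:R * (u * (r * u * (M ^+ 3 * u)))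
    = b * r * M ^+ 3 * u ^+ 2 * (u / n%:R) by ring.
  have -> : b * r * M ^+ 3 * d * u ^+ 2 = b * r * M ^+ 3 * u ^+ 2 * d by ring.
  by apply: ler_wpM2l => //; rewrite !mulr_ge0 ?sqr_ge0.
have t3 : n%:R * (Y * GG) / 2 <= Y * (4 * M ^+ 2 * b * B1 * d * n%:R
    + 4 * M * B4 * d * (u ^+ 2 + n%:R) + 2 * M * b * B2 * d * n%:R).
  have -> : n%:R * (Y * GG) / 2 = Y * (n%:R * GG / 2) by ring.
  apply: ler_wpM2l => //; rewrite /GG /E0.
  have -> : n%:R * (4 * M ^+ 2 * (2 * b / n%:R) * (B1 * u) +
     2 * M * (u + 2 * M) * (B4 * ((u + 1) / n%:R) ^+ 2 + b * B2 / n%:R)) / 2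
   = 4 * M ^+ 2 * b * B1 * u + M * B4 * ((u + 2 * M) / n%:R) * (u + 1) ^+ 2
     + M * b * B2 * (u + 2 * M) by field; rewrite gt_eqF.
  have uM : (u + 2 * M) / n%:R <= 2 * d.
    by rewrite ler_pdivrMr //; lra.
  apply: lerD; first apply: lerD.
  - rewrite -[leRHS]mulrA; apply: ler_wpM2l => //.
    by rewrite !mulr_ge0 // sqr_ge0.
  - have -> : 4 * M * B4 * d * (u ^+ 2 + n%:R)
      = M * B4 * (2 * d) * (2 * (u ^+ 2 + n%:R)) by ring.
    have MB40 : 0 <= M * B4 by apply: mulr_ge0.
    have uM0 : 0 <= (u + 2 * M) / n%:R.
      by rewrite divr_ge0 ?ler0n // addr_ge0 // mulr_ge0.
    apply: ler_pM.
    - exact: mulr_ge0.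
    - exact: sqr_ge0.
    - exact: ler_wpM2l.
    have := sqr_ge0 (u - 1); nra.
  - have -> : 2 * M * b * B2 * d * n%:R = M * b * B2 * (2 * d * n%:R) by ring.
    by apply: ler_wpM2l; rewrite ?mulr_ge0 //; lra.
apply: le_trans (lerD (lerD t1 t2) t3) _.
have -> : near_constant * d * (u ^+ 2 + n%:R) * Y
   = Y * (near_constant * d * (u ^+ 2 + n%:R)) by ring.
rewrite -!mulrDr; apply: ler_wpM2l => //; rewrite /near_constant.
set a1 := M ^+ 3; set a2 := b * r * M ^+ 3; set a3 := 4 * M ^+ 2 * b * B1.
set a4 := 4 * M * B4; set a5 := 2 * M * b * B2.
have a20 : 0 <= a2 by rewrite !mulr_ge0.
have a30 : 0 <= a3 by rewrite !mulr_ge0 // sqr_ge0.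
have a50 : 0 <= a5 by rewrite !mulr_ge0.
have U2 : 0 <= u ^+ 2 by apply: sqr_ge0.
have h1 : 0 <= a1 * d * u ^+ 2 by rewrite !mulr_ge0.
have h2 : 0 <= a2 * d * n%:R by rewrite !mulr_ge0.
have h3 : 0 <= a3 * d * u ^+ 2 by rewrite !mulr_ge0.
have h5 : 0 <= a5 * d * u ^+ 2 by rewrite !mulr_ge0.
lra.
Qed.

Hypothesis P_ge0 : forall n (t : {ffun 'I_n -> 'I_q}), (0 < n)%N ->
  0 <= pair_mean f rho t.

Definition far_constant : K :=
  M ^+ 2 * (p%:R + 2) + (1 + 2 * b * r * (p%:R * M) ^+ 2).

Let F10 : 0 <= M ^+ 2 * (p%:R + 2).
Proof. by rewrite mulr_ge0 ?sqr_ge0 // addr_ge0. Qed.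

Let F20 : 0 <= 1 + 2 * b * r * (p%:R * M) ^+ 2.
Proof. by rewrite addr_ge0 // !mulr_ge0 // sqr_ge0. Qed.

Lemma far_constant_ge0 : 0 <= far_constant.
Proof. exact: addr_ge0. Qed.

(** A crude bound, sufficient where the weight is exponentially small. *)
Lemma stein_summand_far n m (t : {ffun 'I_n -> 'I_q}) k (c : K) :
  (0 < n)%N -> 0 <= c <= b ->
  `|stein_summand m t k
    - (n%:R + 2 * c * rho k * coord f t k ^+ 2) * pair_mean f rho t ^+ m|
  <= far_constant * (n%:R ^+ 2 * pair_mean f rho t ^+ m +
       n%:R * (q%:R^-1 * \sum_w \sum_s pair_mean f rho (resample t w s) ^+ m)).
Proof.
move=> n_gt0 /andP[c0 cb].
have n0 : 0 < n%:R :> K by rewrite ltr0n.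
have n1 : 1 <= n%:R :> K by rewrite ler1n.
have u0 := coord_norm_ge0 t; have ule := coord_norm_le t.
set u := coord_norm f t in u0 ule.
set P := pair_mean f rho t; set z := coord f t k.
have zu : `|z| <= u by apply: coord_le.
set Y := P ^+ m; have Y0 : 0 <= Y by rewrite exprn_ge0 // P_ge0.
pose Y' w s := pair_mean f rho (resample t w s) ^+ m.
have Y'0 w s : 0 <= Y' w s by rewrite exprn_ge0 // P_ge0.
set X := q%:R^-1 * _.
have X0 : 0 <= X.
  apply: mulr_ge0; first by rewrite invr_ge0 ler0n.
  by apply: sumr_ge0 => w _; apply: sumr_ge0 => s _; apply: Y'0.
have summand_le : `|stein_summand m t k|
    <= M ^+ 2 * (p%:R + 2) * (n%:R ^+ 2 * Y + n%:R * X).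
  have -> : M ^+ 2 * (p%:R + 2) * (n%:R ^+ 2 * Y + n%:R * X)
    = (2 * q%:R)^-1 * \sum_(w < n) \sum_(s < q)
       2 * M * ((p%:R + 2) * M * n%:R) * (Y + Y' w s).
    under [in RHS]eq_bigr do rewrite -mulr_sumr big_split /= sumr_const card_ord.
    rewrite -mulr_sumr big_split /= sumr_const card_ord /X.
    rewrite -[_ *+ n]mulr_natl -[_ *+ q]mulr_natl.
    by field; rewrite gt_eqF.
  rewrite /stein_summand normrM normfV [`|2 * _|]ger0_norm ?mulr_ge0 ?ler0n //.
  rewrite ler_wpM2l ?invr_ge0 ?mulr_ge0 ?ler0n //.
  apply: le_trans (ler_norm_sum _ _ _) _; apply: ler_sum => w _.
  apply: le_trans (ler_norm_sum _ _ _) _; apply: ler_sum => s _.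
  rewrite normrM -mulrA; apply: ler_pM => //.
  apply: le_trans (ler_normB _ _) _; rewrite mulrDr !normrM.
  have z'u : `|coord f (resample t w s) k| <= u + 2 * M.
    rewrite coord_resample; apply: le_trans (ler_normB _ _) _.
    exact: lerD.
  have uB : u + 2 * M <= (p%:R + 2) * M * n%:R.
    have : M <= M * n%:R by rewrite ler_peMr.
    by move: ule; nra.
  apply: lerD; apply: ler_pM => //; rewrite ?normr_ge0 //.
  - by apply: le_trans zu _; apply: le_trans uB; rewrite lerDl mulr_ge0.
  - by rewrite ger0_norm.
  - exact: le_trans z'u uB.
  - by rewrite ger0_norm //; apply: Y'0.
apply: le_trans (ler_normB _ _) _.
rewrite /far_constant [leRHS]mulrDl; apply: lerD; first by [].
apply: (@le_trans _ _ ((1 + 2 * b * r * (p%:R * M) ^+ 2) * (n%:R ^+ 2 * Y))); last first.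
  by apply: ler_wpM2l => //; rewrite lerDl mulr_ge0 // ltW.
rewrite normrM (ger0_norm Y0) mulrA; apply: ler_wpM2r => //.
apply: le_trans (ler_normD _ _) _; rewrite ger0_norm; last exact: ltW.
rewrite [leRHS]mulrDl; apply: lerD; first by nra.
rewrite !normrM -(expr2 `|z|) (ger0_norm c0) [`|2|]ger0_norm //.
have -> : 2 * b * r * (p%:R * M) ^+ 2 * n%:R ^+ 2
  = 2 * b * r * (p%:R * M * n%:R) ^+ 2 by ring.
apply: ler_pM; rewrite ?mulr_ge0 ?sqr_ge0 //.
  by apply: ler_pM; rewrite ?mulr_ge0 //; apply: ler_wpM2l.
apply: lerXn2r; rewrite ?nnegrE ?mulr_ge0 ?ler0n //.
exact: le_trans zu ule.
Qed.

Definition far_mass (d : K) n m : K :=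
  expect (fun t : {ffun 'I_n -> 'I_q} =>
    (d * n%:R < coord_norm f t)%R%:R * pair_mean f rho t ^+ m).

Lemma coord_norm_sqr_le n (t : {ffun 'I_n -> 'I_q}) :
  coord_norm f t ^+ 2 <= p%:R * \sum_k coord f t k ^+ 2.
Proof.
rewrite expr2 /coord_norm mulr_suml.
have -> : p%:R * \sum_k coord f t k ^+ 2
  = \sum_(k < p) \sum_(l < p) (coord f t k ^+ 2 + coord f t l ^+ 2) / 2.
  under [RHS]eq_bigr do rewrite -mulr_suml big_split /= sumr_const card_ord.
  rewrite -mulr_suml big_split /= sumr_const card_ord sumrMnl -[_ *+ p]mulr_natl.
  by field.
apply: ler_sum => k _; rewrite mulr_sumr; apply: ler_sum => l _.
have := sqr_ge0 (`|coord f t k| - `|coord f t l|).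
rewrite -[coord f t k ^+ 2]real_normK ?num_real //.
rewrite -[coord f t l ^+ 2]real_normK ?num_real //; nra.
Qed.

Lemma coord_norm_resample n (t : {ffun 'I_n -> 'I_q}) w s :
  coord_norm f (resample t w s) <= coord_norm f t + 2 * M * p%:R.
Proof.
have -> : 2 * M * p%:R = \sum_(k < p) 2 * M by rewrite sumr_const card_ord mulr_natr.
rewrite /coord_norm -big_split /=.
apply: ler_sum => k _; rewrite coord_resample.
by apply: le_trans (ler_normB _ _) _; apply: lerD.
Qed.

(** Resampling one vertex moves the coordinates by a bounded amount, so the resampled
    typing still exceeds half the threshold; exchangeability then removes the resampling. *)
Lemma far_mass_resample n m d : (0 < n)%N -> 4 * M * p%:R < d * n%:R ->
  expect (fun t : {ffun 'I_n -> 'I_q} => (d * n%:R < coord_norm f t)%R%:R *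
    (q%:R^-1 * \sum_w \sum_s pair_mean f rho (resample t w s) ^+ m))
  <= n%:R * far_mass (d / 2) n m.
Proof.
move=> n_gt0 dn; rewrite /far_mass /expect mulrA.
rewrite ler_wpM2r ?invr_ge0 ?exprn_ge0 ?ler0n //.
have -> : \sum_(t : {ffun 'I_n -> 'I_q}) (d * n%:R < coord_norm f t)%R%:R *
    (q%:R^-1 * \sum_w \sum_s pair_mean f rho (resample t w s) ^+ m)
  = q%:R^-1 * \sum_w \sum_(t : {ffun 'I_n -> 'I_q}) \sum_s
     (d * n%:R < coord_norm f (resample t w s))%R%:R * pair_mean f rho t ^+ m.
  under eq_bigr do rewrite mulrCA mulr_sumr.
  rewrite -mulr_sumr exchange_big /=; congr (_ * _); apply: eq_bigr => w _.
  under eq_bigr do rewrite mulr_sumr.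
  rewrite (sum_resample w (fun t s =>
    (d * n%:R < coord_norm f t)%R%:R * pair_mean f rho (resample t w s) ^+ m)).
  apply: eq_bigr => t _; apply: eq_bigr => s _.
  have -> // : resample (resample t w s) w (t w) = t.
  by apply/ffunP => v; rewrite !ffunE; case: eqP => // ->.
rewrite ler_pdivrMl //.
have natE j x : j%:R * x = \sum_(i < j) x :> K by rewrite sumr_const card_ord mulr_natl.
rewrite mulrCA [leRHS]natE.
apply: ler_sum => w _.
rewrite mulr_sumr; apply: ler_sum => t _; rewrite [leRHS]natE.
apply: ler_sum => s _; apply: ler_wpM2r; first by rewrite exprn_ge0 // P_ge0.
case: ltP => //= h; rewrite (_ : d / 2 * n%:R < _) // mulrAC.
have := coord_norm_resample t w s; lra.
Qed.

(** The pointwise bounds for the Stein summand, averaged over all typings.  The factor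
    [d] in front of the moments themselves makes the estimate self-improving: for small [d]
    the second moments on the right can be absorbed. *)
Lemma stein_estimate n m k (c d : K) :
  (0 < n)%N -> m%:R = c * n%:R -> 0 <= c <= b -> 0 <= d <= 1 ->
  r * d <= 2^-1 ->
  2 * (2 * b * (2 * (2 * M * r) + p%:R * r * (2 * M) ^+ 2)) * d <= 1 ->
  2 * (2 * b * (2 * (2 * M * r) + p%:R * r * (2 * M) ^+ 2)) <= n%:R ->
  2 * M <= d * n%:R -> 4 * M * p%:R < d * n%:R ->
  `|(1 - 2 * c * rho k) *
      expect (fun t : {ffun 'I_n -> 'I_q} => coord f t k ^+ 2 * pair_mean f rho t ^+ m)
    - n%:R * expect (fun t : {ffun 'I_n -> 'I_q} => pair_mean f rho t ^+ m)|
  <= near_constant * d *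
      (p%:R * \sum_l expect (fun t : {ffun 'I_n -> 'I_q} =>
                 coord f t l ^+ 2 * pair_mean f rho t ^+ m)
       + n%:R * expect (fun t : {ffun 'I_n -> 'I_q} => pair_mean f rho t ^+ m))
     + 2 * far_constant * n%:R ^+ 2 * far_mass (d / 2) n m.
Proof.
move=> n_gt0 mE c0b d01 rd Bd Bn Mn Mpn.
have n0 : 0 < n%:R :> K by rewrite ltr0n.
have [d0 d1] := andP d01.
have nc0 : 0 <= near_constant.
  exact: near_constant_ge0.
set a := expect (fun t => pair_mean f rho t ^+ m).
set sm := expect (fun t => coord f t k ^+ 2 * _).
have -> : (1 - 2 * c * rho k) * sm - n%:R * a =
  expect (fun t : {ffun 'I_n -> 'I_q} => stein_summand m t k -
    (n%:R + 2 * c * rho k * coord f t k ^+ 2) * pair_mean f rho t ^+ m).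
  rewrite expectB; have <- : sm = expect (fun t : {ffun 'I_n -> 'I_q} => stein_summand m t k).
    rewrite {}/sm /expect; congr (_ / _).
    rewrite -(stein_exchange q_gt0 f_mean k
      (fun t : {ffun 'I_n -> 'I_q} => coord f t k * pair_mean f rho t ^+ m)).
    by apply: eq_bigr => t _; rewrite expr2 mulrA.
  have -> : expect (fun t : {ffun 'I_n -> 'I_q} =>
      (n%:R + 2 * c * rho k * coord f t k ^+ 2) * pair_mean f rho t ^+ m)
    = n%:R * a + 2 * c * rho k * sm.
    rewrite /a /sm -!expectZ -expectD; congr expect; apply/funext => t; ring.
  ring.
set NC := near_constant in nc0 *.
apply: le_trans (expect_norm _) _.
pose ind (t : {ffun 'I_n -> 'I_q}) : K := (d * n%:R < coord_norm f t)%R%:R.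
pose Q (t : {ffun 'I_n -> 'I_q}) := q%:R^-1 * \sum_w \sum_s pair_mean f rho (resample t w s) ^+ m.
have pw (t : {ffun 'I_n -> 'I_q}) : `|stein_summand m t k -
      (n%:R + 2 * c * rho k * coord f t k ^+ 2) * pair_mean f rho t ^+ m|
    <= NC * d * (p%:R * \sum_l coord f t l ^+ 2 * pair_mean f rho t ^+ m
                 + n%:R * pair_mean f rho t ^+ m)
       + (far_constant * n%:R ^+ 2 * (ind t * pair_mean f rho t ^+ m)
          + far_constant * n%:R * (ind t * Q t)).
  have P0 := P_ge0 t n_gt0; have Pm0 : 0 <= pair_mean f rho t ^+ m by rewrite exprn_ge0.
  have near_ge0 : 0 <= NC * d * (p%:R * \sum_l coord f t l ^+ 2 * pair_mean f rho t ^+ m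
      + n%:R * pair_mean f rho t ^+ m).
    rewrite mulr_ge0 ?mulr_ge0 // addr_ge0 // mulr_ge0 // sumr_ge0 // => l _.
    by rewrite mulr_ge0 // sqr_ge0.
  rewrite /ind; case: ltP => /= h.
    rewrite !mul1r -[X in X <= _]add0r; apply: lerD => //.
    by apply: le_trans (stein_summand_far _ _ _ n_gt0 c0b) _; rewrite mulrDr !mulrA.
  rewrite !mul0r !mulr0 !addr0.
  apply: le_trans (stein_summand_near k n_gt0 mE c0b d01 rd Bd Bn Mn h P0) _.
  rewrite -/NC -!mulrA; apply: ler_wpM2l => //; apply: ler_wpM2l => //.
  rewrite -mulr_suml mulrA -mulrDl; apply: ler_wpM2r => //.
  by rewrite lerD2r coord_norm_sqr_le.
apply: le_trans (expect_le pw) _.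
rewrite !expectD !expectZ !expectD !expectZ expect_sum.
apply: lerD => //.
have F0 := far_constant_ge0.
have -> : 2 * far_constant * n%:R ^+ 2 * far_mass (d / 2) n m
  = far_constant * n%:R ^+ 2 * far_mass (d / 2) n m
    + far_constant * n%:R * (n%:R * far_mass (d / 2) n m) by ring.
apply: lerD.
  apply: ler_wpM2l; first by rewrite mulr_ge0 ?sqr_ge0.
  apply: expect_le => t; apply: ler_wpM2r; first by rewrite exprn_ge0 // P_ge0.
  rewrite /ind; case: ltP => //= h; rewrite (_ : d / 2 * n%:R < _) //.
  by apply: le_lt_trans h; rewrite ler_wpM2r ?ler0n //; lra.
apply: ler_wpM2l; first by rewrite mulr_ge0 ?ler0n.
exact: far_mass_resample.
Qed.

End SteinEstimate.

(** * Asymptotics of the moments *)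

Section MomentAsymptotics.
Variables (K : realType) (q p : nat).
Variables (f : 'I_p -> 'I_q -> K) (rho : 'I_p -> K).
Hypothesis q_gt0 : (0 < q)%N.
Hypothesis f_mean : forall k, \sum_a f k a = 0.
Hypothesis f_orth : forall k l, \sum_a f k a * f l a = q%:R * (k == l)%:R.
Hypothesis f_complete :
  forall a b, \sum_k f k a * f k b = q%:R * (a == b)%:R - 1.
Hypothesis P_ge0 : forall n (t : {ffun 'I_n -> 'I_q}), (0 < n)%N ->
  0 <= pair_mean f rho t.
Variables (b kappa : K).
Hypothesis b0 : 0 <= b.
Hypothesis kappa0 : 0 < kappa.
Hypothesis kappa_le : forall k c, 0 <= c <= b -> kappa <= 1 - 2 * c * rho k.
Hypothesis far_mass_small : forall d eta : K, 0 < d -> 0 < eta ->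
  exists N : nat, forall n m, (N <= n)%N -> m%:R <= b * n%:R ->
    n%:R ^+ 2 * far_mass f rho d n m <= eta.

Definition moment n m : K :=
  expect (fun t : {ffun 'I_n -> 'I_q} => pair_mean f rho t ^+ m).

Definition second_moment n m k : K :=
  expect (fun t : {ffun 'I_n -> 'I_q} => coord f t k ^+ 2 * pair_mean f rho t ^+ m)
  / n%:R.

Variables (M r : K).
Hypothesis M0 : 0 <= M.
Hypothesis r0 : 0 <= r.
Hypothesis f_le : forall k a, `|f k a| <= M.
Hypothesis rho_le : forall k, `|rho k| <= r.

Lemma moment_ge0 n m : (0 < n)%N -> 0 <= moment n m.
Proof. by move=> n0; apply: expect_ge0 => t; rewrite exprn_ge0 // P_ge0. Qed.

Lemma second_moment_ge0 n m k : (0 < n)%N -> 0 <= second_moment n m k.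
Proof.
move=> n0; rewrite divr_ge0 ?ler0n //; apply: expect_ge0 => t.
by rewrite mulr_ge0 ?sqr_ge0 // exprn_ge0 // P_ge0.
Qed.

(** Here [d] is chosen in terms of [eta], and [n] is then taken large enough for the far
    mass to be negligible. *)
Lemma second_moment_eq (eta : K) : 0 < eta -> exists N : nat, forall n m k,
  (N <= n)%N -> (0 < n)%N -> m%:R <= b * n%:R ->
  `|(1 - 2 * (m%:R / n%:R) * rho k) * second_moment n m k - moment n m|
  <= eta * (\sum_l second_moment n m l + moment n m + 1).
Proof.
move=> eta0.
pose B3 : K := 2 * b * (2 * (2 * M * r) + p%:R * r * (2 * M) ^+ 2).
pose NC := near_constant p M r b.
have NC0 : 0 <= NC by apply: near_constant_ge0.
pose FC := far_constant p M r b.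
have FC0 : 0 <= FC by apply: far_constant_ge0.
have B30 : 0 <= B3 by rewrite !mulr_ge0 // addr_ge0 ?mulr_ge0 // sqr_ge0.
pose eta1 := Num.min 1 eta.
have eta10 : 0 < eta1 by rewrite lt_min ltr01.
have eta11 : eta1 <= 1 by rewrite ge_min lexx.
have eta1e : eta1 <= eta by rewrite ge_min lexx orbT.
have pNC0 : 0 <= NC * (p%:R + 1) by rewrite mulr_ge0 // addr_ge0.
(* Dividing by [DD] meets at once all the smallness conditions on [d]. *)
pose DD := 1 + 2 * r + 2 * B3 + NC * (p%:R + 1).
have DD1 : 1 <= DD by rewrite /DD -!addrA lerDl !addr_ge0 // mulr_ge0.
pose d := eta1 / DD.
have DD0 : 0 < DD by lra.
have d0 : 0 < d by rewrite divr_gt0.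
have dE : d * DD = eta1 by rewrite /d divfK // gt_eqF.
have [rd0 Bd0 Nd0] : [/\ 0 <= r * d, 0 <= B3 * d & 0 <= NC * (p%:R + 1) * d].
  by split; apply: mulr_ge0; rewrite ?(ltW d0).
have dsum : d + 2 * (r * d) + 2 * (B3 * d) + NC * (p%:R + 1) * d = eta1.
  by rewrite -dE /DD; ring.
have [N1 hN1] := eventually_lt_nat (2 * B3 + 2 * M / d + 4 * M * p%:R / d).
have d20 : 0 < d / 2 by rewrite divr_gt0.
have F1 : 0 < 2 * FC + 1 by rewrite ltr_wpDl ?mulr_ge0.
have e20 : 0 < eta / (2 * FC + 1) by rewrite divr_gt0.
have [N2 hN2] := far_mass_small d20 e20.
exists (maxn N1 N2) => n m k; rewrite geq_max => /andP[/hN1 hn1 hn2] n_gt0 hm.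
have n0 : 0 < n%:R :> K by rewrite ltr0n.
have n1 : 1 <= n%:R :> K by rewrite ler1n.
have Md0 : 0 <= 2 * M / d by apply: divr_ge0 (ltW d0); apply: mulr_ge0.
have Mpd0 : 0 <= 4 * M * p%:R / d by apply: divr_ge0 (ltW d0); rewrite !mulr_ge0.
have c0b : 0 <= (m%:R / n%:R : K) <= b by rewrite divr_ge0 //= ler_pdivrMr.
have mE : m%:R = m%:R / n%:R * n%:R :> K by rewrite divfK // gt_eqF.
have d01 : 0 <= d <= 1 by rewrite (ltW d0) /=; lra.
have rd : r * d <= 2^-1 by lra.
have Bd : 2 * B3 * d <= 1 by rewrite -mulrA; lra.
have Bn : 2 * B3 <= n%:R by lra.
have Mn : 2 * M <= d * n%:R by rewrite [d * _]mulrC -ler_pdivrMr //; lra.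
have Mpn : 4 * M * p%:R < d * n%:R.
  rewrite [d * _]mulrC -ltr_pdivrMr //.
  by apply: le_lt_trans hn1; rewrite lerDr; apply: addr_ge0 Md0; apply: mulr_ge0.
have hS := stein_estimate q_gt0 f_mean f_orth f_complete M0 r0 b0 f_le rho_le
  P_ge0 k n_gt0 mE c0b d01 rd Bd Bn Mn Mpn.
have hT := hN2 n m hn2 hm.
rewrite -/(moment n m) -/NC -/FC in hS.
have smE l : expect (fun t : {ffun 'I_n -> 'I_q} =>
    coord f t l ^+ 2 * pair_mean f rho t ^+ m) = n%:R * second_moment n m l.
  by rewrite /second_moment mulrC divfK // gt_eqF.
have s0 : 0 <= \sum_l second_moment n m l.
  by apply: sumr_ge0 => l _; apply: second_moment_ge0.
have a0 := moment_ge0 m n_gt0.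
rewrite smE mulrCA -mulrBr normrM (ger0_norm (ltW n0)) in hS.
rewrite (eq_bigr _ (fun l _ => smE l)) in hS.
rewrite -mulr_sumr in hS.
move: s0 a0 hS hT; set S := \sum_l _; set a := moment n m; set T := far_mass _ _ _ _ _.
set Z := `|_| => s0 a0 hS hT.
have T2 : 2 * FC * n%:R ^+ 2 * T <= eta.
  move: hT; rewrite ler_pdivlMr // => hT.
  have : 0 <= n%:R ^+ 2 * T.
    rewrite mulr_ge0 ?sqr_ge0 //; apply: expect_ge0 => t.
    by rewrite mulr_ge0 // exprn_ge0 // P_ge0.
  by move: hT; rewrite -[2 * FC * _ * _]mulrA; lra.
rewrite -(ler_pM2l n0); apply: le_trans hS _.
have T3 : 2 * FC * n%:R ^+ 2 * T <= n%:R * eta by apply: le_trans T2 _; rewrite ler_peMl // ltW.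
apply: le_trans (lerD (lexx _) T3) _.
have -> : n%:R * (eta * (S + a + 1)) = n%:R * (eta * (S + a)) + n%:R * eta by ring.
rewrite lerD2r.
have -> : NC * d * (p%:R * (n%:R * S) + n%:R * a) = n%:R * (NC * d * (p%:R * S + a)) by ring.
rewrite ler_pM2l //.
apply: (@le_trans _ _ (NC * (p%:R + 1) * d * (S + a))).
  have -> : NC * (p%:R + 1) * d * (S + a) = NC * d * ((p%:R + 1) * (S + a)) by ring.
  apply: ler_wpM2l; first by rewrite mulr_ge0 // ltW.
  have h1 : 0 <= p%:R * a :> K by rewrite mulr_ge0.
  lra.
by apply: ler_wpM2r; lra.
Qed.

(** Because [P - 1] is a combination of the squares [(coord t k / n) ^ 2]. *)
Lemma moment_step_eq n m : (0 < n)%N ->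
  moment n m.+1 - moment n m
  = (\sum_k rho k * second_moment n m k) / n%:R.
Proof.
move=> n_gt0; have n0 : 0 < n%:R :> K by rewrite ltr0n.
rewrite /moment -expectB.
have -> : (\sum_k rho k * second_moment n m k) / n%:R
  = expect (fun t : {ffun 'I_n -> 'I_q} =>
      \sum_k (rho k / n%:R ^+ 2) * (coord f t k ^+ 2 * pair_mean f rho t ^+ m)).
  rewrite expect_sum mulr_suml; apply: eq_bigr => k _.
  by rewrite expectZ /second_moment; field; rewrite gt_eqF.
congr expect; apply/funext => t; rewrite exprS -[X in _ - X]mul1r -mulrBl.
rewrite pair_meanE [X in X * _]addrC addKr mulr_suml mulr_suml.
by apply: eq_bigr => k _; ring.
Qed.

Lemma moment0 n : moment n 0 = 1.
Proof.
rewrite /moment /expect; under eq_bigr do rewrite expr0.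
rewrite sumr_const card_ffun !card_ord natrX divff //.
by rewrite expf_neq0 // pnatr_eq0 -lt0n.
Qed.

Definition growth_rate (c : K) : K := \sum_k rho k / (1 - 2 * c * rho k).

(** The moments satisfy, up to an error small with respect to [1 / n], the Euler scheme of
    the differential equation whose solution is the inverse of
    [\prod_k Num.sqrt (1 - 2 * c * rho k)]. *)
Lemma moment_step eta : 0 < eta -> exists N : nat, forall n m,
  (N <= n)%N -> (0 < n)%N -> m%:R <= b * n%:R ->
  `|moment n m.+1 - moment n m * (1 + growth_rate (m%:R / n%:R) / n%:R)|
  <= eta / n%:R * (moment n m + 1).
Proof.
move=> eta0.
have p0 : 0 <= p%:R :> K by [].
pose C1 := 2 * p%:R / kappa + 1.
have C11 : 1 <= C1.
  by rewrite /C1 lerDr divr_ge0 ?mulr_ge0 // ltW.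
(* [C1] bounds the sum of the second moments in terms of the moment; the inverse of [D] is a
   tolerance small enough to absorb them and to reach [eta]. *)
pose D := 2 * p%:R / kappa + r * p%:R * (C1 + 1) / (kappa * eta) + 1.
have Yg : 0 <= 2 * p%:R / kappa by apply: divr_ge0 (ltW kappa0); apply: mulr_ge0.
have Xg : 0 <= r * p%:R * (C1 + 1) / (kappa * eta).
  apply: divr_ge0; last by rewrite ltW // mulr_gt0.
  by apply: mulr_ge0; [apply: mulr_ge0 | lra].
have D1 : 0 < D by rewrite /D ltr_wpDl // addr_ge0.
pose e := D^-1.
have e0 : 0 < e by rewrite invr_gt0.
have [e1 e2] : p%:R * e <= kappa / 2 /\ r * p%:R * (C1 + 1) * (e / kappa) <= eta.
  split.
    rewrite ler_pdivrMr // [leRHS]mulrC -ler_pdivrMr ?divr_gt0 //.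
    rewrite /D; have -> : p%:R / (kappa / 2) = 2 * p%:R / kappa by field; rewrite gt_eqF.
    by lra.
  rewrite mulrA ler_pdivrMr // ler_pdivrMr //.
  have Y0 : 0 < eta * kappa by rewrite mulr_gt0.
  have -> : r * p%:R * (C1 + 1) = (eta * kappa) * (r * p%:R * (C1 + 1) / (kappa * eta)).
    by field; rewrite !gt_eqF.
  by rewrite ler_pM2l // /D; lra.
have [N hN] := second_moment_eq e0.
exists N => n m Nn n_gt0 hm.
have n0 : 0 < n%:R :> K by rewrite ltr0n.
have c0b : 0 <= (m%:R / n%:R : K) <= b by rewrite divr_ge0 //= ler_pdivrMr.
have {hN} hS k := hN n m k Nn n_gt0 hm.
have g0 k : kappa <= 1 - 2 * (m%:R / n%:R) * rho k by apply: kappa_le.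
set c := m%:R / n%:R in c0b hS g0 *.
have a0 := moment_ge0 m n_gt0; set a := moment n m in a0 hS *.
have sk0 k : 0 <= second_moment n m k by apply: second_moment_ge0.
pose s k := second_moment n m k.
have S0 : 0 <= \sum_k s k by apply: sumr_ge0 => k _; apply: sk0.
rewrite -/(s _) in hS; set S := \sum_l s l in S0.
have {}hS k : `|(1 - 2 * c * rho k) * s k - a| <= e * (S + a + 1) by apply: hS.
have hs k : kappa * s k <= a + e * (S + a + 1).
  have : kappa * s k <= (1 - 2 * c * rho k) * s k by rewrite ler_wpM2r ?sk0.
  by have := hS k; rewrite ler_norml => /andP[_]; lra.
have SC : S <= C1 * (a + 1).
  have h1 : kappa * S <= p%:R * (a + e * (S + a + 1)).
    rewrite mulr_natl -[p in _ *+ p]card_ord -sumr_const /S mulr_sumr.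
    by apply: ler_sum.
  have h2 : p%:R * (e * (S + a + 1)) <= kappa / 2 * (S + a + 1).
    by rewrite mulrA ler_wpM2r //; lra.
  have h3 : kappa * S <= p%:R * a + kappa / 2 * (S + a + 1).
    by apply: le_trans h1 _; rewrite mulrDr lerD2l.
  have h4 : kappa / 2 * S <= p%:R * (a + 1) + kappa / 2 * (a + 1) by lra.
  have -> : C1 * (a + 1) = (kappa / 2)^-1 * (p%:R * (a + 1) + kappa / 2 * (a + 1)).
    by rewrite /C1; field; rewrite gt_eqF.
  by rewrite ler_pdivlMl // divr_gt0.
have dev k : `|s k - a / (1 - 2 * c * rho k)| <= e / kappa * ((C1 + 1) * (a + 1)).
  have gk : 0 < 1 - 2 * c * rho k by apply: lt_le_trans (g0 k).
  have -> : s k - a / (1 - 2 * c * rho k)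
    = ((1 - 2 * c * rho k) * s k - a) / (1 - 2 * c * rho k).
    by field; rewrite gt_eqF.
  rewrite normrM normfV (ger0_norm (ltW gk)) ler_pdivrMr //.
  apply: le_trans (hS k) _.
  have -> : e / kappa * ((C1 + 1) * (a + 1)) * (1 - 2 * c * rho k)
     = e * (C1 + 1) * (a + 1) * ((1 - 2 * c * rho k) / kappa) by ring.
  apply: (@le_trans _ _ (e * (C1 + 1) * (a + 1))).
    by rewrite -mulrA ler_pM2l //; lra.
  have X0 : 0 <= e * (C1 + 1) * (a + 1).
    by apply: mulr_ge0; [apply: mulr_ge0 (ltW e0) _; lra | lra].
  by rewrite ler_peMr // ler_pdivlMr // mul1r.
have -> : moment n m.+1 - a * (1 + growth_rate c / n%:R)
  = (\sum_k rho k * (s k - a / (1 - 2 * c * rho k))) / n%:R.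
  have -> : moment n m.+1 = a + (\sum_k rho k * s k) / n%:R.
    by rewrite -(moment_step_eq _ n_gt0) addrC subrK.
  under [in RHS]eq_bigr do rewrite mulrBr.
  rewrite sumrB /growth_rate.
  have -> : \sum_k rho k * (a / (1 - 2 * c * rho k))
     = a * \sum_k rho k / (1 - 2 * c * rho k).
    by rewrite mulr_sumr; apply: eq_bigr => k _; ring.
  ring.
rewrite normrM normfV (ger0_norm (ltW n0)) mulrAC ler_pM2r ?invr_gt0 //.
apply: le_trans (ler_norm_sum _ _ _) _.
apply: (@le_trans _ _ (\sum_(k < p) r * (e / kappa * ((C1 + 1) * (a + 1))))).
  by apply: ler_sum => k _; rewrite normrM ler_pM.
rewrite sumr_const card_ord -[_ *+ p]mulr_natl.
have -> : p%:R * (r * (e / kappa * ((C1 + 1) * (a + 1))))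
  = r * p%:R * (C1 + 1) * (e / kappa) * (a + 1) by ring.
by rewrite ler_wpM2r //; lra.
Qed.

Definition root_prod (c : K) : K := \prod_k Num.sqrt (1 - 2 * c * rho k).

(** The product of the moment by [root_prod] changes by at most [eps / n] in one step,
    relative to its size: the growth of the moment is compensated by the first-order
    variation of the square roots. *)
Lemma moment_asymptotics (eta : K) : 0 < eta -> exists N : nat, forall n m,
  (N <= n)%N -> (0 < n)%N -> m%:R <= b * n%:R ->
  `|moment n m * root_prod (m%:R / n%:R) - 1| <= eta.
Proof.
move=> eta0; have p0 : 0 <= p%:R :> K by [].
pose eps := Num.min eta 1 / (4 * (b + 1)).
have b1 : 0 < b + 1 by rewrite ltr_wpDl.
have min0 : 0 < Num.min eta 1 by rewrite lt_min eta0 ltr01.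
have eps0 : 0 < eps by rewrite divr_gt0 // mulr_gt0.
have epsE : eps * (4 * (b + 1)) = Num.min eta 1.
  by rewrite divfK // gt_eqF // mulr_gt0.
have epsb : 4 * (eps * b) <= Num.min eta 1 by rewrite -epsE; lra.
have epsb1 : 4 * (eps * b) <= eta by apply: le_trans epsb _; rewrite ge_min lexx.
have epsb2 : eps * b <= 2^-1.
  have : Num.min eta 1 <= 1 by rewrite ge_min lexx orbT.
  by lra.
pose sz := size (index_enum 'I_p : seq 'I_p).
pose p2 : K := 2 ^+ sz; pose p4 : K := 4 ^+ sz.
have p20 : 0 < p2 by rewrite exprn_gt0.
have p40 : 0 < p4 by rewrite exprn_gt0.
pose H := 2 * r / kappa; have H0 : 0 <= H by apply: divr_ge0 (ltW kappa0); apply: mulr_ge0.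
pose G := H ^+ 2 * (p%:R ^+ 2 + p4 * (1 + p%:R)).
have G0 : 0 <= G.
  apply: mulr_ge0 (sqr_ge0 _) _; apply: addr_ge0 (sqr_ge0 _) _.
  by apply: mulr_ge0 (ltW p40) _; lra.
pose Bm := \prod_(k < p) (1 + 2 * b * r).
have br0 : 0 <= 2 * b * r by rewrite !mulr_ge0.
have Bm1 : 1 <= Bm.
  by rewrite /Bm prodr_const card_ord exprn_ege1 // lerDl.
have Bm0 : 0 < Bm by apply: lt_le_trans Bm1.
pose e := eps / (2 * p2 * Bm).
have e0 : 0 < e by rewrite divr_gt0 // !mulr_gt0.
have eE : e * p2 * Bm = eps / 2 by rewrite /e; field; rewrite !gt_eqF.
have [N1 hN1] := moment_step e0.
have [N2 hN2] := eventually_lt_nat (2 * H + 2 * G / eps).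
exists (maxn N1 N2) => n m; rewrite geq_max => /andP[hn1 /hN2 hn2] n_gt0 hm.
have n0 : 0 < n%:R :> K by rewrite ltr0n.
have Ge0 : 0 <= 2 * G / eps by apply: divr_ge0 (ltW eps0); apply: mulr_ge0.
pose v j := moment n j * root_prod (j%:R / n%:R).
apply: le_trans epsb1; rewrite -/(v m).
apply: (@discrete_gronwall _ v eps b n%:R) => //; first exact: ltW.
  rewrite /v moment0 mul1r mul0r /root_prod big1 // => k _.
  by rewrite mulr0 mul0r subr0 sqrtr1.
move=> {hm}{}m hm.
have hm0 : m%:R <= b * n%:R by apply: le_trans hm; rewrite ler_nat.
have := hN1 n m hn1 n_gt0 hm0.
have a0 := moment_ge0 m n_gt0.
rewrite /v; set c := m%:R / n%:R.
have c0b : 0 <= c <= b by rewrite divr_ge0 //= ler_pdivrMr.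
have g0 k : kappa <= 1 - 2 * c * rho k by apply: kappa_le.
have gk k : 0 < 1 - 2 * c * rho k by apply: lt_le_trans (g0 k).
pose x k := 2 * rho k / (1 - 2 * c * rho k) / n%:R.
pose y := H / n%:R.
have y0 : 0 <= y by apply: divr_ge0.
have y12 : y <= 2^-1 by rewrite ler_pdivrMr //; lra.
have xy k : `|x k| <= y.
  rewrite /x /y !normrM !normfV (ger0_norm (ltW n0)) ler_pM2r ?invr_gt0 //.
  rewrite [`|2|]ger0_norm // (ger0_norm (ltW (gk k))) /H.
  apply: ler_pM; rewrite ?mulr_ge0 ?invr_ge0 ?(ltW (gk k)) //.
    by apply: ler_wpM2l.
  by rewrite lef_pV2 ?posrE.
set sg := growth_rate c / n%:R.
have sgE : sg = (\sum_k x k) / 2.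
  rewrite /sg /growth_rate !mulr_suml; apply: eq_bigr => k _; rewrite /x.
  by field; rewrite !gt_eqF.
have [/andP[Pi0 Pi2] hPi] : 0 <= \prod_k Num.sqrt (1 - x k) <= p2 /\
  `|\prod_k Num.sqrt (1 - x k) - 1 + (\sum_k x k) / 2| <= p4 * y ^+ 2.
  by apply: prod_sqrt_second_order => //; rewrite y0.
have sgle : `|sg| <= p%:R * y / 2.
  rewrite sgE normrM normfV [`|2|]ger0_norm // ler_pM2r ?invr_gt0 //.
  apply: le_trans (ler_norm_sum _ _ _) _.
  have -> : p%:R * y = \sum_(k < p) y by rewrite sumr_const card_ord mulr_natl.
  exact: ler_sum.
have rootS : root_prod (m.+1%:R / n%:R) = root_prod c * \prod_k Num.sqrt (1 - x k).
  rewrite /root_prod -big_split /=; apply: eq_bigr => k _.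
  rewrite -sqrtrM; last exact: ltW.
  have -> : m.+1%:R / n%:R = c + n%:R^-1 by rewrite -natr1 mulrDl mul1r.
  congr Num.sqrt; rewrite /x; move: (gk k); clearbody c => gk'.
  by field; rewrite (gt_eqF n0) (gt_eqF gk').
rewrite rootS -sgE in hPi *.
move: Pi0 Pi2 hPi; set Pi := \prod_k _ => Pi0 Pi2 hPi herr.
set B := root_prod c.
have B0 : 0 <= B by apply: prodr_ge0 => k _; apply: sqrtr_ge0.
have BBm : B <= Bm.
  apply: ler_prod => k _; rewrite sqrtr_ge0 /=.
  have cr : `|2 * c * rho k| <= 2 * b * r.
    have [c0 cb] := andP c0b.
    have c20 : 0 <= 2 * c by apply: mulr_ge0.
    rewrite (normrM (2 * c)) (ger0_norm c20).
    by apply: ler_pM => //; apply: ler_wpM2l.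
  have h1 : 1 - 2 * c * rho k <= 1 + 2 * b * r.
    by move: cr; rewrite ler_norml => /andP[]; lra.
  have h2 : 1 - 2 * c * rho k <= (1 + 2 * b * r) ^+ 2 by nra.
  by rewrite -[leRHS]ger0_norm ?addr_ge0 // -sqrtr_sqr ler_sqrt // sqr_ge0.
set a := moment n m in a0 herr *; set a' := moment n m.+1 in herr *.
set err := a' - a * (1 + sg) in herr; set th := Pi - 1 + sg in hPi.
have -> : a' * (B * Pi) - a * B
  = a * B * (- sg ^+ 2 + th * (1 + sg)) + err * (Pi * B).
  by rewrite /err /th; ring.
apply: le_trans (ler_normD _ _) _.
have aB0 : 0 <= a * B by rewrite mulr_ge0.
rewrite normrM !(ger0_norm aB0) normrM [`|Pi * B|]ger0_norm ?mulr_ge0 //.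
have yn : y ^+ 2 = H ^+ 2 / n%:R / n%:R by rewrite /y; field; rewrite gt_eqF.
have t1 : `|- sg ^+ 2 + th * (1 + sg)| <= eps / 2 / n%:R.
  apply: (@le_trans _ _ (G / n%:R / n%:R)); last first.
    rewrite ler_pM2r ?invr_gt0 // ler_pdivrMr // -ler_pdivrMl; last by apply: divr_gt0.
    by have -> : (eps / 2)^-1 * G = 2 * G / eps; [field; rewrite gt_eqF | lra].
  rewrite [leRHS](_ : _ = y ^+ 2 * p%:R ^+ 2 + (p4 * y ^+ 2) * (1 + p%:R)); last first.
    by rewrite yn /G; ring.
  apply: le_trans (ler_normD _ _) _; apply: lerD.
    have yp0 : 0 <= y * p%:R by apply: mulr_ge0.
    rewrite normrN normrX -exprMn; apply: lerXn2r; rewrite ?nnegrE //.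
    by apply: le_trans sgle _; lra.
  rewrite normrM; apply: ler_pM => //.
  apply: le_trans (ler_normD _ _) _; rewrite normr1 lerD2l.
  apply: le_trans sgle _; have : p%:R * y <= p%:R * 2^-1 by apply: ler_wpM2l.
  by lra.
have t2 : `|err| * (Pi * B) <= eps / 2 / n%:R * (a * B + 1).
  apply: (@le_trans _ _ (e / n%:R * (a + 1) * (p2 * B))).
    apply: ler_pM; rewrite ?mulr_ge0 //.
    exact: ler_wpM2r.
  have -> : eps / 2 / n%:R * (a * B + 1) = e / n%:R * p2 * (a * B * Bm + Bm).
    by rewrite -eE; ring.
  have -> : e / n%:R * (a + 1) * (p2 * B) = e / n%:R * p2 * (a * B + B) by ring.
  apply: ler_wpM2l; first by apply: mulr_ge0 (ltW p20); apply: divr_ge0 (ltW e0) _.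
  by apply: lerD => //; rewrite ler_peMr.
apply: le_trans (lerD (ler_wpM2l aB0 t1) t2) _.
have : 0 <= eps / n%:R by rewrite divr_ge0 // ltW.
lra.
Qed.

End MomentAsymptotics.

(** * Relative entropy and typings far from equidistribution *)

Section RelativeEntropy.
Variables (K : realType).

(** Apply [ln y <= y - 1] at the inverse square root of [t]. *)
Lemma ln_lower (t : K) : 0 <= t -> (Num.sqrt t - 1) ^+ 2 <= t * ln t - t + 1.
Proof.
rewrite le_eqVlt => /orP[/eqP <-|t0].
  by rewrite mul0r sqrtr0 subr0 sub0r sqrrN expr1n add0r.
set s := Num.sqrt t.
have s0 : 0 < s by rewrite sqrtr_gt0.
have tE : t = s ^+ 2 by rewrite sqr_sqrtr // ltW.
have h : ln s^-1 <= s^-1 - 1.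
  have := @le_ln1Dx K (s^-1 - 1); rewrite [1 + _]addrC subrK; apply.
  by rewrite ltrBrDl subrr invr_gt0.
rewrite lnV ?posrE // in h.
have -> : ln t = 2 * ln s by rewrite tE lnXn // mulr_natl.
have h2 : 1 - s^-1 <= ln s by lra.
have h3 : s ^+ 2 * (1 - s^-1) <= s ^+ 2 * ln s by rewrite ler_wpM2l ?sqr_ge0.
have h4 : s ^+ 2 * (1 - s^-1) = s ^+ 2 - s by field; rewrite gt_eqF.
rewrite h4 in h3; rewrite tE; lra.
Qed.

Lemma ln_lower_bounded (t B : K) : 1 <= B -> 0 <= t <= B ->
  (t - 1) ^+ 2 / (B + 1) ^+ 2 <= t * ln t - t + 1.
Proof.
move=> B1 /andP[t0 tB]; apply: le_trans (ln_lower t0).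
have s0 := sqrtr_ge0 t; have := sqr_sqrtr t0.
move: (Num.sqrt t) s0 => s s0 sE.
have sB : s <= B by nra.
rewrite ler_pdivrMr ?exprn_gt0 //; last by lra.
rewrite -exprMn -sE (_ : s ^+ 2 - 1 = (s - 1) * (s + 1)); last by ring.
rewrite !exprMn; apply: ler_wpM2l; first exact: sqr_ge0.
by apply: lerXn2r; rewrite ?nnegrE; lra.
Qed.

Variable (q : nat).
Hypothesis q_gt0 : (0 < q)%N.
Let q0 : 0 < q%:R :> K. Proof. by rewrite ltr0n. Qed.

(** Relative entropy with respect to the uniform law; the convention [0 * ln 0 = 0] holds
    because [ln] vanishes outside the positive numbers. *)
Definition entropy (x : 'I_q -> K) : K := \sum_i x i * ln (q%:R * x i).

(** A form of Pinsker's inequality, summing [ln_lower_bounded] over the types. *)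
Lemma entropy_ge_sqr (x : 'I_q -> K) :
  (forall i, 0 <= x i) -> \sum_i x i = 1 ->
  (\sum_i (q%:R * x i - 1) ^+ 2) / (q%:R * (q%:R + 1) ^+ 2) <= entropy x.
Proof.
move=> x0 x1.
have xle i : x i <= 1.
  by rewrite -x1 (bigD1 i) //= lerDl sumr_ge0.
have -> : entropy x = (\sum_i (q%:R * x i * ln (q%:R * x i) - q%:R * x i + 1)) / q%:R.
  rewrite big_split /= sumrB sumr_const card_ord -mulr_sumr x1 mulr1 addrNK.
  by rewrite mulr_suml; apply: eq_bigr => i _; field; rewrite gt_eqF.
rewrite invfM mulrA mulrAC ler_pM2r ?invr_gt0 // mulr_suml.
apply: ler_sum => i _; apply: ln_lower_bounded; first by rewrite ler1n.
by rewrite mulr_ge0 //= -[leRHS]mulr1 ler_wpM2l.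
Qed.

Lemma entropy_ge0 (x : 'I_q -> K) :
  (forall i, 0 <= x i) -> \sum_i x i = 1 -> 0 <= entropy x.
Proof.
move=> x0 x1; apply: le_trans (entropy_ge_sqr x0 x1).
rewrite divr_ge0 ?mulr_ge0 ?sqr_ge0 // sumr_ge0 // => i _; exact: sqr_ge0.
Qed.

Definition freq n (t : {ffun 'I_n -> 'I_q}) i : K :=
  (\sum_w (t w == i)%:R) / n%:R.

Lemma freq_ge0 n (t : {ffun 'I_n -> 'I_q}) i : 0 <= freq t i.
Proof. by rewrite divr_ge0 // sumr_ge0. Qed.

Lemma sum_freq n (t : {ffun 'I_n -> 'I_q}) (h : 'I_q -> K) :
  \sum_i freq t i * h i = (\sum_w h (t w)) / n%:R.
Proof.
under eq_bigr do rewrite mulrAC mulr_suml.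
rewrite -mulr_suml exchange_big /=; congr (_ / _); apply: eq_bigr => w _.
rewrite (bigD1 (t w)) //= eqxx mul1r big1 ?addr0 // => i.
by rewrite eq_sym => /negPf ->; rewrite mul0r.
Qed.

Lemma sum_freq1 n (t : {ffun 'I_n -> 'I_q}) : (0 < n)%N -> \sum_i freq t i = 1.
Proof.
move=> n0; under eq_bigr do rewrite -[freq t _]mulr1.
by rewrite sum_freq sumr_const card_ord divff // pnatr_eq0 -lt0n.
Qed.

Lemma freq_gt0 n (t : {ffun 'I_n -> 'I_q}) w : 0 < freq t (t w).
Proof.
rewrite divr_gt0 ?ltr0n //; last by apply: leq_ltn_trans (ltn_ord w).
by rewrite (bigD1 w) //= eqxx ltr_pwDl // sumr_ge0.
Qed.

(** The likelihood ratio between the product of the empirical law of [t] and the uniform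
    law, evaluated at [t] itself. *)
Lemma expR_entropy_freq n (t : {ffun 'I_n -> 'I_q}) :
  expR (n%:R * entropy (freq t)) = q%:R ^+ n * \prod_w freq t (t w).
Proof.
have [n0|n0] := posnP n.
  by subst n; rewrite mul0r expR0 big_ord0 expr0 mulr1.
rewrite /entropy sum_freq mulrCA divff ?mulr1 ?pnatr_eq0 -?lt0n //.
rewrite expR_sum.
rewrite (eq_bigr (fun w => q%:R * freq t (t w))) => [|w _]; last first.
  by rewrite lnK // posrE mulr_gt0 // freq_gt0.
by rewrite big_split /= prodr_const card_ord.
Qed.

(** Group the typings by class sizes: by the multinomial theorem each vector of class sizes
    contributes at most [1], and there are at most [(n + 1) ^ q] such vectors. *)
Lemma sum_prod_freq_le n :
  \sum_(t : {ffun 'I_n -> 'I_q}) \prod_w freq t (t w) <= n.+1%:R ^+ q.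
Proof.
have cnt_lt (t : {ffun 'I_n -> 'I_q}) i : (\sum_w (t w == i) < n.+1)%N.
  rewrite ltnS -[X in (_ <= X)%N]card_ord -sum1_card.
  by apply: leq_sum => w _; apply: leq_b1.
pose cnt (t : {ffun 'I_n -> 'I_q}) : {ffun 'I_q -> 'I_n.+1} :=
  [ffun i => Ordinal (cnt_lt t i)].
pose C : pred {ffun 'I_q -> 'I_n.+1} := fun N => (\sum_i N i == n)%N.
have cntC t : C (cnt t).
  rewrite /C; apply/eqP; under eq_bigr do rewrite ffunE /=.
  rewrite exchange_big /=; under eq_bigr => w _.
    rewrite (bigD1 (t w)) //= eqxx big1 ?addn0; last first.
      by move=> i; rewrite eq_sym => /negPf ->.
    over.
  by rewrite sum1_card card_ord.
have freqE t i : freq t i = (cnt t i)%:R / n%:R.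
  by rewrite /freq ffunE /= natr_sum.
rewrite (partition_big cnt C) //=.
apply: (@le_trans _ _ (\sum_(N : {ffun 'I_q -> 'I_n.+1} | C N) 1)); last first.
  apply: (@le_trans _ _ (\sum_(N : {ffun 'I_q -> 'I_n.+1}) 1)).
    by rewrite [leLHS]big_mkcond /=; apply: ler_sum => N _; case: ifP.
  by rewrite sumr_const card_ffun !card_ord natrX.
apply: ler_sum => N CN.
have -> : \sum_(t | cnt t == N) \prod_w freq t (t w)
  = \sum_(t | cnt t == N) \prod_(w < n) ((N (t w))%:R / n%:R : K).
  by apply: eq_bigr => t /eqP <-; apply: eq_bigr => w _; rewrite freqE.
apply: (@le_trans _ _ (\sum_(t : {ffun 'I_n -> 'I_q}) \prod_(w < n) ((N (t w))%:R / n%:R : K))).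
  rewrite [leLHS]big_mkcond /=; apply: ler_sum => t _; case: ifP => // _.
  by apply: prodr_ge0 => w _; apply: divr_ge0.
rewrite -(bigA_distr_bigA (fun (w : 'I_n) i => (N i)%:R / n%:R : K)) /=.
rewrite prodr_const card_ord -mulr_suml -natr_sum (eqP CN).
have [->|n0] := posnP n; first by rewrite expr0.
by rewrite divff ?expr1n // pnatr_eq0 -lt0n.
Qed.

End RelativeEntropy.

Section FarMass.
Variables (K : realType) (q p : nat).
Variables (f : 'I_p -> 'I_q -> K) (rho : 'I_p -> K).
Hypothesis q_gt0 : (0 < q)%N.
Hypothesis f_complete :
  forall a b, \sum_k f k a * f k b = q%:R * (a == b)%:R - 1.
Hypothesis P_ge0 : forall n (t : {ffun 'I_n -> 'I_q}), (0 < n)%N ->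
  0 <= pair_mean f rho t.
Variables (b c : K).
Hypothesis b0 : 0 <= b.
Hypothesis bc : b < c.
Hypothesis entropy_bound : forall x : 'I_q -> K,
  (forall i, 0 <= x i) -> \sum_i x i = 1 ->
  1 + \sum_k rho k * (\sum_i x i * f k i) ^+ 2 <= expR (entropy x / c).

Let q0 : 0 < q%:R :> K. Proof. by rewrite ltr0n. Qed.

Lemma coord_freq n (t : {ffun 'I_n -> 'I_q}) k :
  coord f t k / n%:R = \sum_i freq K t i * f k i.
Proof. by rewrite sum_freq. Qed.

Lemma pair_mean_freq n (t : {ffun 'I_n -> 'I_q}) :
  pair_mean f rho t = 1 + \sum_k rho k * (\sum_i freq K t i * f k i) ^+ 2.
Proof. by rewrite /pair_mean; under eq_bigr do rewrite coord_freq. Qed.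

(** Parseval's identity for the basis made of the constant and the [f k]. *)
Lemma sum_coordinates_sqr (x : 'I_q -> K) : \sum_i x i = 1 ->
  q%:R * (\sum_k (\sum_i x i * f k i) ^+ 2) = \sum_i (q%:R * x i - 1) ^+ 2.
Proof.
move=> x1.
have -> : \sum_k (\sum_i x i * f k i) ^+ 2 = q%:R * (\sum_i x i ^+ 2) - 1.
  have -> : \sum_k (\sum_i x i * f k i) ^+ 2
    = \sum_i \sum_j x i * x j * (q%:R * (i == j)%:R - 1).
    under eq_bigr do rewrite expr2 mulr_suml.
    rewrite exchange_big /=; apply: eq_bigr => i _.
    under eq_bigr do rewrite mulr_sumr.
    rewrite exchange_big /=; apply: eq_bigr => j _.
    rewrite -f_complete mulr_sumr; apply: eq_bigr => k _; ring.
  have E1 : \sum_i \sum_j x i * x j = 1.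
    under eq_bigr do rewrite -mulr_sumr x1 mulr1.
    by rewrite x1.
  rewrite -[X in _ = _ - X]E1.
  rewrite mulr_sumr -sumrB; apply: eq_bigr => i _.
  under [LHS]eq_bigr do rewrite mulrBr mulr1.
  rewrite sumrB; congr (_ - _).
  rewrite (bigD1 i) //= eqxx mulr1 big1 ?addr0; first by ring.
  by move=> j; rewrite eq_sym => /negPf ->; rewrite !mulr0.
under [RHS]eq_bigr do rewrite sqrrB expr1n mulr1 exprMn.
rewrite big_split sumrB /= -mulr_sumr sumr_const card_ord.
under [X in _ = _ - X + _]eq_bigr do rewrite -mulr_natl.
rewrite -!mulr_sumr x1; ring.
Qed.

Lemma entropy_ge_coord_norm n (t : {ffun 'I_n -> 'I_q}) : (0 < n)%N ->
  (coord_norm f t / n%:R) ^+ 2 / ((p%:R + 1) * (q%:R + 1) ^+ 2)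
  <= entropy (freq K t).
Proof.
move=> n_gt0; have n0 : 0 < n%:R :> K by rewrite ltr0n.
have x1 := sum_freq1 K t n_gt0.
apply: le_trans (entropy_ge_sqr q_gt0 (freq_ge0 K t) x1).
rewrite -(sum_coordinates_sqr x1).
set S := \sum_k _.
have S0 : 0 <= S by apply: sumr_ge0 => k _; apply: sqr_ge0.
have q1 : 0 < (q%:R + 1) ^+ 2 :> K by rewrite exprn_gt0 // addr_gt0.
have p1 : 0 < p%:R + 1 :> K by rewrite ltr_wpDl.
have -> : q%:R * S / (q%:R * (q%:R + 1) ^+ 2) = S / (q%:R + 1) ^+ 2.
  by field; rewrite !gt_eqF // addr_gt0.
rewrite invfM mulrA ler_pM2r ?invr_gt0 // ler_pdivrMr //.
rewrite expr_div_n ler_pdivrMr ?exprn_gt0 //.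
apply: le_trans (coord_norm_sqr_le f t) _.
have -> : S * (p%:R + 1) * n%:R ^+ 2 = (p%:R + 1) * \sum_k coord f t k ^+ 2.
  rewrite [S * _]mulrC -mulrA; congr (_ * _).
  rewrite /S mulr_suml; apply: eq_bigr => k _.
  by rewrite -coord_freq expr_div_n divfK // expf_neq0 // gt_eqF.
apply: ler_wpM2r; last by rewrite lerDl.
by apply: sumr_ge0 => k _; apply: sqr_ge0.
Qed.

(** The weight of a typing is at most [expR (m * H / c) <= expR (n * H * b / c)], and the sum of
    [expR (n * H)] over all typings is polynomially bounded; far from equidistribution [H] is
    bounded below, so the gap between [b] and [c] leaves an exponentially small factor. *)
Lemma far_mass_limit (d eta : K) : 0 < d -> 0 < eta ->
  exists N : nat, forall n m, (N <= n)%N -> m%:R <= b * n%:R ->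
    n%:R ^+ 2 * far_mass f rho d n m <= eta.
Proof.
move=> d0 eta0; have c0 : 0 < c by apply: le_lt_trans bc.
pose hd := d ^+ 2 / ((p%:R + 1) * (q%:R + 1) ^+ 2).
have hd0 : 0 < hd.
  by rewrite divr_gt0 ?exprn_gt0 // mulr_gt0 ?exprn_gt0 ?ltr_wpDl.
pose tau := (1 - b / c) * hd.
have tau0 : 0 < tau by rewrite mulr_gt0 // subr_gt0 ltr_pdivrMr // mul1r.
have [N hN] := poly_expR_small q tau0 eta0.
exists N => n m Nn hm; have [->|n_gt0] := posnP n.
  by rewrite expr0n mul0r ltW.
have n0 : 0 < n%:R :> K by rewrite ltr0n.
apply: le_trans (hN n Nn); rewrite -[leRHS]mulrA ler_wpM2l ?sqr_ge0 //.
rewrite /far_mass /expect ler_pdivrMr ?exprn_gt0 //.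
rewrite [leRHS](_ : _ = expR (- (tau * n%:R)) * (q%:R ^+ n * n.+1%:R ^+ q)); last by ring.
apply: (@le_trans _ _ (expR (- (tau * n%:R)) *
   (\sum_(t : {ffun 'I_n -> 'I_q}) q%:R ^+ n * \prod_w freq K t (t w)))); last first.
  rewrite ler_pM2l ?expR_gt0 // -mulr_sumr ler_wpM2l ?exprn_ge0 //.
  exact: sum_prod_freq_le.
rewrite mulr_sumr; apply: ler_sum => t _.
rewrite -expR_entropy_freq // -expRD.
case: ltP => [far|_] /=; last by rewrite mul0r expR_ge0.
rewrite mul1r.
have x0 := freq_ge0 K t; have x1 := sum_freq1 K t n_gt0.
have H0 := entropy_ge0 q_gt0 x0 x1.
apply: (@le_trans _ _ (expR (entropy (freq K t) / c) ^+ m)).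
  rewrite lerXn2r ?nnegrE ?expR_ge0 ?P_ge0 // pair_mean_freq.
  exact: entropy_bound.
rewrite -expRM_natl ler_expR.
have Hd : hd <= entropy (freq K t).
  apply: le_trans (entropy_ge_coord_norm t n_gt0).
  rewrite /hd ler_pM2r; last by rewrite invr_gt0 mulr_gt0 ?exprn_gt0 ?ltr_wpDl.
  apply: lerXn2r; rewrite ?nnegrE ?(ltW d0) // ?divr_ge0 ?coord_norm_ge0 //.
  by rewrite ler_pdivlMr // ltW.
set H := entropy _ in H0 Hd *.
apply: (@le_trans _ _ (b / c * n%:R * H)).
  rewrite mulrA [leRHS](_ : _ = b * n%:R * H / c); last by ring.
  by rewrite ler_pM2r ?invr_gt0 // ler_wpM2r.
have : (1 - b / c) * n%:R * hd <= (1 - b / c) * n%:R * H.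
  apply: ler_wpM2l => //; apply: mulr_ge0 => //.
  by rewrite subr_ge0 ler_pdivrMr // mul1r ltW.
by rewrite /tau; lra.
Qed.

End FarMass.

(** * Paths of invertible symmetric matrices *)

Lemma cvg_finite_sum (K : realType) (I : finType) (F : I -> K -> K) (a : I -> K) (s : K) :
  (forall i, F i x @[x --> s] --> a i) ->
  \sum_i F i x @[x --> s] --> \sum_i a i.
Proof.
move=> cF; elim: (index_enum I) => [|i r IH].
  rewrite big_nil; under eq_cvg do rewrite big_nil.
  exact: cvg_cst.
rewrite big_cons; under eq_cvg do rewrite big_cons.
by apply: cvgD; [exact: cF | exact: IH].
Qed.

Section PositiveSemidefinite.
Variables (K : realType) (n : nat).
Implicit Types (A : 'M[K]_n) (v : 'cV[K]_n).

Definition psd A := forall v, 0 <= (v^T *m A *m v) 0 0.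

Definition sqr_norm v : K := \sum_i v i 0 ^+ 2.

Lemma sqr_normE v : (v^T *m v) 0 0 = sqr_norm v.
Proof. by rewrite mxE; apply: eq_bigr => i _; rewrite mxE expr2. Qed.

Lemma mxform_sum A v : (v^T *m A *m v) 0 0 = \sum_i \sum_j v i 0 * A i j * v j 0.
Proof.
rewrite mxE exchange_big /=; apply: eq_bigr => j _.
by rewrite mxE mulr_suml; apply: eq_bigr => i _; rewrite mxE.
Qed.

Lemma sqr_norm_ge0 v : 0 <= sqr_norm v.
Proof. by apply: sumr_ge0 => i _; apply: sqr_ge0. Qed.

Lemma mxform_le A v C : (forall i j, `|A i j| <= C) ->
  `|(v^T *m A *m v) 0 0| <= n%:R * C * sqr_norm v.
Proof.
move=> AC; rewrite mxform_sum.
have -> : n%:R * C * sqr_norm v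
  = \sum_(i < n) \sum_(j < n) C * ((v i 0 ^+ 2 + v j 0 ^+ 2) / 2).
  under eq_bigr do rewrite -mulr_sumr -mulr_suml big_split /= sumr_const card_ord.
  rewrite -mulr_sumr -mulr_suml big_split /= sumr_const card_ord sumrMnl.
  by rewrite -/(sqr_norm v) -[_ *+ n]mulr_natl; field.
apply: le_trans (ler_norm_sum _ _ _) _; apply: ler_sum => i _.
apply: le_trans (ler_norm_sum _ _ _) _; apply: ler_sum => j _.
rewrite !normrM mulrAC [_ * `|A i j|]mulrC; apply: ler_pM => //.
have := sqr_ge0 (`|v i 0| - `|v j 0|).
rewrite -[v i 0 ^+ 2]real_normK ?num_real // -[v j 0 ^+ 2]real_normK ?num_real //.
nra.
Qed.

(** Testing positivity on [v - tau *: A^-1 v] bounds the form at [v] below by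
    [2 * tau - tau ^ 2 * C] times the squared norm of [v], where [C] bounds the form of
    [A^-1]; then take [tau = C^-1]. *)
Lemma psd_coercive A : A^T = A -> A \in unitmx -> psd A ->
  exists2 eps : K, 0 < eps & forall v, eps * sqr_norm v <= (v^T *m A *m v) 0 0.
Proof.
move=> symA Au pA.
pose C0 := \sum_i \sum_j `|invmx A i j|.
have C0le i j : `|invmx A i j| <= C0.
  rewrite /C0 (bigD1 i) //= (bigD1 j) //= -addrA lerDl addr_ge0 ?sumr_ge0 // => k _.
  by rewrite sumr_ge0.
have C00 : 0 <= C0 by apply: sumr_ge0 => i _; apply: sumr_ge0.
pose C := n%:R * C0 + 1.
have C1 : 0 < C by rewrite ltr_wpDl // mulr_ge0.
exists C^-1; first by rewrite invr_gt0.
move=> v; have s0 := sqr_norm_ge0 v.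
pose w := invmx A *m v; pose tau := C^-1.
have Aw : A *m w = v by rewrite /w mulmxA mulmxV // mul1mx.
have wA : w^T *m A = v^T by rewrite -[A in LHS]symA -trmx_mul Aw.
have := pA (v - tau *: w).
have -> : (v - tau *: w)^T *m A *m (v - tau *: w)
   = v^T *m A *m v - tau *: (v^T *m v) - tau *: (v^T *m v - tau *: (v^T *m w)).
  have -> : (v - tau *: w)^T = v^T - tau *: w^T by rewrite linearB /= linearZ.
  rewrite mulmxBl -scalemxAl wA !mulmxBr -!scalemxAr !mulmxBl -(mulmxA _ A w) Aw.
  by rewrite -!scalemxAl.
have hw : (v^T *m w) 0 0 <= n%:R * C0 * sqr_norm v.
  rewrite /w mulmxA; apply: le_trans (ler_norm _) _; exact: mxform_le.
have hvv := sqr_normE v.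
move: hw hvv; set x := v^T *m w; set y := v^T *m v; set z := v^T *m A *m v.
have mxBE (a b : 'M[K]_1) : (a - b) 0 0 = a 0 0 - b 0 0 by rewrite !mxE.
have mxZE t (a : 'M[K]_1) : (t *: a) 0 0 = t * a 0 0 by rewrite mxE.
rewrite !(mxBE, mxZE); move: (x 0 0) (y 0 0) (z 0 0) => {x y z} x y z hx -> hz.
have tC : tau * C = 1 by rewrite mulVf // gt_eqF.
have t0 : 0 < tau by rewrite invr_gt0.
have hx2 : tau * (tau * x) <= tau * sqr_norm v.
  rewrite ler_pM2l //; apply: (@le_trans _ _ (tau * (C * sqr_norm v))).
    by rewrite ler_pM2l //; apply: le_trans hx _; rewrite /C mulrDl mul1r lerDl.
  by rewrite mulrA tC mul1r.
rewrite -/tau; lra.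
Qed.

(** On the segment, semidefiniteness is a closed condition, and by coercivity an open one
    as long as the matrices stay invertible. *)
Lemma psd_path (A : K -> 'M[K]_n) :
  (forall s, (A s)^T = A s) ->
  (forall s : K, 0 <= s <= 1 -> A s \in unitmx) ->
  (forall s : K, 0 <= s <= 1 -> forall i j, {for s, continuous (fun s => A s i j)}) ->
  psd (A 0) -> psd (A 1).
Proof.
move=> symA unitA contA psd0.
pose P := [set s | psd (A s)].
pose B : set K := `[0, 1]%classic `&` P^°.
have open_near (s : K) : 0 <= s <= 1 -> psd (A s) -> P^° s.
  move=> s01 ps.
  have [eps eps0 coer] := psd_coercive (symA s) (unitA s s01) ps.
  have e0 : 0 < eps / (n%:R + 1) by rewrite divr_gt0 // ltr_wpDl.
  have : \forall s' \near s, forall i j, `|A s i j - A s' i j| <= eps / (n%:R + 1).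
    pose e := eps / (n%:R + 1).
    have F i j : \forall s' \near s, `|A s i j - A s' i j| <= e.
      by have /cvgrPdist_le := contA s s01 i j; apply.
    have FF : Filter (nbhs s) by exact: nbhs_filter.
    exact: (filter_forall FF (fun i => filter_forall FF (F i))).
  apply: filterS => s' hs' v.
  have hD : `|(v^T *m (A s - A s') *m v) 0 0| <= eps * sqr_norm v.
    apply: le_trans (@mxform_le _ v (eps / (n%:R + 1)) _) _.
      by move=> i j; have := hs' i j; rewrite !mxE.
    apply: ler_wpM2r; first exact: sqr_norm_ge0.
    rewrite mulrA ler_pdivrMr ?ltr_wpDl // mulrDr mulr1 mulrC lerDl.
    exact: ltW.
  have := coer v; move: hD; rewrite mulmxBr mulmxBl.
  have -> (a b : 'M[K]_1) : (a - b) 0 0 = a 0 0 - b 0 0 by rewrite !mxE.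
  by rewrite ler_norml => /andP[_]; lra.
have closedP (s : K) : 0 <= s <= 1 -> closure P s -> psd (A s).
  move=> s01 cl v; rewrite leNgt; apply/negP => neg.
  have cont : (v^T *m A x *m v) 0 0 @[x --> s] --> (v^T *m A s *m v) 0 0.
    rewrite mxform_sum; under eq_cvg do rewrite mxform_sum.
    apply: cvg_finite_sum => i; apply: cvg_finite_sum => j.
    apply: cvgM; last exact: cvg_cst.
    apply: cvgM; first exact: cvg_cst.
    exact: contA.
  have : \forall s' \near s, (v^T *m A s' *m v) 0 0 < 0.
    by apply: (cvgr_lt _ cont).
  by move/cl => [s' [ps' /=]]; rewrite ltNge (ps' v).
have : B = `[0, 1]%classic.
  apply: (@segment_connected K 0 1).
  - exists 0; split; first by rewrite /= in_itv /= lexx ler01.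
    by apply: open_near => //; rewrite lexx ler01.
  - by exists P^° => //; apply: open_interior.
  - exists (closure P); first exact: closed_closure.
    apply/seteqP; split => s [s01 ps]; split => //.
      by apply: subset_closure; apply: interior_subset ps.
    have s01' : 0 <= s <= 1 by move: s01; rewrite /= in_itv.
    by apply: open_near => //; apply: closedP.
move=> BE; have : B 1 by rewrite BE /= in_itv /= ler01 lexx.
by case=> _ /interior_subset.
Qed.

End PositiveSemidefinite.

(** * Positivity of the Hessian *)

Section Hessian.
Variables (K : realType) (p : nat).
Variables (R : 'M[K]_p.+1) (E : 'M[K]_(p.+1, p)).
Hypothesis R_sym : R^T = R.
Hypothesis R_ge0 : forall i j, 0 <= R i j.
Hypothesis R_pos : exists i j, 0 < R i j.
Hypothesis E_one : (const_mx 1 : 'rV[K]_p.+1) *m E = 0.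
Hypothesis E_ker : \rank (kermx E) = 1%N.
Implicit Types (x v : 'cV[K]_p.+1) (c : K).

Definition bilin v x : K := \sum_i \sum_j v i 0 * R i j * x j 0.

(** The Hessian of [Phi_c] at [x], as a quadratic form on the vectors of sum zero. *)
Definition hessian_form c x v : K :=
  \sum_i v i 0 ^+ 2 / x i 0
  + 2 * c / bilin x x * (2 / bilin x x * bilin v x ^+ 2 - bilin v v).

Lemma bilinE v x : (v^T *m R *m x) 0 0 = bilin v x.
Proof.
rewrite mxE /bilin exchange_big /=; apply: eq_bigr => j _.
by rewrite mxE mulr_suml; apply: eq_bigr => i _; rewrite mxE.
Qed.

Lemma quad_formE x : quad_form R x = bilin x x.
Proof. exact: bilinE. Qed.

Lemma bilinC v x : bilin v x = bilin x v.
Proof.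
rewrite /bilin exchange_big /=; apply: eq_bigr => i _; apply: eq_bigr => j _.
by rewrite -[in LHS]R_sym mxE; ring.
Qed.

Lemma invmx_diag x : (forall i, x i 0 != 0) ->
  invmx (diag_mx x^T) = diag_mx (\row_i (x i 0)^-1).
Proof.
move=> x0.
have DI : diag_mx x^T *m diag_mx (\row_i (x i 0)^-1) = 1%:M.
  rewrite mulmx_diag; apply/matrixP => i j; rewrite !mxE.
  by case: eqP => [->|]; rewrite ?mulr0n // !mulr1n mulfV.
have [Du _] := mulmx1_unit DI.
by rewrite -[RHS]mul1mx -(mulVmx Du) -mulmxA DI mulmx1.
Qed.

Lemma diag_form x v :
  (v^T *m diag_mx (\row_i (x i 0)^-1) *m v) 0 0 = \sum_i v i 0 ^+ 2 / x i 0.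
Proof.
rewrite mul_mx_diag mxE; apply: eq_bigr => i _; rewrite !mxE; ring.
Qed.

Lemma hessian_formE c x (eps : 'cV[K]_p) : simplex_interior x ->
  (eps^T *m hessian R E c x *m eps) 0 0 = hessian_form c x (E *m eps).
Proof.
move=> [x0 x1]; rewrite /hessian quad_formE invmx_diag; last first.
  by move=> i; rewrite gt_eqF.
set v := E *m eps; set D := diag_mx _; set Q := bilin x x.
set M := D + _.
have -> : eps^T *m (E^T *m M *m E) *m eps = v^T *m M *m v.
  by rewrite /v trmx_mul !mulmxA.
have vx : v^T *m R *m x = (bilin v x)%:M by rewrite [LHS]mx11_scalar bilinE.
have xv : x^T *m R *m v = (bilin v x)%:M.
  by rewrite [LHS]mx11_scalar bilinE bilinC.
have vv : v^T *m R *m v = (bilin v v)%:M by rewrite [LHS]mx11_scalar bilinE.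
have -> : v^T *m M *m v = v^T *m D *m v +
   (2 * c / Q) *: ((2 / Q) *: ((bilin v x)%:M *m (bilin v x)%:M) - (bilin v v)%:M).
  rewrite /M mulmxDr mulmxDl; congr (_ + _).
  rewrite -scalemxAr -scalemxAl mulmxBr mulmxBl -scalemxAr -scalemxAl vv.
  by rewrite -{1}vx -xv !mulmxA.
rewrite -scalar_mxM [LHS]mxE diag_form /hessian_form; congr (_ + _).
by rewrite !mxE /= !mulr1n expr2.
Qed.

Lemma hessian_sym c x : simplex_interior x -> (hessian R E c x)^T = hessian R E c x.
Proof.
move=> [x0 x1]; rewrite /hessian invmx_diag; last by move=> i; rewrite gt_eqF.
rewrite !trmx_mul trmxK mulmxA; congr (_ *m _ *m _).
have tD (A B : 'M[K]_p.+1) : (A + B)^T = A^T + B^T by rewrite linearD.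
have tB (A B : 'M[K]_p.+1) : (A - B)^T = A^T - B^T by rewrite linearB.
have tZ a (A : 'M[K]_p.+1) : (a *: A)^T = a *: A^T by rewrite linearZ.
by rewrite tD tZ tB tZ tr_diag_mx !trmx_mul R_sym trmxK !mulmxA.
Qed.

Lemma sum_E (eps : 'cV[K]_p) : \sum_i (E *m eps) i 0 = 0.
Proof.
have : (const_mx 1 : 'rV[K]_p.+1) *m (E *m eps) = 0 by rewrite mulmxA E_one mul0mx.
move/matrixP => /(_ 0 0); rewrite !mxE => h; rewrite -[RHS]h.
by apply: eq_bigr => i _; rewrite !mxE mul1r.
Qed.

(** The columns of [E] lie in the hyperplane of vectors of sum zero, and its rank is the
    dimension of that hyperplane. *)
Lemma E_onto v : \sum_i v i 0 = 0 -> exists eps : 'cV[K]_p, v = E *m eps.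
Proof.
move=> v0; pose one : 'cV[K]_p.+1 := const_mx 1.
have rE : \rank E^T = p.
  rewrite mxrank_tr; have := E_ker; rewrite mxrank_ker.
  have := rank_leq_col E; move: (\rank E) => r; lia.
have rone : \rank (kermx one) = p.
  rewrite mxrank_ker; have -> : \rank one = 1%N; last by rewrite subn1.
  apply/eqP; rewrite eqn_leq rank_leq_col lt0n mxrank_eq0.
  by apply/eqP => /matrixP /(_ 0 0); rewrite !mxE; apply/eqP/oner_neq0.
have sub : (E^T <= kermx one)%MS.
  apply/sub_kermxP; apply: trmx_inj.
  by rewrite trmx_mul trmxK trmx0 trmx_const E_one.
have : (v^T <= E^T)%MS.
  apply: (@submx_trans _ _ _ _ _ _ (kermx one)).
    apply/sub_kermxP/matrixP => i j; rewrite !ord1 !mxE -[RHS]v0.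
    by apply: eq_bigr => k _; rewrite !mxE mulr1.
  by rewrite -(geq_leqif (mxrank_leqif_sup sub)) rE rone.
case/submxP => D hD; exists D^T.
by rewrite -[LHS]trmxK hD trmx_mul trmxK.
Qed.

Lemma bilin_gt0 x : simplex_interior x -> 0 < bilin x x.
Proof.
move=> [x0 _]; have [i [j Rij]] := R_pos.
have t0 k l : 0 <= x k 0 * R k l * x l 0 by rewrite !mulr_ge0 ?R_ge0 // ltW.
rewrite /bilin (bigD1 i) //= (bigD1 j) //= -addrA ltr_pwDl ?mulr_gt0 //.
rewrite addr_ge0 ?sumr_ge0 // => k _; exact: sumr_ge0.
Qed.

(** For the largest entry [R i j] the direction [e_i - e_j] has non-positive curvature,
    [R i i + R j j <= 2 * R i j], and when [i = j] it is zero.  Subtracting the component of [v]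
    in that direction leaves a vector controlled by the coordinates other than [j]. *)
Lemma bilin_le_max i j v (w : 'I_p.+1 -> K) (W : K) :
  (forall k l, R k l <= R i j) -> \sum_k v k 0 = 0 ->
  (forall k, w k = v k 0 - v i 0 * ((k == i)%:R - (k == j)%:R)) ->
  W = \sum_(k | k != j) `|w k| ->
  bilin v v <= 4 * R i j * (W * `|v i 0| + W ^+ 2).
Proof.
move=> Rmax v0 wE WE.
pose t := v i 0; pose r := R i j.
have r0 : 0 <= r by apply: R_ge0.
pose g k : K := (k == i)%:R - (k == j)%:R.
have sum_ind (h : 'I_p.+1 -> K) l : \sum_k (k == l)%:R * h k = h l.
  rewrite (bigD1 l) //= eqxx mul1r big1 ?addr0 // => k /negPf ->.
  by rewrite mul0r.
have sum_g (h : 'I_p.+1 -> K) : \sum_k g k * h k = h i - h j.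
  under eq_bigr do rewrite mulrBl.
  by rewrite sumrB !sum_ind.
have g0 : \sum_k g k = 0.
  by under eq_bigr do rewrite -[g _]mulr1; rewrite sum_g subrr.
have w0 : \sum_k w k = 0.
  under eq_bigr do rewrite wE.
  by rewrite sumrB v0 -mulr_sumr g0 mulr0 subrr.
have vE k : v k 0 = w k + t * g k by rewrite wE /g /t; ring.
pose S := \sum_k `|w k|.
have W0 : 0 <= W by rewrite WE; apply: sumr_ge0.
have SW : S <= 2 * W.
  have wj : w j = - \sum_(k | k != j) w k.
    by apply/eqP; rewrite -addr_eq0; move: w0; rewrite (bigD1 j) //= => ->.
  have : `|w j| <= W by rewrite wj normrN WE ler_norm_sum.
  by rewrite /S (bigD1 j) //= -WE; lra.
have S0 : 0 <= S by apply: sumr_ge0.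
pose L := \sum_k (R i k - R j k) * w k.
have -> : bilin v v = (R i i + R j j - 2 * r) * t ^+ 2 + 2 * t * L
    + \sum_k \sum_l w k * R k l * w l.
  have -> : bilin v v = \sum_k \sum_l w k * R k l * w l
     + t * (\sum_k w k * \sum_l g l * R k l) + t * (\sum_k g k * (\sum_l R k l * w l))
     + t ^+ 2 * (\sum_k g k * \sum_l g l * R k l).
    rewrite !mulr_sumr -!big_split /=; apply: eq_bigr => k _.
    rewrite !mulr_sumr -!big_split /=; apply: eq_bigr => l _.
    by rewrite !vE; ring.
  rewrite !sum_g.
  have symR k l : R k l = R l k by rewrite -[in LHS]R_sym mxE.
  have -> : \sum_k w k * (\sum_l g l * R k l) = L.
    rewrite /L; apply: eq_bigr => k _.
    by rewrite sum_g (symR i) (symR j) mulrC.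
  have -> : \sum_l R i l * w l - \sum_l R j l * w l = L.
    by rewrite -sumrB; apply: eq_bigr => l _; rewrite mulrBl.
  by rewrite (symR j i) -/r; ring.
have cW : \sum_k \sum_l w k * R k l * w l <= r * S ^+ 2.
  rewrite expr2 {1}/S mulr_suml mulr_sumr; apply: ler_sum => k _.
  rewrite /S !mulr_sumr; apply: ler_sum => l _.
  apply: le_trans (ler_norm _) _; rewrite !normrM (ger0_norm (R_ge0 k l)).
  rewrite mulrAC mulrC; apply: ler_wpM2r => //; exact: mulr_ge0.
have cL : `|L| <= r * S.
  apply: le_trans (ler_norm_sum _ _ _) _; rewrite /S mulr_sumr.
  apply: ler_sum => k _; rewrite normrM; apply: ler_wpM2r => //.
  rewrite ler_norml; have := Rmax i k; have := Rmax j k.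
  by have := R_ge0 i k; have := R_ge0 j k; rewrite -/r; lra.
have cG : (R i i + R j j - 2 * r) * t ^+ 2 <= 0.
  apply: mulr_le0_ge0; last exact: sqr_ge0.
  by have := Rmax i i; have := Rmax j j; rewrite -/r; lra.
have c1 : r * S ^+ 2 <= r * (2 * W) ^+ 2.
  by apply: ler_wpM2l => //; apply: lerXn2r; rewrite ?nnegrE // mulr_ge0.
have c2 : t * L <= `|t| * (r * (2 * W)).
  apply: le_trans (ler_norm _) _; rewrite normrM; apply: ler_wpM2l => //.
  by apply: le_trans cL _; apply: ler_wpM2l.
rewrite -/t -/r; move: cW cG c1 c2.
move: (\sum_k \sum_l _) ((_ - _) * _) => X Y hX hY c1 c2.
have -> : 2 * t * L = 2 * (t * L) by rewrite mulrA.
lra.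
Qed.

(** Near the barycentre of the face spanned by the indices of the largest entry of [R], the
    terms [v k ^ 2 / x k] of the other coordinates [k] are huge, and dominate everything that
    [bilin_le_max] leaves of the indefinite part. *)
Lemma exists_hessian_form_ge0 c : 0 <= c ->
  exists2 x, simplex_interior x &
    forall v, \sum_i v i 0 = 0 -> 0 <= hessian_form c x v.
Proof.
move=> c0; pose q : K := p.+1%:R.
have q0 : 0 < q by rewrite ltr0n.
have q1 : 1 <= q by rewrite ler1n.
have [[i j] _ /= hmax] := @arg_maxP _ K ('I_p.+1 * 'I_p.+1)%type (ord0, ord0) xpredT
  (fun z => R z.1 z.2) isT.
have Rmax k l : R k l <= R i j by apply: (hmax (k, l)).
pose r := R i j.
have r0 : 0 < r.
  by have [k [l Rkl]] := R_pos; apply: lt_le_trans (Rmax k l).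
pose B := 8 * c * q ^+ 2.
have B0 : 0 <= B by rewrite !mulr_ge0 // exprn_ge0 // ltW.
(* [e] is the relative mass of the coordinates off the face; the choice makes the final
   quadratic form in [`|v i 0|] and [W] non-negative. *)
pose e := (q * (1 + B + B ^+ 2))^-1.
have B1 : 1 <= 1 + B + B ^+ 2 by have := sqr_ge0 B; lra.
have D1 : 1 <= q * (1 + B + B ^+ 2) by nra.
have e0 : 0 < e by rewrite invr_gt0; lra.
have e1 : e <= 1 by rewrite invf_le1 //; lra.
have qe : (q * e)^-1 = 1 + B + B ^+ 2.
  by rewrite /e; field; rewrite !gt_eqF //; lra.
clearbody e.
pose z k := if (k == i) || (k == j) then 1 else e.
have z0 k : 0 < z k by rewrite /z; case: ifP.
have z1 k : z k <= 1 by rewrite /z; case: ifP.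
pose Z := \sum_k z k.
have zi : z i = 1 by rewrite /z eqxx.
have zj : z j = 1 by rewrite /z eqxx orbT.
have Z1 : 1 <= Z.
  by rewrite /Z (bigD1 i) //= zi lerDl sumr_ge0 // => k _; apply: ltW.
have Z0 : 0 < Z by apply: lt_le_trans Z1.
have Zq : Z <= q.
  rewrite /Z /q -[p.+1 in leRHS]card_ord -sumr_const.
  by apply: ler_sum.
pose x : 'cV[K]_p.+1 := \col_k (z k / Z).
have xE k : x k 0 = z k / Z by rewrite mxE.
have xz k : x k 0 <= z k.
  by rewrite xE ler_pdivrMr // ler_peMr // ltW.
have x0 k : 0 < x k 0 by rewrite xE divr_gt0.
have xint : simplex_interior x.
  split=> //; under eq_bigr do rewrite xE.
  by rewrite -mulr_suml divff // gt_eqF.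
exists x => // v v0.
have Q0 := bilin_gt0 xint; set Q := bilin x x in Q0.
have Qr : r / q ^+ 2 <= Q.
  have t0 k l : 0 <= x k 0 * R k l * x l 0 by rewrite !mulr_ge0 ?R_ge0 // ltW.
  apply: (@le_trans _ _ (x i 0 * R i j * x j 0)).
    rewrite !xE zi zj !mul1r -/r.
    have -> : Z^-1 * r / Z = r / Z ^+ 2 by field; rewrite gt_eqF.
    rewrite ler_pM2l // lef_pV2 ?posrE ?exprn_gt0 //.
    by apply: lerXn2r; rewrite ?nnegrE ?(ltW Z0) ?(ltW q0).
  rewrite /Q /bilin (bigD1 i) //= (bigD1 j) //= -addrA lerDl.
  rewrite addr_ge0 ?sumr_ge0 // => k _; exact: sumr_ge0.
pose w k := v k 0 - v i 0 * ((k == i)%:R - (k == j)%:R).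
pose W := \sum_(k | k != j) `|w k|.
have hv := bilin_le_max Rmax v0 (fun k => erefl (w k)) (erefl W).
have W0 : 0 <= W by apply: sumr_ge0.
have hE : v i 0 ^+ 2 + W ^+ 2 / (q * e) <= \sum_k v k 0 ^+ 2 / x k 0.
  have W2 : W ^+ 2 <= q * \sum_(k | k != j) w k ^+ 2.
    pose a k := if k != j then `|w k| else 0.
    have WE : W = \sum_k a k by rewrite /W big_mkcond.
    have aE : \sum_(k | k != j) w k ^+ 2 = \sum_k a k ^+ 2.
      rewrite big_mkcond; apply: eq_bigr => k _; rewrite /a.
      by case: ifP => _; rewrite ?expr0n // real_normK ?num_real.
    rewrite aE WE.
    have -> : q * \sum_k a k ^+ 2
      = \sum_(k < p.+1) \sum_(l < p.+1) (a k ^+ 2 + a l ^+ 2) / 2.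
      under [RHS]eq_bigr do rewrite -mulr_suml big_split /= sumr_const card_ord.
      rewrite -mulr_suml big_split /= sumr_const card_ord sumrMnl.
      by rewrite -[_ *+ p.+1]mulr_natl -/q; field.
    rewrite expr2 mulr_suml; apply: ler_sum => k _; rewrite mulr_sumr.
    by apply: ler_sum => l _; have := sqr_ge0 (a k - a l); nra.
  apply: (@le_trans _ K (v i 0 ^+ 2 + \sum_(k | k != j) w k ^+ 2 / e)).
    rewrite lerD2l -mulr_suml invfM mulrA ler_pM2r ?invr_gt0 //.
    by rewrite ler_pdivrMr // mulrC.
  have -> : v i 0 ^+ 2 = \sum_k (k == i)%:R * v k 0 ^+ 2.
    rewrite (bigD1 i) //= eqxx mul1r big1 ?addr0 // => k /negPf ->.
    by rewrite mul0r.
  rewrite [X in _ + X]big_mkcond /= -big_split /=; apply: ler_sum => k _.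
  have vx0 : 0 <= v k 0 ^+ 2 / x k 0 by rewrite divr_ge0 ?sqr_ge0 // ltW.
  have vx : v k 0 ^+ 2 / z k <= v k 0 ^+ 2 / x k 0.
    by rewrite ler_wpM2l ?sqr_ge0 // lef_pV2 ?posrE.
  rewrite /w; have [ki|ki] := eqVneq k i.
    subst k; rewrite mul1r; move: vx; rewrite zi divr1 => vx.
    have [ij|ij] := eqVneq i j; first by rewrite addr0.
    by rewrite subr0 mulr1 subrr expr0n mul0r addr0.
  have [kj|kj] := eqVneq k j; first by rewrite mul0r addr0.
  rewrite mul0r add0r subr0 mulr0 subr0.
  by move: vx; rewrite /z (negPf ki) (negPf kj).
rewrite qe in hE.
have T0 : 0 <= `|v i 0| by [].
have vT : v i 0 ^+ 2 = `|v i 0| ^+ 2 by rewrite real_normK ?num_real.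
rewrite vT in hE; move: (`|v i 0|) T0 hE hv => T T0 hE hv.
have key : 2 * c / Q * bilin v v <= B * (W * T + W ^+ 2).
  have WT : 0 <= W * T + W ^+ 2 by rewrite addr_ge0 ?mulr_ge0 ?sqr_ge0.
  apply: (@le_trans _ _ (2 * c / Q * (4 * r * (W * T + W ^+ 2)))).
    by apply: ler_wpM2l => //; rewrite divr_ge0 ?mulr_ge0 // ltW.
  rewrite [leLHS](_ : _ = 8 * c * (r / Q) * (W * T + W ^+ 2)); last by ring.
  apply: ler_wpM2r => //; apply: ler_wpM2l; first by rewrite mulr_ge0.
  by rewrite ler_pdivrMr // mulrC -ler_pdivrMr // exprn_gt0.
have sq0 : 0 <= 2 * c / Q * (2 / Q * bilin v x ^+ 2).
  have Qi : 0 <= Q^-1 by rewrite invr_ge0 ltW.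
  apply: mulr_ge0; first by rewrite !mulr_ge0.
  by apply: mulr_ge0 (sqr_ge0 _); rewrite mulr_ge0.
rewrite /hessian_form -/Q mulrBr.
have : 0 <= T ^+ 2 + W ^+ 2 * (1 + B + B ^+ 2) - B * (W * T + W ^+ 2).
  by have := sqr_ge0 (T - B * W / 2); have := sqr_ge0 (B * W); have := sqr_ge0 W; nra.
lra.
Qed.

End Hessian.

Section HessianEverywhere.
Variables (K : realType) (p : nat).
Variables (R : 'M[K]_p.+1) (E : 'M[K]_(p.+1, p)).
Hypothesis R_sym : R^T = R.
Hypothesis R_ge0 : forall i j, 0 <= R i j.
Hypothesis R_pos : exists i j, 0 < R i j.
Hypothesis E_one : (const_mx 1 : 'rV[K]_p.+1) *m E = 0.
Hypothesis E_ker : \rank (kermx E) = 1%N.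
Variable c : K.
Hypothesis c0 : 0 <= c.
Hypothesis det_gt0 : forall x, simplex_interior x -> 0 < \det (hessian R E c x).
Implicit Types (x v : 'cV[K]_p.+1).

(** A formula for the middle factor of the Hessian without matrix inversion, hence symmetric
    at every point and visibly continuous. *)
Definition hessian_core x : 'M[K]_p.+1 :=
  \matrix_(k, l) ((k == l)%:R / x k 0 + 2 * c / bilin R x x *
    (2 / bilin R x x * ((\sum_m R k m * x m 0) * (\sum_m R l m * x m 0)) - R k l)).

Lemma hessian_coreE x : simplex_interior x ->
  hessian R E c x = E^T *m hessian_core x *m E.
Proof.
move=> [x0 x1]; rewrite /hessian invmx_diag; last by move=> i; rewrite gt_eqF.
congr (_ *m _ *m _); apply/matrixP => k l; rewrite quad_formE.
have r1 : (R *m x *m x^T *m R) k l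
    = (\sum_m R k m * x m 0) * (\sum_m R l m * x m 0).
  rewrite -mulmxA mxE big_ord1 !mxE; congr (_ * _); apply: eq_bigr => m _.
  by rewrite mxE -[in LHS]R_sym mxE mulrC.
rewrite [RHS]mxE -r1; move: (R *m x *m x^T *m R) => X; rewrite !mxE.
congr (_ + _).
by case: eqP => [->|_]; rewrite ?mulr1n ?mul1r // mulr0n mul0r.
Qed.

Lemma hessian_core_sym x : (E^T *m hessian_core x *m E)^T = E^T *m hessian_core x *m E.
Proof.
rewrite !trmx_mul trmxK mulmxA; congr (_ *m _ *m _).
apply/matrixP => k l; rewrite !mxE eq_sym -[in R l k]R_sym mxE.
case: eqP => [->|_]; first by [].
by rewrite !mul0r [X in _ * (X) - _]mulrC.
Qed.

Lemma hessian_core_continuous (x : K -> 'cV[K]_p.+1) (s : K) :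
  (forall m, x y m 0 @[y --> s] --> x s m 0) ->
  (forall m, x s m 0 != 0) -> bilin R (x s) (x s) != 0 ->
  forall i j, {for s, continuous (fun s => (E^T *m hessian_core (x s) *m E) i j)}.
Proof.
move=> cx x0 Q0 i j.
have cQ : bilin R (x y) (x y) @[y --> s] --> bilin R (x s) (x s).
  apply: cvg_finite_sum => k; apply: cvg_finite_sum => l.
  apply: cvgM; last exact: cx.
  by apply: cvgM; [exact: cx | exact: cvg_cst].
have cR k : \sum_m R k m * x y m 0 @[y --> s] --> \sum_m R k m * x s m 0.
  by apply: cvg_finite_sum => m; apply: cvgM; [exact: cvg_cst | exact: cx].
have ck k l : hessian_core (x y) k l @[y --> s] --> hessian_core (x s) k l.
  rewrite mxE; under eq_cvg do rewrite mxE.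
  apply: cvgD.
    apply: cvgM; first exact: cvg_cst.
    by apply: cvgV.
  apply: cvgM.
    by apply: cvgM; [exact: cvg_cst | apply: cvgV].
  apply: cvgB; last exact: cvg_cst.
  apply: cvgM; last by apply: cvgM; apply: cR.
  by apply: cvgM; [exact: cvg_cst | apply: cvgV].
have entry y : (E^T *m hessian_core (x y) *m E) i j
  = \sum_l (\sum_k E k i * hessian_core (x y) k l) * E l j.
  rewrite mxE; apply: eq_bigr => l _; rewrite mxE; congr (_ * _).
  by apply: eq_bigr => k _; rewrite mxE.
have : (E^T *m hessian_core (x y) *m E) i j @[y --> s]
    --> (E^T *m hessian_core (x s) *m E) i j.
  rewrite entry; under eq_cvg do rewrite entry.
  apply: cvg_finite_sum => l; apply: cvgM; last exact: cvg_cst.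
  by apply: cvg_finite_sum => k; apply: cvgM; [exact: cvg_cst | exact: ck].
by [].
Qed.

Lemma hessian_psd x : simplex_interior x -> psd (hessian R E c x).
Proof.
move=> xint.
have [x0 x0int h0] := exists_hessian_form_ge0 R_sym R_ge0 R_pos c0.
pose y s : 'cV[K]_p.+1 := x0 + s *: (x - x0).
have yE s m : y s m 0 = x0 m 0 + s * (x m 0 - x0 m 0) by rewrite !mxE.
have yint s : 0 <= s <= 1 -> simplex_interior (y s).
  move=> /andP[s0 s1]; split.
    move=> m; rewrite yE.
    have a := (proj1 xint) m; have b := (proj1 x0int) m.
    have -> : x0 m 0 + s * (x m 0 - x0 m 0) = (1 - s) * x0 m 0 + s * x m 0 by ring.
    have [->|s2] := eqVneq s 1; first by rewrite subrr mul0r mul1r add0r.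
    have s3 : 0 < 1 - s by rewrite subr_gt0 lt_neqAle s2.
    by rewrite ltr_pwDl ?mulr_gt0 // mulr_ge0 // ltW.
  under eq_bigr do rewrite yE.
  rewrite big_split /= -mulr_sumr sumrB (proj2 xint) (proj2 x0int) subrr mulr0 addr0 //.
have y0 : y 0 = x0 by rewrite /y scale0r addr0.
have y1 : y 1 = x by rewrite /y scale1r addrC subrK.
rewrite hessian_coreE // -y1.
apply: (@psd_path _ _ (fun s => E^T *m hessian_core (y s) *m E)).
- by move=> s; apply: hessian_core_sym.
- move=> s s01; rewrite -hessian_coreE; last exact: yint.
  by rewrite unitmxE unitfE gt_eqF // det_gt0 //; apply: yint.
- move=> s s01; apply: hessian_core_continuous.
  + move=> m; rewrite yE; under eq_cvg do rewrite yE.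
    apply: cvgD; first exact: cvg_cst.
    by apply: cvgM; [exact: cvg_id | exact: cvg_cst].
  + by move=> m; rewrite gt_eqF // (proj1 (yint s s01)).
  + by rewrite gt_eqF // bilin_gt0 //; apply: yint.
- move=> eps; rewrite y0 -hessian_coreE // hessian_formE //.
  by apply: h0; apply: sum_E.
Qed.

Lemma hessian_form_ge0 x v : simplex_interior x -> \sum_i v i 0 = 0 ->
  0 <= hessian_form R c x v.
Proof.
move=> xint /(E_onto E_one E_ker) [eps ->].
by rewrite -hessian_formE //; apply: hessian_psd.
Qed.

(** Semidefinite and invertible imply definite, by coercivity. *)
Lemma hessian_form_gt0 x v : simplex_interior x -> \sum_i v i 0 = 0 ->
  v != 0 -> 0 < hessian_form R c x v.
Proof.
move=> xint /(E_onto E_one E_ker) [eps ->] v0.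
rewrite -hessian_formE //.
have symH := hessian_sym E R_sym c xint.
have unitH : hessian R E c x \in unitmx by rewrite unitmxE unitfE gt_eqF // det_gt0.
have [e e0 he] := psd_coercive symH unitH (hessian_psd xint).
apply: lt_le_trans (he eps); rewrite mulr_gt0 // lt_neqAle sqr_norm_ge0 andbT eq_sym.
apply: contra_neq v0 => s0.
suff -> : eps = 0 by rewrite mulmx0.
apply/colP => i; rewrite mxE.
have := s0; rewrite /sqr_norm => /eqP; rewrite psumr_eq0 => [/allP /(_ i)|k _].
  by rewrite mem_index_enum sqrf_eq0 => /(_ isT) /eqP.
exact: sqr_ge0.
Qed.

End HessianEverywhere.

(** * Convexity along segments issued from the uniform law *)

Section SecondOrderConvexity.
Variable K : realType.
Implicit Types (s a b k : K) (f g : K -> K).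

Lemma is_derive_add f g s df dg : is_derive s 1 f df -> is_derive s 1 g dg ->
  is_derive s 1 (fun y => f y + g y) (df + dg).
Proof. by move=> ? ?; exact: is_deriveD. Qed.

Lemma is_derive_sub f g s df dg : is_derive s 1 f df -> is_derive s 1 g dg ->
  is_derive s 1 (fun y => f y - g y) (df - dg).
Proof. by move=> ? ?; exact: is_deriveB. Qed.

Lemma is_derive_mul f g s df dg : is_derive s 1 f df -> is_derive s 1 g dg ->
  is_derive s 1 (fun y => f y * g y) (f s * dg + g s * df).
Proof. by move=> ? ?; exact: is_deriveM. Qed.

Lemma is_derive_const s a : is_derive s 1 (fun _ : K => a) 0.
Proof. exact: is_derive_cst. Qed.

Lemma is_derive_var s : is_derive s 1 (fun y : K => y) 1.
Proof. exact: is_derive_id. Qed.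

Lemma is_derive_ln_comp f s df : 0 < f s -> is_derive s 1 f df ->
  is_derive s 1 (fun y => ln (f y)) (df / f s).
Proof.
move=> f0 hf; rewrite mulrC.
exact: (is_derive1_comp (is_derive1_ln f0) hf).
Qed.

Lemma is_derive_inv f s df : f s != 0 -> is_derive s 1 f df ->
  is_derive s 1 (fun y => (f y)^-1) (- df / f s ^+ 2).
Proof.
move=> f0 hf; apply: (is_derive_eq (is_deriveV f0 hf)).
by rewrite /GRing.scale /= mulrC mulrN mulNr.
Qed.

Lemma is_derive_finite_sum n (h : 'I_n -> K -> K) (dh : 'I_n -> K) s :
  (forall i, is_derive s 1 (h i) (dh i)) ->
  is_derive s 1 (fun y => \sum_i h i y) (\sum_i dh i).
Proof.
move=> hh; have := is_derive_sum hh; congr is_derive.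
by apply/funext => y; rewrite fct_sumE.
Qed.

Lemma is_derive_affine a b s : is_derive s 1 (fun y => a + y * b) b.
Proof.
apply: (is_derive_eq (is_derive_add (is_derive_const s a)
  (is_derive_mul (is_derive_var s) (is_derive_const s b)))); ring.
Qed.

Lemma is_derive_ln_affine (q : K) a b s : 0 < q -> 0 < a + s * b ->
  is_derive s 1 (fun y => ln (q * (a + y * b))) (b / (a + s * b)).
Proof.
move=> q0 ab0; apply: (is_derive_eq (is_derive_ln_comp _
  (is_derive_mul (is_derive_const s q) (is_derive_affine a b s)))).
  exact: mulr_gt0.
by field; rewrite !gt_eqF.
Qed.

Lemma is_derive_entropy_affine (q : K) a b s : 0 < q -> 0 < a + s * b ->
  is_derive s 1 (fun y => (a + y * b) * ln (q * (a + y * b)))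
    (b * ln (q * (a + s * b)) + b).
Proof.
move=> q0 ab0.
apply: (is_derive_eq (is_derive_mul (is_derive_affine a b s) (is_derive_ln_affine q0 ab0))).
by field; rewrite gt_eqF.
Qed.

Lemma is_derive_quad k s : is_derive s 1 (fun y => 1 + y * y * k) (2 * s * k).
Proof.
apply: (is_derive_eq (is_derive_add (is_derive_const s 1)
  (is_derive_mul (is_derive_mul (is_derive_var s) (is_derive_var s))
                 (is_derive_const s k)))); ring.
Qed.

Lemma is_derive_ln_quad k s : 0 < 1 + s * s * k ->
  is_derive s 1 (fun y => ln (1 + y * y * k)) (2 * s * k / (1 + s * s * k)).
Proof.
move=> h.
exact: (@is_derive_ln_comp (fun y => 1 + y * y * k) s _ h (is_derive_quad k s)).
Qed.

Lemma is_derive_ratio_quad k s : 0 < 1 + s * s * k ->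
  is_derive s 1 (fun y => 2 * y * k / (1 + y * y * k))
    (2 * k / (1 + s * s * k) - (2 * s * k) ^+ 2 / (1 + s * s * k) ^+ 2).
Proof.
move=> h.
apply: (is_derive_eq (is_derive_mul
  (is_derive_mul (is_derive_mul (is_derive_const s 2) (is_derive_var s))
                 (is_derive_const s k))
  (@is_derive_inv (fun y => 1 + y * y * k) s _ (lt0r_neq0 h) (is_derive_quad k s)))).
by field; rewrite gt_eqF.
Qed.

(** Two applications of the mean value theorem. *)
Lemma ge0_second_derivative (f df ddf : K -> K) (T : K) :
  (forall s, 0 <= s < T -> is_derive s 1 f (df s)) ->
  (forall s, 0 <= s < T -> is_derive s 1 df (ddf s)) ->
  (forall s, 0 <= s < T -> 0 <= ddf s) ->
  f 0 = 0 -> df 0 = 0 -> forall s, 0 <= s < T -> 0 <= f s.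
Proof.
move=> hf hdf hddf f0 df0.
have mono (g dg : K -> K) : (forall s, 0 <= s < T -> is_derive s 1 g (dg s)) ->
    (forall s, 0 <= s < T -> 0 <= dg s) -> g 0 = 0 ->
    forall s, 0 <= s < T -> 0 <= g s.
  move=> hg hdg g0 s /andP[s0 sT].
  have [z| |z zs E] := @MVT_segment K g dg 0 s s0.
  - by rewrite in_itv /= => /andP[z0 zs]; apply: hg; rewrite (ltW z0) (lt_trans zs).
  - apply: derivable_within_continuous => z; rewrite in_itv /= => /andP[z0 zs].
    have zT : 0 <= z < T by rewrite z0 (le_lt_trans zs).
    by have := hg z zT => -[].
  - move: zs E; rewrite in_itv /= g0 !subr0 => /andP[z0 zs] ->.
    by apply: mulr_ge0 => //; apply: hdg; rewrite z0 (le_lt_trans zs).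
exact: (mono f df hf (mono df ddf hdf hddf df0) f0).
Qed.

End SecondOrderConvexity.

Section EntropyBound.
Variables (K : realType) (p : nat).
Variables (R : 'M[K]_p.+1) (E : 'M[K]_(p.+1, p)).
Hypothesis R_sym : R^T = R.
Hypothesis R_ge0 : forall i j, 0 <= R i j.
Hypothesis R_pos : exists i j, 0 < R i j.
Hypothesis E_one : (const_mx 1 : 'rV[K]_p.+1) *m E = 0.
Hypothesis E_ker : \rank (kermx E) = 1%N.
Variable c : K.
Hypothesis c0 : 0 < c.
Hypothesis det_gt0 : forall x, simplex_interior x -> 0 < \det (hessian R E c x).
Variable mu : K.
Hypothesis mu0 : 0 < mu.
Hypothesis row_sums : forall i, \sum_j R i j = mu.
Implicit Types (x v : 'I_p.+1 -> K).

Let q : K := p.+1%:R.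
Let q0 : 0 < q. Proof. by rewrite ltr0n. Qed.

Definition quad_sum x : K := \sum_i \sum_j x i * R i j * x j.

Let symR i j : R i j = R j i. Proof. by rewrite -[in LHS]R_sym mxE. Qed.

Let left_one v : \sum_i v i = 0 -> \sum_i \sum_j v i * R i j = 0.
Proof.
move=> v0; under eq_bigr do rewrite -mulr_sumr row_sums.
by rewrite -mulr_suml v0 mul0r.
Qed.

Let right_one v : \sum_i v i = 0 -> \sum_i \sum_j R i j * v j = 0.
Proof.
move=> v0; rewrite exchange_big /= -[RHS](left_one v0).
by apply: eq_bigr => i _; apply: eq_bigr => j _; rewrite symR mulrC.
Qed.

(** The row sums of [R] being constant, the terms linear in [v] vanish. *)
Lemma quad_shift v (z : K) : \sum_i v i = 0 ->
  quad_sum (fun i => q^-1 + z * v i) = mu / q * (1 + z * z * (q / mu * quad_sum v)).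
Proof.
move=> v0; rewrite /quad_sum.
have -> : \sum_i \sum_j (q^-1 + z * v i) * R i j * (q^-1 + z * v j)
  = q^-1 ^+ 2 * (\sum_i \sum_j R i j) + q^-1 * z * (\sum_i \sum_j R i j * v j)
    + z * q^-1 * (\sum_i \sum_j v i * R i j) + z * z * quad_sum v.
  rewrite !mulr_sumr -!big_split /=; apply: eq_bigr => i _.
  rewrite !mulr_sumr -!big_split /=; apply: eq_bigr => j _; ring.
rewrite left_one // right_one //.
under eq_bigr do rewrite row_sums.
rewrite sumr_const card_ord -[mu *+ _]mulr_natl -/q.
rewrite -/(quad_sum v).
by field; rewrite !gt_eqF.
Qed.

(** Relative entropy decreases towards the uniform law, by convexity of [t * ln t].  It is used
    to reach the boundary of the simplex, where the logarithms are not differentiable. *)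
Lemma entropy_shrink x (s : K) : (forall i, 0 <= x i) -> \sum_i x i = 1 -> 0 <= s < 1 ->
  entropy (fun i => q^-1 + s * (x i - q^-1)) <= entropy x.
Proof.
move=> x0 x1 /andP[s0 s1].
apply: (@le_trans _ _ (s * entropy x)); last first.
  have := entropy_ge0 (ltn0Sn p) x0 x1; nra.
have qi : \sum_(i < p.+1) q^-1 = 1 :> K.
  by rewrite sumr_const card_ord -[q^-1 *+ _]mulr_natl divff // gt_eqF.
suff h (t : K) : 0 <= t -> (1 + s * (t - 1)) * ln (1 + s * (t - 1)) <= s * (t * ln t).
  rewrite /entropy mulr_sumr; apply: ler_sum => i _.
  rewrite -(ler_pM2l q0) -/q.
  have qy : q * (q^-1 + s * (x i - q^-1)) = 1 + s * (q * x i - 1).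
    by field; rewrite gt_eqF.
  rewrite [leLHS]mulrA qy.
  rewrite [leRHS](_ : _ = s * (q * x i * ln (q * x i))); last by ring.
  by apply: h; rewrite mulr_ge0 // ltW.
rewrite le_eqVlt => /orP[/eqP <-|t0].
  rewrite mul0r mulr0 sub0r mulrN1.
  have s3 : ln (1 - s) <= 0 by apply: ln_le0; lra.
  by apply: mulr_ge0_le0 => //; lra.
set y := 1 + s * (t - 1).
have y0 : 0 < y by rewrite /y; nra.
have lnle (a : K) : 0 < a -> ln a <= a - 1.
  move=> a0; have := @le_ln1Dx K (a - 1); rewrite [1 + _]addrC subrK; apply.
  by rewrite ltrBrDl subrr.
have l1 := lnle y y0.
have l2 : ln y - ln t <= y / t - 1.
  by rewrite -ln_div ?posrE //; apply: lnle; rewrite divr_gt0.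
have l3 : s * t * (ln y - ln t) <= s * (y - t).
  apply: le_trans (_ : s * t * (y / t - 1) <= _).
    by apply: ler_wpM2l => //; rewrite mulr_ge0 // ltW.
  by rewrite le_eqVlt; apply/orP; left; apply/eqP; field; rewrite gt_eqF.
have l4 : (1 - s) * ln y <= (1 - s) * (y - 1) by apply: ler_wpM2l => //; lra.
have -> : y * ln y = s * t * ln y + (1 - s) * ln y by rewrite /y; ring.
have : s * (y - t) + (1 - s) * (y - 1) = 0 by rewrite /y; ring.
lra.
Qed.

(** The difference between the entropy and [c] times the logarithm of the left-hand side vanishes
    to first order at [s = 0], and its second derivative in [s] is the Hessian form. *)
Lemma entropy_bound_interior x (s : K) : (forall i, 0 <= x i) -> \sum_i x i = 1 ->
  0 <= s < 1 ->
  1 + s * s * (q / mu * quad_sum (fun i => x i - q^-1))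
  <= expR (entropy (fun i => q^-1 + s * (x i - q^-1)) / c).
Proof.
move=> x0 x1 s01.
pose v i := x i - q^-1.
have qi : \sum_(i < p.+1) q^-1 = 1 :> K.
  by rewrite sumr_const card_ord -[q^-1 *+ _]mulr_natl divff // gt_eqF.
have v0 : \sum_i v i = 0 by rewrite /v sumrB x1 qi subrr.
set k := q / mu * quad_sum _.
pose y z : 'cV[K]_p.+1 := \col_i (q^-1 + z * v i).
have yE z i : y z i 0 = q^-1 + z * v i by rewrite mxE.
have yint z : 0 <= z < 1 -> simplex_interior (y z).
  move=> /andP[z0 z1]; split.
    move=> i; rewrite yE /v.
    have -> : q^-1 + z * (x i - q^-1) = (1 - z) * q^-1 + z * x i by ring.
    by rewrite ltr_pwDl ?mulr_gt0 ?invr_gt0 ?subr_gt0 // mulr_ge0.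
  under eq_bigr do rewrite yE.
  by rewrite big_split /= -mulr_sumr v0 mulr0 addr0 qi.
have ypos z i : 0 <= z < 1 -> 0 < q^-1 + z * v i.
  by move=> /yint [+ _] => /(_ i); rewrite yE.
pose vv : 'cV[K]_p.+1 := \col_i v i.
have qv : bilin R vv vv = mu / q * k.
  rewrite /k mulrA (_ : mu / q * (q / mu) = 1); last by field; rewrite !gt_eqF.
  by rewrite mul1r /bilin /quad_sum; apply: eq_bigr => i _; apply: eq_bigr => j _; rewrite !mxE.
have qvy z : bilin R vv (y z) = z * (mu / q * k).
  rewrite -qv /bilin.
  have -> : \sum_i \sum_j vv i 0 * R i j * y z j 0
    = q^-1 * (\sum_i \sum_j v i * R i j) + z * (\sum_i \sum_j vv i 0 * R i j * vv j 0).
    rewrite !mulr_sumr -big_split /=; apply: eq_bigr => i _.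
    rewrite !mulr_sumr -big_split /=; apply: eq_bigr => j _.
    by rewrite !mxE; ring.
  by rewrite left_one // mulr0 add0r.
have qyy z : bilin R (y z) (y z) = mu / q * (1 + z * z * k).
  rewrite -quad_shift // /bilin; apply: eq_bigr => i _.
  by apply: eq_bigr => j _; rewrite !mxE.
have Pk z : 0 <= z < 1 -> 0 < 1 + z * z * k.
  move=> /yint yi; have := bilin_gt0 R_ge0 R_pos yi.
  by rewrite qyy pmulr_rgt0 // divr_gt0.
pose phi z := \sum_i (q^-1 + z * v i) * ln (q * (q^-1 + z * v i)) - c * ln (1 + z * z * k).
pose dphi z := \sum_i (v i * ln (q * (q^-1 + z * v i)) + v i)
   - c * (2 * z * k / (1 + z * z * k)).
pose ddphi z := \sum_i (v i * (v i / (q^-1 + z * v i)))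
   - c * (2 * k / (1 + z * z * k) - (2 * z * k) ^+ 2 / (1 + z * z * k) ^+ 2).
have phi_ge0 : 0 <= phi s.
  apply: (@ge0_second_derivative K phi dphi ddphi 1) => //.
  - move=> z z01; apply: is_derive_sub.
      apply: is_derive_finite_sum => i.
      by apply: is_derive_entropy_affine => //; apply: ypos.
    apply: (is_derive_eq (is_derive_mul (is_derive_const z c) (is_derive_ln_quad (Pk z z01)))).
    by rewrite mulr0 addr0.
  - move=> z z01; apply: is_derive_sub.
      apply: is_derive_finite_sum => i.
      apply: (is_derive_eq (is_derive_add (is_derive_mul (is_derive_const z (v i))
        (is_derive_ln_affine q0 (ypos z i z01))) (is_derive_const z (v i)))).
      by rewrite mulr0 !addr0.
    apply: (is_derive_eq (is_derive_mul (is_derive_const z c) (is_derive_ratio_quad (Pk z z01)))).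
    by rewrite mulr0 addr0.
  - move=> z z01.
    have : 0 <= hessian_form R c (y z) vv.
      apply: (hessian_form_ge0 R_sym R_ge0 R_pos E_one E_ker (ltW c0) det_gt0).
        exact: yint.
      by under eq_bigr do rewrite mxE.
    congr (_ <= _); rewrite /hessian_form /ddphi qvy qyy qv; congr (_ + _).
      by apply: eq_bigr => i _; rewrite !mxE; ring.
    by have := Pk z z01 => P0; field; rewrite !gt_eqF.
  - rewrite /phi mulr0 mul0r addr0 ln1 mulr0 subr0 big1 // => i _.
    by rewrite mul0r addr0 divff ?gt_eqF // ln1 mulr0.
  - rewrite /dphi mulr0 !mul0r mulr0 subr0 -[RHS]v0; apply: eq_bigr => i _.
    by rewrite mul0r addr0 divff ?gt_eqF // ln1 mulr0 add0r.
rewrite -[leLHS]lnK ?posrE; last exact: Pk.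
rewrite ler_expR ler_pdivlMr // mulrC.
by move: phi_ge0; rewrite /phi subr_ge0.
Qed.

(** The interior bound, let [s] tend to [1]. *)
Lemma entropy_bound x : (forall i, 0 <= x i) -> \sum_i x i = 1 ->
  q / mu * quad_sum x <= expR (entropy x / c).
Proof.
move=> x0 x1.
set k := q / mu * quad_sum (fun i => x i - q^-1).
have -> : q / mu * quad_sum x = 1 + k.
  have v0 : \sum_i (x i - q^-1) = 0.
    rewrite sumrB x1 sumr_const card_ord -[q^-1 *+ _]mulr_natl divff ?subrr //.
  have := quad_shift 1 v0; rewrite -/k !mul1r => E1.
  have -> : quad_sum x = mu / q * (1 + k).
    rewrite -E1; congr quad_sum; apply/funext => i; ring.
  by field; rewrite !gt_eqF.
have H0 := entropy_ge0 (ltn0Sn p) x0 x1.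
have X1 : 1 <= expR (entropy x / c).
  by rewrite -[leLHS]expR0 ler_expR divr_ge0 // ltW.
have bnd s : 0 <= s < 1 -> 1 + s * s * k <= expR (entropy x / c).
  move=> s01; apply: le_trans (entropy_bound_interior x0 x1 s01) _.
  rewrite ler_expR ler_pM2r ?invr_gt0 //; exact: entropy_shrink.
move: (expR _) X1 bnd => X X1 bnd.
have [k0|k0] := lerP k 0; first by lra.
rewrite leNgt; apply/negP => hX.
(* [s = 1 - d] is still large enough for [1 + s * s * k] to exceed [X]. *)
pose d := (1 + k - X) / (4 * k).
have d0 : 0 < d by apply: divr_gt0; [lra | exact: mulr_gt0].
have dk : d * (4 * k) = 1 + k - X by rewrite /d divfK // gt_eqF // mulr_gt0.
have d1 : d <= 4^-1 by nra.
have := bnd (1 - d); rewrite (_ : 0 <= 1 - d < 1); last by apply/andP; split; lra.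
move=> /(_ isT); nra.
Qed.

End EntropyBound.

(** * The number of graphs *)

Lemma equivalent_on_neg (K : realType) (a b : K) (F G : nat -> nat -> K) :
  b < 0 -> equivalent_on a b F G.
Proof.
move=> b0 eps _; exists 0%N => // n _ m /andP[_ mb].
have mn0 : 0 <= (m%:R / n%:R : K) by rewrite divr_ge0.
by have := le_lt_trans (le_trans mn0 mb) b0; rewrite ltxx.
Qed.

Section Assembly.
Variables (K : realType) (p : nat).
Variables (R : 'M[K]_p.+1) (lambda : seq K).
Variables (f : 'I_p -> 'I_p.+1 -> K).
Hypothesis R_sym : R^T = R.
Hypothesis f_mean : forall k, \sum_a f k a = 0.
Hypothesis f_orth : forall k l, \sum_a f k a * f l a = p.+1%:R * (k == l)%:R.
Hypothesis f_complete :
  forall a b, \sum_k f k a * f k b = p.+1%:R * (a == b)%:R - 1.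

Definition eigen_ratio (k : 'I_p) : K := lambda`_k.+1 / lambda`_0.

Definition pair_weight a b : K := 1 + \sum_k eigen_ratio k * (f k a * f k b).

Hypothesis R_pair_weight : forall a b, R a b = lambda`_0 / p.+1%:R * pair_weight a b.
Hypothesis pair_weight_ge0 : forall a b, 0 <= pair_weight a b.

Let q0 : 0 < p.+1%:R :> K. Proof. by rewrite ltr0n. Qed.

(** The squares of the coordinates are the double sums of [f k (t v) * f k (t w)]. *)
Lemma sum_pair_weight n (t : {ffun 'I_n -> 'I_p.+1}) : (0 < n)%N ->
  \sum_v \sum_w pair_weight (t v) (t w) = n%:R ^+ 2 * pair_mean f eigen_ratio t.
Proof.
move=> n0; rewrite pair_meanE mulrDr mulr1 mulrCA divff; last first.
  by rewrite expf_neq0 // pnatr_eq0 -lt0n.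
under eq_bigr do rewrite big_split /= sumr_const card_ord.
rewrite big_split /= sumr_const card_ord mulr1; congr (_ + _).
  by rewrite -mulrnA -natrX.
under eq_bigr do rewrite exchange_big /=.
rewrite exchange_big /=; apply: eq_bigr => k _.
rewrite expr2 {1}/coord mulr_suml mulr_sumr; apply: eq_bigr => v _.
by rewrite /coord !mulr_sumr; apply: eq_bigr => w _.
Qed.

Lemma pair_mean_ge0 n (t : {ffun 'I_n -> 'I_p.+1}) : (0 < n)%N -> 0 <= pair_mean f eigen_ratio t.
Proof.
move=> n0; have n2 : 0 < n%:R ^+ 2 :> K by rewrite exprn_gt0 // ltr0n.
rewrite -(pmulr_rge0 _ n2) -sum_pair_weight //.
by apply: sumr_ge0 => v _; apply: sumr_ge0.
Qed.

Lemma graph_number_moment n m : (0 < n)%N ->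
  graph_number R n m
  = n%:R ^+ (2 * m) / (2 ^+ m * m`!%:R) * lambda`_0 ^+ m
    * p.+1%:R ^ (n%:Z - m%:Z) * moment f eigen_ratio n m.
Proof.
move=> n0; rewrite graph_number_typings //.
have -> : \sum_(t : {ffun 'I_n -> 'I_p.+1}) (\sum_v \sum_w R (t v) (t w)) ^+ m
  = (lambda`_0 / p.+1%:R * n%:R ^+ 2) ^+ m
    * \sum_(t : {ffun 'I_n -> 'I_p.+1}) pair_mean f eigen_ratio t ^+ m.
  rewrite mulr_sumr; apply: eq_bigr => t _; rewrite -exprMn; congr (_ ^+ _).
  rewrite -(mulrA (_ / _)) -sum_pair_weight // mulr_sumr; apply: eq_bigr => v _; rewrite mulr_sumr.
  by apply: eq_bigr => w _.
rewrite /moment /expect expfzDr ?gt_eqF // -exprnN -exprnP.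
rewrite !exprMn exprVn mul2n -addnn exprD.
by field; rewrite !gt_eqF ?exprn_gt0 ?ltr0n ?fact_gt0.
Qed.

Lemma asymptotic_number_root n m :
  (forall k, 0 < 1 - 2 * (m%:R / n%:R) * eigen_ratio k) ->
  asymptotic_number p.+1 lambda n m
  = n%:R ^+ (2 * m) / (2 ^+ m * m`!%:R) * lambda`_0 ^+ m
    * p.+1%:R ^ (n%:Z - m%:Z) / root_prod eigen_ratio (m%:R / n%:R).
Proof.
move=> h; rewrite /asymptotic_number; congr (_ * _).
rewrite big_add1 big_mkord /root_prod -prodfV; apply: eq_bigr => k _.
have -> : 1 - 2 * (lambda`_k.+1 / lambda`_0) * (m%:R / n%:R)
  = 1 - 2 * (m%:R / n%:R) * eigen_ratio k by rewrite /eigen_ratio; ring.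
by rewrite powRN div1r powR12_sqrt // ltW.
Qed.

(** The reduction of the asymptotics to a bound by the relative entropy at some [c > b]. *)
Lemma equivalent_graph_number (a b c : K) : 0 <= b -> b < c ->
  (forall k, 0 < 1 - 2 * c * eigen_ratio k) ->
  (forall x : 'I_p.+1 -> K, (forall i, 0 <= x i) -> \sum_i x i = 1 ->
    1 + \sum_k eigen_ratio k * (\sum_i x i * f k i) ^+ 2 <= expR (entropy x / c)) ->
  equivalent_on a b (graph_number R) (asymptotic_number p.+1 lambda).
Proof.
move=> b0 bc ratio_c ent eps eps0.
have c0 : 0 < c by apply: le_lt_trans bc.
(* [1 - 2 * z * eigen_ratio k] is affine in [z], equal to [1] at [0] and positive at [c]. *)
pose kappa := 1 - b / c.
have kappa0 : 0 < kappa by rewrite subr_gt0 ltr_pdivrMr // mul1r.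
have kappa_le k z : 0 <= z <= b -> kappa <= 1 - 2 * z * eigen_ratio k.
  move=> /andP[z0 zb].
  have -> : 1 - 2 * z * eigen_ratio k = (1 - z / c) + (z / c) * (1 - 2 * c * eigen_ratio k).
    by field; rewrite gt_eqF.
  have h1 : z / c <= b / c by rewrite ler_pM2r ?invr_gt0.
  have h2 : 0 <= (z / c) * (1 - 2 * c * eigen_ratio k).
    by apply: mulr_ge0; [apply: divr_ge0 => //|]; exact: ltW.
  by rewrite /kappa; lra.
pose M : K := \sum_k \sum_a `|f k a|.
pose r : K := \sum_k `|eigen_ratio k|.
have f_le k i : `|f k i| <= M.
  rewrite /M (bigD1 k) //= (bigD1 i) //= -addrA lerDl addr_ge0 ?sumr_ge0 // => l _.
  by rewrite sumr_ge0.
have r_le k : `|eigen_ratio k| <= r by rewrite /r (bigD1 k) //= lerDl sumr_ge0.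
have M0 : 0 <= M by apply: sumr_ge0 => k _; apply: sumr_ge0.
have r0 : 0 <= r by apply: sumr_ge0.
have tl := far_mass_limit (ltn0Sn p) f_complete (fun n t => @pair_mean_ge0 n t) b0 bc ent.
have [N hN] := moment_asymptotics (ltn0Sn p) f_mean f_orth f_complete
  (fun n t => @pair_mean_ge0 n t) b0 kappa0 kappa_le (fun d eta => @tl d eta) M0 r0 f_le r_le eps0.
exists N.+1 => //= n nN m /andP[_ mb].
have n_gt0 : (0 < n)%N by apply: leq_ltn_trans nN.
have n0 : 0 < n%:R :> K by rewrite ltr0n.
have hm : m%:R <= b * n%:R by rewrite -ler_pdivrMr.
have g0 k : 0 < 1 - 2 * (m%:R / n%:R) * eigen_ratio k.
  by apply: lt_le_trans kappa0 (kappa_le _ _ _); rewrite mb divr_ge0.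
rewrite graph_number_moment // asymptotic_number_root //.
have := hN n m (ltnW nN) n_gt0 hm.
set B := root_prod _ _; set A := moment _ _ _ _; set X := _ * _ ^ _.
have B0 : 0 < B by apply: prodr_gt0 => k _; rewrite sqrtr_gt0.
move=> h; have -> : X * A - X / B = X / B * (A * B - 1) by field; rewrite gt_eqF.
by rewrite normrM mulrC ler_wpM2r.
Qed.

End Assembly.

Section NumberOfGraphs.
Variables (K : realType) (p : nat).
Variables (R : 'M[K]_p.+1) (lambda : seq K).
Hypothesis R_sym : R^T = R.
Hypothesis R_ge0 : forall i j, 0 <= R i j.
Hypothesis R_irr : irreducible_matrix R.
Hypothesis lambda_eigen : char_poly R = \prod_(x <- lambda) ('X - x%:P).
Hypothesis lambda_sorted : sorted (fun x y : K => y <= x) lambda.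
Hypothesis R_one : R *m const_mx 1 = lambda`_0 *: (const_mx 1 : 'cV[K]_p.+1).

Lemma irreducible_pos : (0 < p)%N -> exists i j, 0 < R i j.
Proof.
move=> p0; have [||i [j [_ _ Rij]]] := R_irr (I := [set ord0]%SET).
- by apply/set0Pn; exists ord0; rewrite inE.
- apply/eqP => /finset.setP /(_ (lift ord0 (Ordinal p0))).
  by rewrite !inE.
by exists i, j; rewrite lt_neqAle eq_sym Rij R_ge0.
Qed.

Lemma head_gt0 : (0 < p)%N -> 0 < lambda`_0.
Proof.
move=> /irreducible_pos [i [j Rij]].
rewrite -(row_sum R_one i) (bigD1 j) //= ltr_pwDl // sumr_ge0 //.
Qed.

Lemma ord_bound_gt0 (k : 'I_p) : (0 < p)%N.
Proof. by apply: leq_ltn_trans (ltn_ord k). Qed.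

Lemma lambda_le k : (0 < k)%N -> lambda`_k <= Num.max 0 lambda`_1.
Proof.
move=> k0; have tr : transitive (fun x y : K => y <= x).
  by move=> y z w h1 h2; apply: le_trans h2 h1.
have [kl|kl] := ltnP k (size lambda); last by rewrite nth_default // le_max lexx.
rewrite le_max; apply/orP; right.
by apply: (@sorted_leq_nth _ _ tr (fun x => lexx x) 0 _ lambda_sorted) => //;
  rewrite inE // (leq_ltn_trans k0).
Qed.

Section WithBasis.
Variable f : 'I_p -> 'I_p.+1 -> K.
Hypothesis f_mean : forall k, \sum_a f k a = 0.
Hypothesis f_orth : forall k l, \sum_a f k a * f l a = p.+1%:R * (k == l)%:R.
Hypothesis f_complete :
  forall a b, \sum_k f k a * f k b = p.+1%:R * (a == b)%:R - 1.
Hypothesis f_decomp : forall a b,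
  R a b = (lambda`_0 + \sum_(k < p) lambda`_k.+1 * (f k a * f k b)) / p.+1%:R.
Hypothesis f_eigen : forall k a, \sum_b R a b * f k b = lambda`_k.+1 * f k a.

Let q0 : 0 < p.+1%:R :> K. Proof. by rewrite ltr0n. Qed.

Lemma R_pair_weight a b : R a b = lambda`_0 / p.+1%:R * pair_weight lambda f a b.
Proof.
rewrite f_decomp /pair_weight mulrDr mulr1 mulrDl; congr (_ + _).
rewrite mulr_suml mulr_sumr; apply: eq_bigr => k _.
have l0 := head_gt0 (ord_bound_gt0 k).
by rewrite /eigen_ratio; field; rewrite !gt_eqF.
Qed.

(** For [p = 0] the sum is empty; otherwise [lambda_1] is positive and this is a multiple of
    an entry of [R]. *)
Lemma pair_weight_ge0 a b : 0 <= pair_weight lambda f a b.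
Proof.
have [p0|p0] := posnP p.
  rewrite /pair_weight big1 ?addr0 // => k _; exfalso.
  by have := ord_bound_gt0 k; rewrite p0.
have c0 : 0 < lambda`_0 / p.+1%:R by rewrite divr_gt0 // head_gt0.
by rewrite -(pmulr_rge0 _ c0) -R_pair_weight.
Qed.

Lemma pair_weight_quad x : \sum_i x i = 1 ->
  1 + \sum_k eigen_ratio lambda k * (\sum_i x i * f k i) ^+ 2
  = \sum_i \sum_j x i * pair_weight lambda f i j * x j.
Proof.
move=> x1.
have -> : \sum_i \sum_j x i * pair_weight lambda f i j * x j
   = \sum_i \sum_j x i * x j
     + \sum_i \sum_j \sum_k eigen_ratio lambda k * ((x i * f k i) * (x j * f k j)).
  rewrite -big_split /=; apply: eq_bigr => i _.
  rewrite -big_split /=; apply: eq_bigr => j _.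
  rewrite /pair_weight mulrDr mulrDl mulr1; congr (_ + _).
  by rewrite mulr_sumr mulr_suml; apply: eq_bigr => k _; ring.
congr (_ + _).
  by under eq_bigr do rewrite -mulr_sumr x1 mulr1.
under [RHS]eq_bigr do rewrite exchange_big /=.
rewrite exchange_big /=; apply: eq_bigr => k _.
rewrite expr2 mulr_suml mulr_sumr; apply: eq_bigr => i _.
by rewrite !mulr_sumr.
Qed.

(** The mean edge weight is at most [1], so the entropy inequality holds for every [c].  This
    also covers the case of a single type, where [lambda] has no second entry and the default value
    [0] is read. *)
Lemma equivalent_nonpos (a b : K) : lambda`_1 <= 0 ->
  equivalent_on a b (graph_number R) (asymptotic_number p.+1 lambda).
Proof.
move=> l1.
have rk (k : 'I_p) : eigen_ratio lambda k <= 0.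
  rewrite /eigen_ratio; apply: mulr_le0_ge0.
    by apply: le_trans (lambda_le (ltn0Sn k)) _; rewrite ge_max lexx.
  by rewrite invr_ge0 ltW // head_gt0 // (ord_bound_gt0 k).
have [b0|b0] := ltP b 0; first exact: equivalent_on_neg.
have bc : b < b + 1 by rewrite ltrDl.
apply: (equivalent_graph_number R_sym f_mean f_orth f_complete R_pair_weight pair_weight_ge0
  a b0 bc).
- by move=> k; have := rk k; nra.
- move=> x x0 x1; apply: (@le_trans _ _ 1); last first.
    rewrite -[leLHS]expR0 ler_expR divr_ge0 ?addr_ge0 //.
    by have H := entropy_ge0 (ltn0Sn p) x0 x1; apply: H.
  rewrite gerDl; apply: sumr_le0 => k _.
  by apply: mulr_le0_ge0 (sqr_ge0 _).
Qed.

Variable E : 'M[K]_(p.+1, p).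
Hypothesis E_ker : \rank (kermx E) = 1%N.
Hypothesis E_one : (const_mx 1 : 'rV[K]_p.+1) *m E = 0.

(** At the uniform law the Hessian form at the eigenvector [f k] is proportional to this
    number. *)
Lemma eigen_ratio_lt (c : K) (k : 'I_p) : 0 < c ->
  (forall x, simplex_interior x -> 0 < \det (hessian R E c x)) ->
  0 < 1 - 2 * c * eigen_ratio lambda k.
Proof.
move=> c0 det_gt0; have p0 := ord_bound_gt0 k; have mu0 := head_gt0 p0.
pose q : K := p.+1%:R; pose u : 'cV[K]_p.+1 := const_mx q^-1.
pose v : 'cV[K]_p.+1 := \col_i f k i.
have uint : simplex_interior u.
  split; first by move=> i; rewrite mxE invr_gt0.
  under eq_bigr do rewrite mxE.
  by rewrite sumr_const card_ord -[q^-1 *+ _]mulr_natl divff // gt_eqF.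
have v0 : \sum_i v i 0 = 0 by under eq_bigr do rewrite mxE.
have v2 : \sum_i f k i * f k i = q by rewrite f_orth eqxx mulr1.
have vnz : v != 0.
  apply/eqP => v00; have : q = 0.
    rewrite -v2 big1 // => i _; have := congr1 (fun w : 'cV_p.+1 => w i 0) v00.
    by rewrite !mxE => ->; rewrite mulr0.
  by apply/eqP; rewrite gt_eqF.
have := hessian_form_gt0 R_sym R_ge0 (irreducible_pos p0) E_one E_ker (ltW c0)
  det_gt0 uint v0 vnz.
have bvv : bilin R v v = lambda`_k.+1 * q.
  rewrite /bilin -v2 mulr_sumr; apply: eq_bigr => i _.
  rewrite mulrA -f_eigen mulr_suml; apply: eq_bigr => j _.
  by rewrite !mxE; ring.
have bvu : bilin R v u = 0.
  rewrite /bilin.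
  under eq_bigr => i _.
    under eq_bigr do rewrite !mxE.
    rewrite -mulr_suml -mulr_sumr (row_sum R_one).
    over.
  by rewrite -!mulr_suml f_mean !mul0r.
have buu : bilin R u u = lambda`_0 / q.
  rewrite /bilin.
  under eq_bigr => i _.
    under eq_bigr do rewrite !mxE.
    rewrite -mulr_suml -mulr_sumr (row_sum R_one).
    over.
  by rewrite sumr_const card_ord -[_ *+ p.+1]mulr_natl -/q; field; rewrite gt_eqF.
rewrite /hessian_form bvv bvu buu.
have -> : \sum_i v i 0 ^+ 2 / u i 0 = q * q.
  rewrite -{1}v2 mulr_suml; apply: eq_bigr => i _.
  by rewrite !mxE invrK expr2.
have -> : q * q + 2 * c / (lambda`_0 / q) * (2 / (lambda`_0 / q) * 0 ^+ 2 - lambda`_k.+1 * q)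
  = q * q * (1 - 2 * c * eigen_ratio lambda k).
  by rewrite /eigen_ratio; field; rewrite !gt_eqF.
by rewrite pmulr_rgt0 // mulr_gt0.
Qed.

Lemma equivalent_hessian (a b c : K) : (0 < p)%N -> b < c ->
  (forall x, simplex_interior x -> 0 < \det (hessian R E c x)) ->
  equivalent_on a b (graph_number R) (asymptotic_number p.+1 lambda).
Proof.
move=> p0 bc det_gt0.
have [b0|b0] := ltP b 0; first exact: equivalent_on_neg.
have c0 : 0 < c by apply: le_lt_trans bc.
apply: (equivalent_graph_number R_sym f_mean f_orth f_complete R_pair_weight pair_weight_ge0
  a b0 bc).
  by move=> k; apply: eigen_ratio_lt.
move=> x x0 x1; rewrite pair_weight_quad //.
have mu0 := head_gt0 p0.
have := entropy_bound R_sym R_ge0 (irreducible_pos p0) E_one E_ker c0 det_gt0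
  mu0 (row_sum R_one) x0 x1.
congr (_ <= _); rewrite /quad_sum mulr_sumr; apply: eq_bigr => i _.
rewrite mulr_sumr; apply: eq_bigr => j _; rewrite R_pair_weight.
by field; rewrite !gt_eqF.
Qed.

Lemma beta_le : 0 < lambda`_1 ->
  (beta R E <= (lambda`_0 / (2 * lambda`_1))%:E)%E.
Proof.
move=> l1; have p0 : (0 < p)%N.
  have := size_eigenvalues lambda_eigen; rewrite lt0n => sz; apply/eqP => p0.
  by move: l1; rewrite nth_default ?ltxx // sz p0.
have mu0 := head_gt0 p0.
apply: ub_ereal_sup => _ [c det_gt0 <-]; rewrite lee_fin.
have [c0|c0] := ltP 0 c; last first.
  by apply: le_trans c0 _; rewrite divr_ge0 ?mulr_ge0 // ltW.
have := eigen_ratio_lt (Ordinal p0) c0 det_gt0.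
rewrite /eigen_ratio /= => h; rewrite ler_pdivlMr ?mulr_gt0 //.
have : 0 < (1 - 2 * c * (lambda`_1 / lambda`_0)) * lambda`_0 by rewrite mulr_gt0.
have -> : (1 - 2 * c * (lambda`_1 / lambda`_0)) * lambda`_0
  = lambda`_0 - c * (2 * lambda`_1) by field; rewrite gt_eqF.
by rewrite subr_gt0 => /ltW.
Qed.

End WithBasis.
End NumberOfGraphs.

Theorem theorem12 (K : realType) (q : nat) (q_gt0 : (0 < q)%N)
    (R : 'M[K]_q) (R_sym : R^T = R) (R_ge0 : forall i j, 0 <= R i j)
    (R_irr : irreducible_matrix R)
    (lambda : seq K)
    (lambda_eigen : char_poly R = \prod_(x <- lambda) ('X - x%:P))
    (lambda_sorted : sorted (fun x y : K => y <= x) lambda)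
    (R_one : exists mu : K, R *m const_mx 1 = mu *: (const_mx 1 : 'cV[K]_q))
    (E : 'M[K]_(q, q.-1))
    (E_ker : \rank (kermx E) = 1%N)
    (E_one : (const_mx 1 : 'rV[K]_q) *m E = 0) :
  (forall a b : K, 0 < a -> (b%:E < beta R E)%E ->
     equivalent_on a b (graph_number R) (asymptotic_number q lambda))
  /\ (0 < lambda`_1 -> (beta R E <= (lambda`_0 / (2 * lambda`_1))%:E)%E)
  /\ (~ 0 < lambda`_1 -> forall a b : K, 0 < a ->
     equivalent_on a b (graph_number R) (asymptotic_number q lambda)).
Proof.
case: q q_gt0 R R_sym R_ge0 R_irr lambda_eigen R_one E E_ker E_one => [//|p] _ R
  R_sym R_ge0 R_irr lambda_eigen [mu R_mu] E E_ker E_one.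
have mu_head := head_eigenvalue R_sym R_ge0 R_mu lambda_eigen lambda_sorted.
have R_one : R *m const_mx 1 = lambda`_0 *: (const_mx 1 : 'cV[K]_p.+1).
  by rewrite mu_head.
have [f [f_mean f_orth f_complete f_decomp f_eigen]] :=
  mean_zero_eigenbasis R_sym R_ge0 R_one lambda_eigen lambda_sorted.
have nonpos a b : lambda`_1 <= 0 ->
    equivalent_on a b (graph_number R) (asymptotic_number p.+1 lambda).
  exact: equivalent_nonpos f_decomp _ _.
split; first last.
  split; first exact: beta_le f_eigen _ E_ker E_one.
  by move=> /negP; rewrite -leNgt => l1 a b _; apply: nonpos.
move=> a b _ hb; have [p0|p0] := posnP p.
  apply: nonpos; rewrite nth_default //.
  by rewrite (size_eigenvalues lambda_eigen) p0.
have [_ [c det_gt0 <-] bc] := ereal_sup_gt hb.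
exact: (equivalent_hessian R_sym R_ge0 R_irr R_one f_mean f_orth f_complete
  f_decomp f_eigen E_ker E_one a p0 bc det_gt0).
Qed.
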